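(* Given single-sink DAGs $G_1,G_2$ of fan-in at most $2$ with $n_1$ and $n_2$ vertices respectively, there are polynomial-time constructible single-sink DAGs $G_1\boxtimes G_2$ and $G_1\otimes G_2$ of fan-in at most $2$ and with $O((n_1+n_2)^2)$ vertices such that: (i) the standard pebbling price of $G_1\boxtimes G_2$ equals $\mathrm{Peb}(G_1)+\mathrm{Peb}(G_2)-1$; and (ii) the reversible pebbling price of $G_1\otimes G_2$ equals $\mathrm{RPeb}(G_1)+\mathrm{RPeb}(G_2)+1$, where $\mathrm{Peb}$ and $\mathrm{RPeb}$ denote standard and reversible pebbling price.
   Context: All graphs are finite DAGs; $\mathrm{pred}(v)$ is the set of immediate predecessors of $v$. A standard pebbling is a sequence of vertex sets $P_0,\dots,P_\tau$, each obtained from the previous by placing a pebble on some $v\notin P$ with $\mathrm{pred}(v)\subseteq P$ or removing a pebble from any $v\in P$. A reversible pebbling is the same but removal from $v$ is allowed only if $\mathrm{pred}(v)\subseteq P$. Space is $\max_t|P_t|$. For a DAG with unique sink $z$, $\mathrm{Peb}$ (resp. $\mathrm{RPeb}$) is the minimum space of a standard (resp. reversible) pebbling from $\emptyset$ to $\{z\}$. *)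

(* Defs.v *)
From mathcomp Require Import all_boot.
From mathcomp Require Import boolp.

Set Implicit Arguments.
Unset Strict Implicit.
Unset Printing Implicit Defensive.

Section PebbleGames.
Variables (V : finType) (e : rel V).
Implicit Types (P Q D B : {set V}) (v z : V).

Definition preds v : {set V} := [set u | e u v].

Definition acyclic : Prop := forall p : seq V, cycle e p -> p = [::].

Definition std_move : rel {set V} := fun P Q =>
  [exists v, [&& v \notin P, preds v \subset P & Q == v |: P]] ||
  [exists v, (v \in P) && (Q == P :\ v)].

Definition rev_move : rel {set V} := fun P Q =>
  [exists v, [&& v \notin P, preds v \subset P & Q == v |: P]] ||
  [exists v, [&& v \in P, preds v \subset P & Q == P :\ v]].

(* The sequence P_0, ..., P_tau is represented by the list p of P_1, ...,
   P_tau, since P_0 is always the empty set. *)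
Definition pebbling (move : rel {set V}) z (p : seq {set V}) : Prop :=
  path move set0 p /\ last set0 p = [set z].

Definition space (p : seq {set V}) : nat := \max_(P <- set0 :: p) #|P|.

Definition pebbling_space (move : rel {set V}) z : pred nat := fun s =>
  `[< exists2 p, pebbling move z p & space p = s >].

Hypothesis acyc : acyclic.

Lemma acyclic_maximal D : D != set0 ->
  exists2 v, v \in D & forall w, w \in D -> ~~ e v w.
Proof.
case/set0Pn=> v0 v0D.
case: (arg_minnP (fun v => #|[set w | connect e v w]|) v0D) => v vD vmin.
exists v => // w wD; apply/negP => evw.
have := vmin w wD; rewrite leqNgt => /negP; apply; apply: proper_card.
apply/properP; split.
  by apply/subsetP=> x; rewrite !inE; apply: connect_trans; apply: connect1.
exists v; rewrite !inE ?connect0 //; apply/negP => /connectP[q qP qv].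
have := acyc (p := v :: belast w q).
suff -> : cycle e (v :: belast w q) by move=> /(_ isT).
by rewrite /= [X in rcons _ X]qv -lastI /= evw.
Qed.

Lemma connect_rev_downset B D : (forall u v, e u v -> v \in D -> u \in D) ->
  connect rev_move B (B :|: D).
Proof.
have [n] := ubnP #|D|; elim: n D => // n IHn D Dn Dcl.
have [->|D0] := eqVneq D set0; first by rewrite setU0 connect0.
have [v vD vmax] := acyclic_maximal D0.
have {}IHn : connect rev_move B (B :|: D :\ v).
  apply: IHn => [|x y exy].
    by move: Dn; rewrite (cardsD1 v) vD.
  rewrite !inE => /andP[yv yD]; rewrite (Dcl _ _ exy yD) andbT.
  by apply: contraTneq exy => ->; apply: vmax.
have UE : B :|: D = v |: (B :|: D :\ v).
  by rewrite setUCA setD1K.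
have [vB|vB] := boolP (v \in B :|: D :\ v).
  by rewrite UE (setUidPr _) // sub1set.
apply: (connect_trans IHn); apply: connect1; apply/orP; left.
apply/existsP; exists v; rewrite vB UE eqxx andbT.
apply/subsetP=> u; rewrite !inE => euv; rewrite (Dcl _ _ euv vD) andbT.
by apply/orP; right; apply: contraTneq euv => ->; apply: vmax.
Qed.

Lemma rev_move_sym : symmetric rev_move.
Proof.
suff H P Q : rev_move P Q -> rev_move Q P by move=> P Q; apply/idP/idP; apply: H.
have predsD v : v \notin preds v.
  apply/negP; rewrite inE => evv; have := acyc (p := [:: v]).
  by rewrite /= evv => /(_ isT).
case/orP=> /existsP[v /and3P[vP sP /eqP->]]; apply/orP; [right|left];
  apply/existsP; exists v.
  by rewrite setU11 setU1K // eqxx andbT (subset_trans sP) // subsetUr.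
rewrite setD11 setD1K // eqxx andbT /= subsetD1 sP /=.
exact: predsD.
Qed.

Lemma ex_rev_pebbling z : exists s, pebbling_space rev_move z s.
Proof.
have H B : connect rev_move B setT.
  by rewrite -(setUT B); apply: connect_rev_downset => u v; rewrite !inE.
have : connect rev_move set0 [set z].
  by apply: connect_trans (H _) _; rewrite (sym_connect_sym rev_move_sym).
case/connectP=> p pP pz; exists (space p); apply/asboolP; exists p => //.
Qed.

Lemma ex_std_pebbling z : exists s, pebbling_space std_move z s.
Proof.
have [s /asboolP[p [pP pz] ps]] := ex_rev_pebbling z.
exists s; apply/asboolP; exists p => //; split=> //.
apply: sub_path pP => P Q; rewrite /rev_move /std_move.
case/orP=> [->//|/existsP[v /and3P[vP _ QE]]]; apply/orP; right.
by apply/existsP; exists v; rewrite vP.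
Qed.

End PebbleGames.

Record ssdag := SSDag {
  nvert : nat;
  edge : rel 'I_nvert;
  edge_acyclic : acyclic edge;
  sink : 'I_nvert;
  sinkP : forall v : 'I_nvert, (forall w, ~~ edge v w) <-> v = sink;
  fan_in_le2 : forall v : 'I_nvert, #|preds edge v| <= 2
}.

Definition Peb (G : ssdag) : nat :=
  ex_minn (ex_std_pebbling (@edge_acyclic G) (sink G)).

Definition RPeb (G : ssdag) : nat :=
  ex_minn (ex_rev_pebbling (@edge_acyclic G) (sink G)).

(* Polynomial time is measured on a random access machine with unit cost, the
   arithmetic being limited to addition and truncated subtraction.  A run of t
   steps then only creates numbers that are at most t bits longer than the
   numbers in its input and program, so that this machine and the Turing machine
   simulate each other with polynomial overhead.  The memory cells X_0, X_1, ...
   hold natural numbers and are initially 0; control flow is structured instead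
   of given by jumps. *)
Inductive cmd : Type :=
  | CConst (i c : nat)
  | CAdd (i j k : nat)
  | CSub (i j k : nat)
  | CLoad (i j : nat)
  | CStore (i j : nat)
  | CRead (i : nat)
  | CPrint (i : nat)
  | CSeq (c1 c2 : cmd)
  | CIf (i : nat) (c1 c2 : cmd)
  | CWhile (i : nat) (c : cmd).

Record state := State {
  cell : nat -> nat;
  input : seq nat;
  output : seq nat
}.

Definition set_cell (s : state) (a x : nat) : state :=
  State (fun b => if b == a then x else cell s b) (input s) (output s).

(* exec c s t s' : started in state s, the program c halts in state s' after
   t steps. *)
Inductive exec : cmd -> state -> nat -> state -> Prop :=
  | exec_const i c s : exec (CConst i c) s 1 (set_cell s i c)
  | exec_add i j k s :
      exec (CAdd i j k) s 1 (set_cell s i (cell s j + cell s k))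
  | exec_sub i j k s :
      exec (CSub i j k) s 1 (set_cell s i (cell s j - cell s k))
  | exec_load i j s : exec (CLoad i j) s 1 (set_cell s i (cell s (cell s j)))
  | exec_store i j s : exec (CStore i j) s 1 (set_cell s (cell s i) (cell s j))
  | exec_read i s :
      exec (CRead i) s 1
        (set_cell (State (cell s) (behead (input s)) (output s))
           i (head 0 (input s)))
  | exec_print i s :
      exec (CPrint i) s 1
        (State (cell s) (input s) (rcons (output s) (cell s i)))
  | exec_seq c1 c2 s1 s2 s3 t1 t2 :
      exec c1 s1 t1 s2 -> exec c2 s2 t2 s3 -> exec (CSeq c1 c2) s1 (t1 + t2) s3
  | exec_if_true i c1 c2 s s' t :
      0 < cell s i -> exec c1 s t s' -> exec (CIf i c1 c2) s t.+1 s'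
  | exec_if_false i c1 c2 s s' t :
      cell s i = 0 -> exec c2 s t s' -> exec (CIf i c1 c2) s t.+1 s'
  | exec_while_true i c s1 s2 s3 t1 t2 :
      0 < cell s1 i -> exec c s1 t1 s2 -> exec (CWhile i c) s2 t2 s3 ->
      exec (CWhile i c) s1 (t1 + t2).+1 s3
  | exec_while_false i c s : cell s i = 0 -> exec (CWhile i c) s 1 s.

Definition init (w : seq nat) : state := State (fun=> 0) w [::].

(* The number of vertices followed by the adjacency matrix in row-major order:
   the encoding is self-delimiting and has length nvert G ^ 2 + 1. *)
Definition encode (G : ssdag) : seq nat :=
  nvert G ::
  [seq nat_of_bool (edge u v) | u <- enum 'I_(nvert G), v <- enum 'I_(nvert G)].

Definition poly_time_constructible (f : ssdag -> ssdag -> ssdag) : Prop :=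
  exists (c : cmd) (d : nat), forall G1 G2 : ssdag,
    let w := encode G1 ++ encode G2 in
    exists (t : nat) (s : state),
      [/\ exec c (init w) t s, output s = encode (f G1 G2)
        & t <= d * size w ^ d].

(* Main.v *)
(* Both products replace every vertex v of G1, with predecessors u and w, by a
   copy of a toll graph built from G2, whose last vertex z leads to a gate
   p = (z, c_u), q = (c_u, c_w), c = (p, q); the vertex c_v plays the role of v.
   Pebbling G1 on the vertices c and paying each toll once per move gives the
   upper bounds.

   Conversely, a pebbling of the product is projected to G1.  Whenever a toll is
   paid, almost the whole budget lies in one toll graph, so the pebbles elsewhere
   are few.  Each pebble on p, q or c, and each partially paid toll, is charged to
   one vertex of G1, and the charged vertices contain the configuration of G1 that
   is being simulated.  In the standard game this configuration is carried along as
   an invariant.  In the reversible game one considers the stretches between two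
   changes of the set of loaded tolls: either the vertices met along a stretch fit
   into the budget, or the charging is injective at both ends, which forces the two
   ends to coincide.

   The reversible toll is G2 subdivided twice, each subdivision raising the
   reversible price by exactly one.  The standard gate fits into the budget only if
   Peb(G2) >= 3, that is if G2 has a vertex of indegree 2; when neither graph has
   one, both are paths and a transitive tournament on at most 3 vertices does. *)

Require Import Defs.
From mathcomp Require Import all_boot.
From mathcomp Require boolp.
From mathcomp Require Import zify.

Set Implicit Arguments.
Unset Strict Implicit.
Unset Printing Implicit Defensive.

(** * Space-bounded games *)

(** The gate is wired so that whichever of [p] and [q] moves second at v shows both predecessors of
    v: [q] has [c_u] and [c_w] below it, while [p] has [c_u] below it and finds w recorded by the
    pebble on [q]. The pair then stands for a pebble on v, and its appearance is a legal move of G1.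
    The constants are read off the peak at one gate, while at most price(G1) - 1 vertices are held
    elsewhere. A standard toll takes Peb(G2) pebbles and shrinks to [z] before the gate is used. A
    reversible toll cannot be discarded: [p] is removed only over [z], and [z] only over its
    predecessors. So up to RPeb(G2) - 1 pebbles around the sink of G2 stay beside three gate
    pebbles. Two subdivisions make this surrounding set dearer to reach without enlarging it. The
    obstacle to the lower bounds is that gate moves are not budgeted by themselves: while no toll is
    being paid, the projection may use the whole space of the product. Only the moments at which a
    toll passes its price bound the rest, so the invariants speak about these moments. *)

(* Only vertices of [A] may be pebbled, idle steps are allowed, and a standard
   step may drop any number of pebbles at once. *)
Definition sst (V : finType) (e : rel V) (A : {set V}) (s : nat) :
    rel {set V} := fun P Q =>
  [&& #|P| <= s, #|Q| <= s &
    (Q \subset P) ||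
    [exists v, [&& v \in A, preds e v \subset P & Q == v |: P]]].

(** Comparing [P] and [Q] away from [v] treats placing, removing and idling alike, so that
    reversibility is built into the form of the relation. *)
Definition rst (V : finType) (e : rel V) (A : {set V}) (s : nat) :
    rel {set V} := fun P Q =>
  [&& #|P| <= s, #|Q| <= s &
    [exists v, [&& v \in A, preds e v \subset P :\ v & P :\ v == Q :\ v]]].

Lemma rst_sym (V : finType) (e : rel V) A s : symmetric (rst e A s).
Proof.
suff H P Q : rst e A s P Q -> rst e A s Q P by move=> P Q; apply/idP/idP; apply: H.
case/and3P=> sP sQ /existsP[v /and3P[vA pv /eqP PQ]].
by rewrite /rst sP sQ; apply/existsP; exists v; rewrite vA -PQ pv eqxx.
Qed.

Lemma connect_rst_sym (V : finType) (e : rel V) A s P Q :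
  connect (rst e A s) P Q -> connect (rst e A s) Q P.
Proof. by rewrite (sym_connect_sym (@rst_sym V e A s)). Qed.

Lemma setD1_id (V : finType) (v : V) (P : {set V}) : v \notin P -> P :\ v = P.
Proof. by move=> vP; apply/setDidPl; rewrite disjoint_sym disjoints1. Qed.

Lemma setD1_eq (V : finType) (v : V) (P Q : {set V}) : P :\ v = Q :\ v ->
  [\/ P = Q, v \notin P /\ Q = v |: P | v \notin Q /\ P = v |: Q].
Proof.
move=> PQ; have [vP|vP] := boolP (v \in P); have [vQ|vQ] := boolP (v \in Q).
- by constructor 1; rewrite -(setD1K vP) PQ setD1K.
- constructor 3; split=> //; rewrite -(setD1K vP) PQ; congr (_ |: _).
  exact: setD1_id.
- constructor 2; split=> //; rewrite -(setD1K vQ) -PQ; congr (_ |: _).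
  exact: setD1_id.
- by constructor 1; move: PQ; rewrite !setD1_id.
Qed.

Lemma rst_sst (V : finType) (e : rel V) A s : subrel (rst e A s) (sst e A s).
Proof.
move=> P Q /and3P[sP sQ /existsP[v /and3P[vA pv /eqP PQ]]].
rewrite /sst sP sQ /=.
case: (setD1_eq PQ) => [->|[vP QE]|[vQ ->]]; first by rewrite subxx.
  apply/orP; right; apply/existsP; exists v; rewrite vA QE eqxx andbT.
  by apply: subset_trans pv _; apply: subD1set.
by rewrite subsetUr.
Qed.

Lemma connect_mono (T : finType) (r r' : rel T) x y :
  subrel r r' -> connect r x y -> connect r' x y.
Proof.
move=> H; apply: connect_sub => a b ab; apply: connect1; exact: H.
Qed.

Lemma connect_ind (T : finType) (r : rel T) (I : T -> Prop) x y :
  (forall a b, r a b -> I a -> I b) -> connect r x y -> I x -> I y.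
Proof.
move=> H /connectP[p pP ->]; elim: p x pP => //= b p IH a /andP[ab pP] Ia.
exact: IH pP (H _ _ ab Ia).
Qed.

(** The simulation principle behind the transports and the upper bounds: only single moves have to
    be translated. *)
Lemma connect_homo (T T' : finType) (r : rel T) (r' : rel T') (f : T -> T') x y :
  (forall a b, r a b -> connect r' (f a) (f b)) ->
  connect r x y -> connect r' (f x) (f y).
Proof.
move=> H xy; apply: (connect_ind (I := fun a => connect r' (f x) (f a))) xy _ => //.
by move=> a b ab xa; apply: connect_trans xa (H _ _ ab).
Qed.

Lemma rst_leq (V : finType) (e : rel V) A s s' :
  s <= s' -> subrel (rst e A s) (rst e A s').
Proof.
by move=> le P Q /and3P[sP sQ H]; rewrite /rst H !(leq_trans _ le).
Qed.

Section PriceConnect.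
Variables (V : finType) (mv r : rel {set V}) (z : V) (s : nat).
Hypothesis mv_r : forall P Q, mv P Q -> #|P| <= s -> #|Q| <= s -> r P Q.
Hypothesis r_mv : forall P Q, r P Q ->
  exists p, [/\ path mv P p, last P p = Q & all (fun X : {set V} => #|X| <= s) p].

Lemma space_leE (p : seq {set V}) :
  (space p <= s) = all (fun X : {set V} => #|X| <= s) p.
Proof.
rewrite /space; apply/bigmax_leqP_seq/allP => [H P Pp|H P].
  by apply: H => //; rewrite inE Pp orbT.
by rewrite inE => /predU1P[->|Pp] _; [rewrite cards0 | apply: H].
Qed.

Lemma pebbling_connect :
  (exists p, pebbling mv z p /\ space p <= s) <-> connect r set0 [set z].
Proof.
split=> [[p [[pP <-]]]|].
  rewrite space_leE => ps.
  have : #|(set0 : {set V})| <= s by rewrite cards0.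
  elim: p set0 pP ps => [|Q p IH] P /= => [_ _ _|]; first exact: connect0.
  case/andP=> PQ pP /andP[sQ sp] sP.
  by apply: connect_trans (IH _ pP sp sQ); apply: connect1; apply: mv_r.
move=> H; pose I P := exists p, [/\ path mv set0 p, last set0 p = P
  & all (fun X : {set V} => #|X| <= s) p].
have [p [pP pl pa]] : I [set z].
  apply: (connect_ind (I := I)) H _; last by exists [::].
  move=> P Q /r_mv[q [qP qQ qa]] [p [pP pl pa]]; exists (p ++ q).
  by rewrite cat_path pP pl qP last_cat pl qQ all_cat pa qa.
by exists p; rewrite space_leE.
Qed.

(** Turns a minimum over move sequences into reachability between two configurations; prices enter
    the argument only in this form. *)
Lemma min_space_connect (H : exists n, pebbling_space mv z n) :
  ex_minn H <= s <-> connect r set0 [set z].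
Proof.
rewrite -pebbling_connect; case: ex_minnP => m /boolp.asboolP[p pP pm] mmin; split.
  by move=> ms; exists p; rewrite pm.
case=> q [qP qs]; apply: leq_trans qs; apply: mmin; apply/boolp.asboolP; by exists q.
Qed.

End PriceConnect.

Lemma acyclic_irr (V : finType) (e : rel V) : acyclic e -> irreflexive e.
Proof.
by move=> ac v; apply/negP=> vv; have := ac [:: v]; rewrite /= vv => /(_ isT).
Qed.

Lemma RPeb_leP (G : ssdag) s :
  RPeb G <= s <-> connect (rst (@edge G) setT s) set0 [set sink G].
Proof.
apply: min_space_connect => P Q.
  move=> PQ sP sQ; rewrite /rst sP sQ /=; apply/existsP.
  case/orP: PQ => /existsP[v /and3P[vP sv /eqP->]]; exists v; rewrite inE /=.
    by rewrite setU1K // setD1_id // sv eqxx.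
  rewrite subsetD1 sv inE (acyclic_irr (@edge_acyclic G)) /=.
  by apply/eqP/setP=> x; rewrite !inE; case: (x == v).
case/and3P=> sP sQ /existsP[v /and3P[_ pv /eqP PQ]].
case: (setD1_eq PQ) => [->|[vP QE]|[vQ PE]]; first by exists [::].
  exists [:: Q]; rewrite /= sQ !andbT; split=> //; apply/orP; left.
  apply/existsP; exists v; rewrite vP QE eqxx andbT /=.
  by apply: subset_trans pv _; apply: subD1set.
exists [:: Q]; rewrite /= sQ !andbT; split=> //; apply/orP; right.
apply/existsP; exists v; rewrite PE setU11 setU1K // eqxx andbT /=.
by rewrite PE in pv; apply: subset_trans pv _; apply: subD1set.
Qed.

Lemma std_path_sub (V : finType) (e : rel V) s (P Q : {set V}) :
  Q \subset P -> #|P| <= s ->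
  exists p, [/\ path (std_move e) P p, last P p = Q
    & all (fun X : {set V} => #|X| <= s) p].
Proof.
have [n] := ubnP #|P|; elim: n P => // n IH P Pn QP sP.
have [->|PQ] := eqVneq P Q; first by exists [::].
have /properP[_ [v vP vQ]] : Q \proper P by rewrite properEneq eq_sym PQ.
have vcard : #|P :\ v| < #|P| by rewrite [X in _ < X](cardsD1 v) vP.
have [||p [pP pl pa]] := IH (P :\ v) (leq_trans vcard Pn).
- by rewrite subsetD1 QP.
- exact: leq_trans (ltnW vcard) sP.
exists (P :\ v :: p); rewrite /= pP pl pa (leq_trans (ltnW vcard) sP) /=.
split=> //; rewrite andbT; apply/orP; right; apply/existsP; exists v.
by rewrite vP eqxx.
Qed.

Lemma Peb_leP (G : ssdag) s :
  Peb G <= s <-> connect (sst (@edge G) setT s) set0 [set sink G].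
Proof.
apply: min_space_connect => P Q.
  move=> PQ sP sQ; rewrite /sst sP sQ /=; apply/orP.
  case/orP: PQ => /existsP[v]; last by case/andP=> _ /eqP->; left; apply: subD1set.
  by case/and3P=> vP sv /eqP->; right; apply/existsP; exists v; rewrite inE sv /=.
case/and3P=> sP sQ /orP[QP|/existsP[v /and3P[_ pv /eqP QE]]].
  exact: std_path_sub.
have [vP|vP] := boolP (v \in P).
  by exists [::]; rewrite QE (setUidPr _) // sub1set.
exists [:: Q]; rewrite /= sQ !andbT; split=> //; apply/orP; left.
by apply/existsP; exists v; rewrite vP pv QE eqxx.
Qed.

(** * Transport of games along injections *)

Section Embedding.
Variables (V W : finType) (e : rel V) (e' : rel W) (f : V -> W).
Hypothesis f_inj : injective f.
Hypothesis f_preds : forall v, preds e' (f v) = f @: preds e v.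

Lemma imset_setD1 v (P : {set V}) : f @: (P :\ v) = (f @: P) :\ f v.
Proof.
apply/setP=> x; rewrite in_setD1; apply/imsetP/andP => [[y yP ->]|[xv /imsetP[y yP xy]]].
  move: yP; rewrite in_setD1 => /andP[yv yP]; rewrite (inj_eq f_inj) yv.
  by split=> //; apply: imset_f.
exists y => //; rewrite in_setD1 yP andbT; apply: contraNneq xv => <-.
by rewrite xy.
Qed.

Lemma rst_emb (A : {set V}) s P Q :
  connect (rst e A s) P Q -> connect (rst e' (f @: A) s) (f @: P) (f @: Q).
Proof.
apply: (connect_homo (f := fun X : {set V} => f @: X)) => {}P {}Q /and3P[sP sQ].
case/existsP=> v /and3P[vA pv /eqP PQ]; apply: connect1.
rewrite /rst !card_imset // sP sQ /=; apply/existsP; exists (f v).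
by rewrite imset_f // -!imset_setD1 f_preds imsetS // PQ eqxx.
Qed.

Lemma sst_emb (A : {set V}) s P Q :
  connect (sst e A s) P Q -> connect (sst e' (f @: A) s) (f @: P) (f @: Q).
Proof.
apply: (connect_homo (f := fun X : {set V} => f @: X)) => {}P {}Q /and3P[sP sQ PQ]; apply: connect1.
rewrite /sst !card_imset // sP sQ /=; case/orP: PQ => [QP|]; first by rewrite imsetS.
case/existsP=> v /and3P[vA pv /eqP ->]; apply/orP; right.
apply/existsP; exists (f v).
by rewrite imset_f // f_preds imsetS // imsetU1 eqxx.
Qed.

Lemma card_preimset_le (P : {set W}) : #|f @^-1: P| <= #|P|.
Proof.
rewrite -(card_imset _ f_inj); apply: subset_leq_card.
by apply/subsetP=> x /imsetP[y]; rewrite inE => yP ->.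
Qed.

Lemma preds_preim v (P : {set W}) : preds e' (f v) \subset P ->
  preds e v \subset f @^-1: P.
Proof.
move=> sP; apply/subsetP=> u uv; rewrite inE; apply: (subsetP sP).
by rewrite f_preds imset_f.
Qed.

Lemma rst_preim (A : {set V}) s P Q :
  connect (rst e' (f @: A) s) P Q -> connect (rst e A s) (f @^-1: P) (f @^-1: Q).
Proof.
apply: (connect_homo (f := fun X : {set W} => f @^-1: X)) => {}P {}Q /and3P[sP sQ]; case/existsP=> x /and3P[].
case/imsetP=> v vA -> pv /eqP PQ; apply: connect1; rewrite /rst.
rewrite !(leq_trans (card_preimset_le _)) //=; apply/existsP; exists v.
have H (X : {set W}) : f @^-1: (X :\ f v) = f @^-1: X :\ v.
  by apply/setP=> y; rewrite !inE (inj_eq f_inj).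
by rewrite vA -!H PQ eqxx andbT /= preds_preim // -PQ.
Qed.

Lemma sst_preim (A : {set V}) s P Q :
  connect (sst e' (f @: A) s) P Q -> connect (sst e A s) (f @^-1: P) (f @^-1: Q).
Proof.
apply: (connect_homo (f := fun X : {set W} => f @^-1: X)) => {}P {}Q /and3P[sP sQ PQ]; apply: connect1; rewrite /sst.
rewrite !(leq_trans (card_preimset_le _)) //=.
case/orP: PQ => [QP|]; first by rewrite preimsetS.
case/existsP=> x /and3P[/imsetP[v vA ->] pv /eqP ->]; apply/orP; right.
apply/existsP; exists v; rewrite vA preds_preim //=.
by apply/eqP/setP=> y; rewrite !inE (inj_eq f_inj).
Qed.

End Embedding.

(** * Ranks, sinks and the indegree bound *)

Section Rank.
Variables (V : finType) (e : rel V).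

Lemma acyclic_of_rank (r : V -> nat) :
  (forall u v, e u v -> r u < r v) -> acyclic e.
Proof.
move=> er [//|x p] /= px; exfalso.
have H q y : path e y q -> r y <= r (last y q) /\ (q != [::] -> r y < r (last y q)).
  elim: q y => //= a q IH y /andP[ya /IH[H _]]; have := er _ _ ya; lia.
have [_ F] := H _ _ px; have /F : rcons p x != [::] by case: (p).
by rewrite last_rcons ltnn.
Qed.

Definition anc_rank v := #|[set u | connect e u v]|.

Lemma anc_rankP : acyclic e -> forall u v, e u v -> anc_rank u < anc_rank v.
Proof.
move=> ac u v uv; apply: proper_card; apply/properP; split.
  by apply/subsetP=> x; rewrite !inE => xu; apply: connect_trans xu (connect1 uv).
exists v; rewrite !inE ?connect0 //; apply/negP => /connectP[q qP qv].
have := ac (u :: belast v q).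
suff -> : cycle e (u :: belast v q) by move=> /(_ isT).
by rewrite /= [X in rcons _ X]qv -lastI /= uv.
Qed.

End Rank.

Lemma connect_sink (G : ssdag) (v : 'I_(nvert G)) : connect (@edge G) v (sink G).
Proof.
have [|w] := @acyclic_maximal _ _ (@edge_acyclic G) [set w | connect (@edge G) v w].
  by apply/set0Pn; exists v; rewrite inE connect0.
rewrite inE => vw wmax; have <- // : w = sink G; apply/sinkP => x.
apply/negP=> wx; have := wmax x; rewrite wx inE => /(_ _)/negP; apply => //.
exact: connect_trans vw (connect1 wx).
Qed.

(** With at most as many pebbles as [v] has predecessors, [v] can never be pebbled, since it would
    have to stand beside all of them. Hence no descendant of [v] is ever pebbled, and the sink is a
    descendant of every vertex. *)
Lemma sst_indegree (G : ssdag) s (v : 'I_(nvert G)) :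
  connect (sst (@edge G) setT s) set0 [set sink G] -> #|preds (@edge G) v| < s.
Proof.
move=> H; rewrite ltnNge; apply/negP => sv.
suff : forall x, x \in [set sink G] -> ~~ connect (@edge G) v x.
  by move=> /(_ (sink G)); rewrite inE eqxx connect_sink => /(_ isT).
apply: (connect_ind (I := fun P : {set 'I_(nvert G)} =>
  forall x, x \in P -> ~~ connect (@edge G) v x)) H _; last by move=> x; rewrite inE.
move=> P Q /and3P[sP sQ /orP[QP|ex]] IP x; first by move/(subsetP QP); apply: IP.
case/existsP: ex => y /and3P[_ py /eqP QE]; rewrite QE => /setU1P[xy|]; last exact: IP.
subst y; apply/negP => /connectP[p pP px].
case/lastP: p pP px => [_ /= xv|p a].
  subst x; move: sQ; rewrite QE cardsU1.
  case: (boolP (v \in P)) => [vP|vP]; first by have := IP v vP; rewrite connect0.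
  have := subset_leq_card py; lia.
rewrite rcons_path last_rcons => /andP[pP pa] xa; subst a.
have : last v p \in P by apply: (subsetP py); rewrite inE.
by move/IP/negP; apply; apply/connectP; exists p.
Qed.

Lemma Peb_indegree (G : ssdag) (v : 'I_(nvert G)) : #|preds (@edge G) v| < Peb G.
Proof. by apply: sst_indegree; apply/Peb_leP. Qed.

Lemma RPeb_indegree (G : ssdag) (v : 'I_(nvert G)) : #|preds (@edge G) v| < RPeb G.
Proof.
apply: sst_indegree; have /RPeb_leP := leqnn (RPeb G).
by apply: connect_mono; apply: rst_sst.
Qed.

Lemma sink_pred (G : ssdag) : 1 < nvert G -> 0 < #|preds (@edge G) (sink G)|.
Proof.
move=> n1; apply/card_gt0P.
have [v vs] : exists v : 'I_(nvert G), v != sink G.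
  pose a := Ordinal (ltnW n1); pose b := Ordinal n1.
  have [sa|sa] := eqVneq (sink G) a; last by exists a; rewrite eq_sym.
  by exists b; rewrite sa.
have /connectP[p pP pl] := connect_sink v.
case/lastP: p pP pl => [_ /= E|p a]; first by rewrite E eqxx in vs.
rewrite rcons_path last_rcons => /andP[_ H] ->; by exists (last v p); rewrite inE.
Qed.

Lemma Peb_le_nvert (G : ssdag) : Peb G <= nvert G.
Proof.
apply/Peb_leP; have /Peb_leP := leqnn (Peb G).
apply: connect_mono => P Q; case/and3P=> _ _ H; rewrite /sst H andbT.
have C (X : {set 'I_(nvert G)}) : #|X| <= nvert G.
  by apply: leq_trans (max_card _) _; rewrite card_ord.
by rewrite !C.
Qed.

(** * Surrounding the sink in the reversible game *)

Section Surround.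
Variables (V : finType) (e : rel V).

Lemma rst_card A s P : connect (rst e A s) set0 P -> #|P| <= s.
Proof.
move=> H; apply: (connect_ind (I := fun P : {set V} => #|P| <= s)) H _; last by rewrite cards0.
by move=> X Y /and3P[].
Qed.

Lemma rst_subset A s P : connect (rst e A s) set0 P -> P \subset A.
Proof.
move=> H; apply: (connect_ind (I := fun P : {set V} => P \subset A)) H _; last exact: sub0set.
move=> X Y /and3P[_ _ /existsP[v /and3P[vA _ /eqP XY]]] XA; apply/subsetP=> y yY.
have [->//|yv] := eqVneq y v; apply: (subsetP XA).
have : y \in Y :\ v by rewrite in_setD1 yv.
by rewrite -XY in_setD1 => /andP[].
Qed.

Lemma rst_allowed (A B : {set V}) s : A \subset B -> subrel (rst e A s) (rst e B s).
Proof.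
move=> AB P Q /and3P[sP sQ /existsP[v /and3P[vA H1 H2]]].
rewrite /rst sP sQ; apply/existsP; exists v; by rewrite (subsetP AB) // H1.
Qed.

Lemma rst_toggle (A : {set V}) s v (P Q : {set V}) : v \in A -> #|P| <= s -> #|Q| <= s ->
  preds e v \subset P :\ v -> P :\ v = Q :\ v -> rst e A s P Q.
Proof.
move=> vA sP sQ pv PQ; rewrite /rst sP sQ; apply/existsP; exists v.
by rewrite vA pv PQ eqxx.
Qed.

(** Run the pebbling backwards from [[set t]]. As long as [t] keeps its pebble, the others play a
    game of their own with one pebble less, undisturbed because [t] has no successor. The end is
    empty, so [t] is removed at some point, and at that point its predecessors are pebbled. *)
Lemma surround_of_price t s : (forall w, ~~ e t w) ->
  connect (rst e setT s.+1) set0 [set t] ->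
  exists2 C : {set V}, preds e t \subset C & connect (rst e [set~ t] s) set0 C.
Proof.
move=> tmax /connect_rst_sym H.
pose I (P : {set V}) := (t \in P /\ connect (rst e [set~ t] s) set0 (P :\ t)) \/
  exists2 C : {set V}, preds e t \subset C & connect (rst e [set~ t] s) set0 C.
suff : I set0 by case=> [[]|//]; rewrite inE.
apply: (connect_ind (I := I)) H _; last first.
  by left; rewrite set11 setDv connect0.
move=> P Q /and3P[sP sQ /existsP[v /and3P[_ pv /eqP PQ]]] [[tP IP]|]; last by right.
have [vt|vt] := eqVneq v t; first by subst v; right; exists (P :\ t).
have tQ : t \in Q.
  have : t \in P :\ v by rewrite in_setD1 eq_sym vt.
  by rewrite PQ in_setD1 => /andP[].
left; split=> //; apply: connect_trans IP _; apply: connect1.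
move: sP sQ; rewrite (cardsD1 t P) (cardsD1 t Q) tP tQ !add1n !ltnS => sP sQ.
apply: (@rst_toggle _ _ v) => //.
- by rewrite !inE.
- rewrite setDDl setUC -setDDl subsetD1 pv inE; exact: tmax.
- by rewrite setDDl setUC -setDDl PQ setDDl setUC -setDDl.
Qed.

(** Reach [C], place [t], and undo the way to [C] beside the pebble on [t], which is the one extra
    pebble. *)
Lemma price_of_surround t s (C : {set V}) : preds e t \subset C ->
  connect (rst e [set~ t] s) set0 C -> connect (rst e setT s.+1) set0 [set t].
Proof.
move=> pt H; have tC : t \notin C.
  by apply/negP=> /(subsetP (rst_subset H)); rewrite !inE eqxx.
have sC := rst_card H.
have H1 : connect (rst e setT s.+1) set0 C.
  apply: connect_mono H => X Y XY; apply: (rst_leq (leqnSn s)).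
  by apply: rst_allowed XY; apply: subsetT.
apply: (connect_trans H1); apply: (@connect_trans _ _ (t |: C)).
  apply: connect1; apply: (@rst_toggle _ _ t) => //.
  - exact: leqW.
  - by rewrite cardsU1 tC.
  - by rewrite setD1_id.
  - by rewrite setU1K // setD1_id.
rewrite -[X in connect _ _ X](setU0 [set t]).
move/connect_rst_sym: H; apply: (connect_homo (f := fun X => t |: X)) => X Y.
case/and3P=> sX sY /existsP[v /and3P[vt pv /eqP XY]]; apply: connect1.
have tv : t != v by move: vt; rewrite !inE eq_sym.
apply: (@rst_toggle _ _ v) => //.
- by apply: leq_trans (leq_card_setU _ _) _; rewrite cards1.
- by apply: leq_trans (leq_card_setU _ _) _; rewrite cards1.
- by apply: subset_trans pv _; apply: setSD; apply: subsetUr.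
- by rewrite !setDUl XY.
Qed.

End Surround.

(** * Subdivision *)

(* Vertex [v] becomes the chain [(v, false)], [(v, true)]. *)
Definition sub (V : finType) (e : rel V) : rel (V * bool) := fun a b =>
  if b.2 then (a.1 == b.1) && ~~ a.2 else a.2 && e a.1 b.1.

Definition fibre (V : finType) (A : {set V}) : {set V * bool} :=
  [set x | x.1 \in A].

Definition top (V : finType) (R : {set V}) : {set V * bool} :=
  [set x | (x.1 \in R) && x.2].

Section Subdivision.
Variables (V : finType) (e : rel V).

Definition level (b : bool) (P : {set V * bool}) : {set V} := [set v | (v, b) \in P].

Lemma card_level (P : {set V * bool}) : #|P| = #|level true P| + #|level false P|.
Proof.
have pinj (b : bool) : injective (fun v : V => (v, b)) by move=> u v [].
rewrite -(card_imset (level true P) (pinj true)).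
rewrite -(card_imset (level false P) (pinj false)) -cardsUI.
set I := _ :&: _; have -> : I = set0.
  apply/setP=> x; rewrite !inE; apply/negP=> /andP[/imsetP[u _ ->] /imsetP[v _ []]] //.
rewrite cards0 addn0; apply: eq_card => -[v b]; rewrite !inE.
apply/idP/orP => [vP|].
  by case: b vP => vP; [left|right]; apply/imsetP; exists v; rewrite ?inE.
by case=> /imsetP[u uP [-> ->]]; move: uP; rewrite inE.
Qed.

Lemma card_top (R : {set V}) : #|top R| = #|R|.
Proof.
rewrite card_level; have -> : level true (top R) = R by apply/setP=> v; rewrite !inE andbT.
have -> : level false (top R) = set0 by apply/setP=> v; rewrite !inE andbF.
by rewrite cards0 addn0.
Qed.

Let X P := level true P :|: level false P.

(* The projection of a configuration of space [s.+1] may exceed [s] only in a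
   critical state: the excess vertex [v] has just been half-entered, and without
   it the projection is reachable. *)
Definition sub_critical (A : {set V}) s P v := [/\ v \in level false P, v \in A,
  preds e v \subset level true P, #|X P| = s.+1
  & connect (rst e A s) set0 (X P :\ v)].

(** The projection [X] marks every chain that carries a pebble. It can reach size [s.+1] only with
    one pebble per occupied chain and the budget exhausted. In such a state no pebble can be added,
    and a move that changes [P] takes the lower pebble off a half-entered chain. *)
Lemma sub_lower A s P : connect (rst (sub e) (fibre A) s.+1) set0 P ->
  (#|X P| <= s /\ connect (rst e A s) set0 (X P)) \/ exists v, sub_critical A s P v.
Proof.
move=> H; pose I P := (#|X P| <= s /\ connect (rst e A s) set0 (X P)) \/
  exists v, sub_critical A s P v.
suff : I P by [].
apply: (connect_ind (I := I)) H _; last first.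
  left; have -> : X set0 = set0 by apply/setP=> v; rewrite !inE.
  by rewrite cards0 connect0.
move=> {}P Q /and3P[sP sQ /existsP[[v b] /and3P[]]].
rewrite inE /= => vA pv /eqP PQ IP.
have E y : y != (v, b) -> (y \in Q) = (y \in P).
  by move=> yx; have /setP/(_ y) := PQ; rewrite !in_setD1 yx.
(* At full projection no chain has room for two pebbles. *)
have disj (Z : {set V * bool}) : #|Z| <= s.+1 -> #|X Z| = s.+1 ->
    level true Z :&: level false Z = set0.
  move=> sZ XZ; apply/eqP; rewrite -cards_eq0.
  have := cardsUI (level true Z) (level false Z); rewrite -card_level -/(X Z); lia.
have same : P = Q -> I Q by move=> <-.
case: b pv PQ E => pv PQ E.
  have vL : (v, false) \in P.
    have : (v, false) \in P :\ (v, true) by apply: (subsetP pv); rewrite inE /sub /= eqxx.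
    by rewrite in_setD1 => /andP[].
  have vLQ : (v, false) \in Q by rewrite E // xpair_eqE andbF.
  have XE : X Q = X P.
    apply/setP=> u; rewrite !inE; have [->|uv] := eqVneq u v; first by rewrite vL vLQ !orbT.
    by rewrite !E // xpair_eqE ?(negPf uv) ?andbF.
  case: IP => [[sX rX]|[v0 cr]]; first by left; rewrite XE.
  apply: same; case: cr => _ _ _ XP _.
  have XQ1 : #|X Q| = s.+1 by rewrite XE.
  have /setP/(_ v) := disj _ sP XP; have /setP/(_ v) := disj _ sQ XQ1.
  rewrite !inE vL vLQ !andbT => vQ vP; apply/setP=> y.
  by have [->|yx] := eqVneq y (v, true); rewrite ?vP ?vQ // E.
have {}pv : preds e v \subset level true P.
  apply/subsetP=> u uv; rewrite inE in uv; rewrite inE.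
  have : (u, true) \in P :\ (v, false) by apply: (subsetP pv); rewrite inE.
  by rewrite in_setD1 => /andP[].
have RE : level true Q = level true P.
  by apply/setP=> u; rewrite !inE E // xpair_eqE andbF.
have XQE u : u != v -> (u \in X Q) = (u \in X P).
  by move=> uv; rewrite !inE !E // xpair_eqE ?(negPf uv) ?andbF.
have [vR|vR] := boolP (v \in level true P).
  have XE : X Q = X P.
    apply/setP=> u; have [->|uv] := eqVneq u v; last exact: XQE.
    by rewrite [LHS]in_setU [RHS]in_setU RE vR.
  case: IP => [[sX rX]|[v0 cr]]; first by left; rewrite XE.
  apply: same; case: cr => _ _ _ XP _.
  have XQ1 : #|X Q| = s.+1 by rewrite XE.
  have /setP/(_ v) := disj _ sP XP; have /setP/(_ v) := disj _ sQ XQ1.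
  rewrite RE 2!in_setI vR !inE /= => vQ vP; apply/setP=> y.
  by have [->|yx] := eqVneq y (v, false); rewrite ?vP ?vQ // E.
have vRD (Y : {set V}) : level true P \subset Y -> preds e v \subset Y :\ v.
  move=> RY; rewrite subsetD1 (subset_trans pv RY) /=.
  by apply: contra vR => /(subsetP pv).
have XD : X P :\ v = X Q :\ v.
  by apply/setP=> u; rewrite !in_setD1; have [//|uv] := eqVneq u v; rewrite XQE.
(* From here on the projection may change, at [v] only. If it outgrows [s], then [v] has just been
   half-entered and the state is critical. *)
case: IP => [[sX rX]|[v0 [v0L v0A pv0 XP r0]]].
  have [sXQ|sXQ] := leqP #|X Q| s.
    left; split=> //; apply: connect_trans rX _; apply: connect1.
    by apply: (@rst_toggle _ _ _ _ v) => //; apply: vRD; apply: subsetUl.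
  have vXP : v \notin X P.
    apply: contraL sXQ => vXP; rewrite -leqNgt (cardsD1 v) -XD.
    by move: sX; rewrite (cardsD1 v (X P)) vXP; case: (v \in X Q) => /=; lia.
  have vXQ : v \in X Q.
    apply: contraTT sXQ => vXQ; rewrite -leqNgt (cardsD1 v) (negPf vXQ) -XD.
    by rewrite setD1_id.
  right; exists v; split=> //.
  - by move: vXQ; rewrite in_setU RE (negPf vR).
  - by rewrite RE.
  - move: sXQ; rewrite (cardsD1 v (X Q)) vXQ -XD setD1_id //; lia.
  - by rewrite -XD setD1_id.
have dP := disj _ sP XP.
have v0R : v0 \notin level true P.
  by apply/negP=> v0R; have /setP/(_ v0) := dP; rewrite in_setI v0R v0L in_set0.
have [vLQ|vLQ] := boolP ((v, false) \in Q); have [vLP|vLP] := boolP ((v, false) \in P).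
- apply: same; apply/setP=> y.
  by have [->|yx] := eqVneq y (v, false); rewrite ?vLQ ?vLP // E.
(* A further half-entered vertex would occupy [s.+2] chains, more than there are pebbles. *)
- have XQ : X Q = v |: X P.
    apply/setP=> u; have [->|uv] := eqVneq u v; first by rewrite setU11 !inE vLQ orbT.
    by rewrite XQE // in_setU1 (negPf uv).
  have : #|X Q| = s.+2.
    rewrite XQ cardsU1 XP; suff -> : v \notin X P by [].
    by rewrite in_setU negb_or vR inE.
  move=> XQ2; have := (leq_card_setU (level true Q) (level false Q)).1.
  rewrite -card_level -/(X Q) XQ2; by move/leq_trans=> /(_ _ sQ); rewrite ltnn.
- have XQ : X Q = X P :\ v.
    apply/setP=> u; rewrite in_setD1; have [->|uv] := eqVneq u v; last by rewrite XQE.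
    by rewrite in_setU RE (negPf vR) inE (negPf vLQ).
  have vXP : v \in X P by rewrite in_setU [X in _ || X]inE vLP orbT.
  have v0XP : v0 \in X P by rewrite in_setU v0L orbT.
  have sv : #|X P :\ v| = s by move: XP; rewrite (cardsD1 v) vXP => -[].
  have sv0 : #|X P :\ v0| = s by move: XP; rewrite (cardsD1 v0) v0XP => -[].
  left; rewrite XQ sv; split=> //.
  have [->//|v0v] := eqVneq v v0.
  (* The vertex left need not be the one that was in excess: starting without [v0], remove [v] and
     then add [v0]. The predecessors of both lie in [level true P], which contains neither. *)
  apply: (connect_trans r0); apply: (@connect_trans _ _ (X P :\ v0 :\ v)).
    apply: connect1; apply: (@rst_toggle _ _ _ _ v) => //.
    + by rewrite sv0.
    + by rewrite -sv0 subset_leq_card // subD1set.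
    + by apply: vRD; rewrite subsetD1 v0R subsetUl.
    + by apply/setP=> u; rewrite !in_setD1; case: (u == v).
  apply: connect1; apply: (@rst_toggle _ _ _ _ v0) => //.
  + by rewrite -sv0 subset_leq_card // subD1set.
  + by rewrite sv.
  + rewrite !subsetD1 (subset_trans pv0 (subsetUl _ _)) /=.
    by rewrite !(contra (subsetP pv0 _)).
  + by apply/setP=> u; rewrite !in_setD1; case: (u == v); rewrite ?andbF //; case: (u == v0).
- apply: same; apply/setP=> y.
  by have [->|yx] := eqVneq y (v, false); rewrite ?(negPf vLQ) ?(negPf vLP) // E.
Qed.

(** In a critical state the excess vertex has only its lower half pebbled, so it is not in [Y] and
    can be left out of the projection. *)
Lemma sub_visit_lower A s (Y : {set V}) (P : {set V * bool}) : top Y \subset P ->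
  connect (rst (sub e) (fibre A) s.+1) set0 P ->
  exists2 C : {set V}, Y \subset C & connect (rst e A s) set0 C.
Proof.
move=> YP H; have YR : Y \subset level true P.
  by apply/subsetP=> y yY; rewrite inE; apply: (subsetP YP); rewrite inE yY.
have sP := rst_card H.
case: (sub_lower H) => [[_ r]|[v [vL vA pv XP r]]].
  by exists (X P) => //; apply: subset_trans YR (subsetUl _ _).
exists (X P :\ v) => //; rewrite subsetD1 (subset_trans YR (subsetUl _ _)) /=.
apply/negP=> /(subsetP YR) vR.
have := cardsUI (level true P) (level false P); rewrite -/(X P) XP.
by move: sP; rewrite card_level (cardsD1 v (_ :&: _)) in_setI vR vL /=; lia.
Qed.

Lemma sub_price_lower s t :
  connect (rst (sub e) setT s.+1) set0 [set (t, true)] ->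
  connect (rst e setT s) set0 [set t].
Proof.
have -> : setT = fibre [set: V] by apply/setP=> x; rewrite !inE.
move=> H; case: (sub_lower H) => [[_]|[v [vL _ _ _ _]]].
  suff -> : X [set (t, true)] = [set t] by [].
  by apply/setP=> v; rewrite !inE !xpair_eqE andbF orbF andbT.
by move: vL; rewrite !inE xpair_eqE andbF.
Qed.

(** Each move passes through the lower half of the chain, which is cleared at once; this is the only
    extra pebble. *)
Lemma sub_upper A s P Q : connect (rst e A s) P Q ->
  connect (rst (sub e) (fibre A) s.+1) (top P) (top Q).
Proof.
apply: (connect_homo (f := @top V)) => {}P {}Q /and3P[sP sQ].
case/existsP=> v /and3P[vA pv /eqP PQ].
suff H (R : {set V}) : v \notin R -> #|R| < s -> preds e v \subset R ->
    connect (rst (sub e) (fibre A) s.+1) (top R) (top (v |: R)).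
  case: (setD1_eq PQ) => [->|[vP QE]|[vQ PE]]; first exact: connect0.
    by rewrite QE; apply: H => //; [rewrite QE cardsU1 vP in sQ | rewrite setD1_id in pv].
  rewrite PE; apply: connect_rst_sym; apply: H => //.
    by rewrite PE cardsU1 vQ in sP.
  by rewrite PE setU1K in pv.
move=> {P Q sP sQ pv PQ} vR sR pv.
have mR : (v, false) \notin top R by rewrite inE andbF.
have cR : (v, true) \notin (v, false) |: top R by rewrite !inE xpair_eqE (negPf vR) andbF.
apply: (@connect_trans _ _ ((v, false) |: top R)).
  apply: connect1; apply: (@rst_toggle _ _ _ _ (v, false)); rewrite ?inE //=.
  - rewrite card_top; lia.
  - rewrite cardsU1 mR card_top; lia.
  - rewrite setD1_id //; apply/subsetP=> -[u b]; rewrite !inE /sub /= => /andP[-> uv].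
    by rewrite (subsetP pv) // inE.
  - by rewrite setU1K // setD1_id.
apply: (@connect_trans _ _ ((v, true) |: ((v, false) |: top R))).
  apply: connect1; apply: (@rst_toggle _ _ _ _ (v, true)); rewrite ?inE //=.
  - rewrite cardsU1 mR card_top; lia.
  - rewrite cardsU1 cR cardsU1 mR card_top; lia.
  - rewrite setD1_id //; apply/subsetP=> -[u b]; rewrite !inE /sub /=.
    by case/andP=> /eqP-> /negPf->; rewrite eqxx.
  - by rewrite setU1K // setD1_id.
have -> : (v, true) |: ((v, false) |: top R) = (v, false) |: top (v |: R).
  apply/setP=> -[u b]; rewrite !inE !xpair_eqE.
  by case: b; case: (u == v); case: (u \in R).
have mR' : (v, false) \notin top (v |: R) by rewrite inE andbF.
apply: connect1; apply: (@rst_toggle _ _ _ _ (v, false)); rewrite ?inE //=.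
- rewrite cardsU1 mR' card_top cardsU1 vR; lia.
- rewrite card_top cardsU1 vR; lia.
- rewrite setU1K //; apply/subsetP=> -[u b]; rewrite !inE /sub /= => /andP[-> uv].
  by rewrite (subsetP pv) ?inE // orbT.
- by rewrite setU1K // setD1_id.
Qed.

End Subdivision.

Lemma card_bigcup_le1 (T : finType) (S : {set T}) (F : T -> {set T}) :
  (forall x, #|F x| <= 1) -> #|\bigcup_(x in S) F x| <= #|S|.
Proof.
move=> F1; rewrite -[leqRHS]sum1_card.
elim/big_rec2: _ => [|x n A _ An]; first by rewrite cards0.
by apply: leq_trans (leq_card_setU _ _) _; apply: leq_add.
Qed.

(** * The gate product *)
Section Gate.
Variables (V W : finType) (e1 e1a : rel V) (el : rel W) (z p q c : W).

(* [e1a] selects one of the at most two predecessors of each vertex, [e1b] is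
   the other one; [el] is the toll graph, with last vertex [z]. *)
Definition gate_edge : rel (V * W) := fun x y =>
  if y.2 == p then (x.1 == y.1) && (x.2 == z) || (x.2 == c) && e1a x.1 y.1
  else if y.2 == q then (x.2 == c) && e1 x.1 y.1
  else if y.2 == c then (x.1 == y.1) && ((x.2 == p) || (x.2 == q))
  else (x.1 == y.1) && el x.2 y.2.

Definition toll : {set W} := [set a | a \notin [:: z; p; q; c]].

Definition e1b : rel V := fun u v => e1 u v && ~~ e1a u v.

(** The side condition in [gate_el] is there because [el] may have edges of its own into [p], [q]
    and [c], which [gate_edge] overrides; the reversible toll graph has such edges. *)
Record gate_ok : Prop := GateOk {
  gate_uniq : uniq [:: z; p; q; c];
  gate_el : forall a b, el a b -> b \notin [:: p; q; c] -> a \in toll;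
  gate_irr : irreflexive e1;
  gate_a1 : subrel e1a e1;
  gate_a_fun : forall u u' v, e1a u v -> e1a u' v -> u = u';
  gate_b_fun : forall u u' v, e1b u v -> e1b u' v -> u = u'
}.

Hypothesis ok : gate_ok.

Lemma gate_neq :
  ((z == p) = false) * ((z == q) = false) * ((z == c) = false) *
  ((p == q) = false) * ((p == c) = false) * ((q == c) = false) *
  ((p == z) = false) * ((q == z) = false) * ((c == z) = false) *
  ((q == p) = false) * ((c == p) = false) * ((c == q) = false).
Proof.
have := gate_uniq ok; rewrite /= !inE !negb_or -!andbA.
case/and5P=> /negPf zp /negPf zq /negPf zc /negPf pq /and3P[/negPf pc /negPf qc _].
by do !split; rewrite // eq_sym.
Qed.

Let distinct := gate_neq.

Lemma in_e1 u v : e1 u v = e1a u v || e1b u v.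
Proof.
rewrite /e1b; have [/(gate_a1 ok)->//|_] := boolP (e1a u v); by rewrite andbT.
Qed.

Lemma card_e1a v : #|[set u | e1a u v]| <= 1.
Proof.
by apply/card_le1_eqP=> u u'; rewrite !inE => /(gate_a_fun ok) H /H.
Qed.

Lemma card_e1b v : #|[set u | e1b u v]| <= 1.
Proof.
by apply/card_le1_eqP=> u u'; rewrite !inE => /(gate_b_fun ok) H /H.
Qed.

Definition col (a : W) (P : {set V * W}) : {set V} := [set v | (v, a) \in P].

Definition row (v : V) (P : {set V * W}) : {set W} :=
  [set a | (a \notin [:: p; q; c]) && ((v, a) \in P)].

(** Every nonempty copy of the toll other than that of [v] is counted once, since nothing more is
    known of a partially paid toll. *)
Lemma gate_count (P : {set V * W}) v :
  #|col p P| + #|col q P| + #|col c P| + #|[set w | w != v & row w P != set0]|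
    + #|row v P| <= #|P|.
Proof.
have colE a : #|col a P| = \sum_w ((w, a) \in P : nat).
  by rewrite -sum1dep_card big_mkcond /=; apply: eq_bigr => w _; case: (_ \in P).
have rowE w : #|row w P| = \sum_(a | a \notin [:: p; q; c]) ((w, a) \in P : nat).
  rewrite -sum1dep_card big_mkcondr /=; apply: eq_bigr => a _; by case: (_ \in P).
have -> : #|P| = \sum_w \sum_a ((w, a) \in P : nat).
  rewrite pair_bigA /= -sum1_card big_mkcond /=; apply: eq_bigr => -[w a] _ /=.
  by case: (_ \in P).
have E w : \sum_a ((w, a) \in P : nat) =
    ((w, p) \in P) + ((w, q) \in P) + ((w, c) \in P) + #|row w P|.
  rewrite (bigD1 p) //= (bigD1 q) /= ?distinct // (bigD1 c) /= ?distinct //.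
  rewrite rowE !addnA; congr (_ + _); apply: eq_bigl => a.
  by rewrite !inE !negb_or andbA.
rewrite (eq_bigr _ (fun w _ => E w)) !big_split /= !colE -addnA leq_add2l.
rewrite (bigD1 v) //= addnC leq_add2l -sum1dep_card big_mkcondr /=.
apply: leq_sum => w _; case: ifP => // H.
by rewrite lt0n cards_eq0.
Qed.

Lemma gate_preds_p v (P : {set V * W}) : preds gate_edge (v, p) \subset P ->
  (v, z) \in P /\ forall u, e1a u v -> u \in col c P.
Proof.
move=> sP; split=> [|u uv]; rewrite ?inE; apply: (subsetP sP);
  by rewrite inE /gate_edge /= !eqxx ?uv ?orbT.
Qed.

Lemma gate_preds_q v (P : {set V * W}) : preds gate_edge (v, q) \subset P ->
  preds e1 v \subset col c P.
Proof.
move=> sP; apply/subsetP=> u uv; rewrite inE in uv; rewrite inE.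
by apply: (subsetP sP); rewrite inE /gate_edge /= !distinct !eqxx uv.
Qed.

Lemma gate_preds_c v (P : {set V * W}) : preds gate_edge (v, c) \subset P ->
  (v, p) \in P /\ (v, q) \in P.
Proof.
move=> sP; split; apply: (subsetP sP);
  by rewrite inE /gate_edge /= !distinct !eqxx ?orbT.
Qed.

Lemma gate_preds_el v a (P : {set V * W}) : a \notin [:: p; q; c] ->
  preds gate_edge (v, a) \subset P ->
  preds el a \subset [set b in toll | (v, b) \in P].
Proof.
move=> aP sP; apply/subsetP=> b ba; rewrite inE in ba; rewrite inE.
rewrite (gate_el ok ba aP); apply: (subsetP sP); rewrite inE /gate_edge /=.
by move: aP; rewrite !inE !negb_or => /and3P[/negPf-> /negPf-> /negPf->]; rewrite eqxx.
Qed.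

(** * Shadows of gate configurations *)

Definition st := ({set V} * {set V} * {set V})%type.
Definition sp (s : st) := s.1.1.
Definition sq (s : st) := s.1.2.
Definition sc (s : st) := s.2.

(* The moves inside the gates while the set [L] of loaded tolls is fixed; a state
   lists the vertices whose [p], [q] and [c] carry a pebble. *)
Definition phase (L : {set V}) : rel st := fun s s' =>
  [|| [exists v, [&& v \in L, [forall u, e1a u v ==> (u \in sc s)],
         sp s :\ v == sp s' :\ v, sq s == sq s' & sc s == sc s']],
      [exists v, [&& preds e1 v \subset sc s, sq s :\ v == sq s' :\ v,
         sp s == sp s' & sc s == sc s']]
    | [exists v, [&& v \in sp s, v \in sq s, sc s :\ v == sc s' :\ v,
         sp s == sp s' & sq s == sq s']]].

(** A pair [p_x], [q_x] stands for a pebble on x, a lone [p_x] records the first predecessor of x,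
    and [q_x] always records the other one. Each gate pebble thus accounts for at most one
    vertex. *)
Definition shadow (s : st) : {set V} :=
  [set v | [|| v \in sc s, (v \in sp s) && (v \in sq s),
     [exists x, (x \in sq s) && e1b v x]
   | [exists x, [&& x \in sp s, x \notin sq s & e1a v x]]]].

Lemma D1_mem (A B : {set V}) v y : A :\ v = B :\ v -> y != v -> (y \in A) = (y \in B).
Proof. by move=> /setP/(_ y); rewrite !in_setD1 => + yv; rewrite yv. Qed.

Lemma shadow_p s s' v : (forall u, e1a u v -> u \in sc s) ->
  sp s :\ v = sp s' :\ v -> sq s = sq s' -> sc s = sc s' ->
  forall y, y \in shadow s -> y \in shadow s' \/ y = v /\ v \in sq s.
Proof.
move=> vu pE qE cE y; rewrite !inE -qE -cE.
case/or4P=> [->|/andP[yp yq]|->|/existsP[x /and3P[xp xq yx]]]; rewrite ?orbT; try by left.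
  have [yv|yv] := eqVneq y v; first by right; rewrite -yv.
  by left; rewrite -(D1_mem pE yv) yp yq orbT.
left; have [xv|xv] := eqVneq x v; first by rewrite (vu y) // -xv.
apply/or4P; constructor 4; apply/existsP; exists x.
by rewrite -(D1_mem pE xv) xp xq.
Qed.

Lemma shadow_q s s' v : preds e1 v \subset sc s ->
  sq s :\ v = sq s' :\ v -> sp s = sp s' -> sc s = sc s' ->
  forall y, y \in shadow s -> y \in shadow s' \/ y = v.
Proof.
move=> vu qE pE cE y; rewrite !inE -pE -cE.
case/or4P=> [->|/andP[yp yq]|/existsP[x /andP[xq yx]]|/existsP[x /and3P[xp xq yx]]].
- by left.
- have [yv|yv] := eqVneq y v; first by right.
  by left; rewrite -(D1_mem qE yv) yp yq orbT.
- left; have [xv|xv] := eqVneq x v.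
    by rewrite (subsetP vu) // inE -xv in_e1 yx orbT.
  apply/or4P; constructor 3; apply/existsP; exists x.
  by rewrite -(D1_mem qE xv) xq.
left; have [xv|xv] := eqVneq x v.
  by rewrite (subsetP vu) // inE -xv in_e1 yx.
apply/or4P; constructor 4; apply/existsP; exists x.
by rewrite -(D1_mem qE xv) xp xq.
Qed.

Lemma shadow_c s s' v : v \in sp s -> v \in sq s ->
  sc s :\ v = sc s' :\ v -> sp s = sp s' -> sq s = sq s' -> shadow s \subset shadow s'.
Proof.
move=> vp vq cE pE qE; apply/subsetP=> y; rewrite !inE -pE -qE.
have [->|yv] := eqVneq y v; first by rewrite vp vq !orbT.
by rewrite (D1_mem cE yv).
Qed.

(** Moving [c_v] changes nothing, because the pair below it already puts v in the shadow. Moving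
    [q_v] or [p_v] can change the shadow only at v, and then all predecessors of v are in it: below
    [q_v] both carry [c], below [p_v] one carries [c] and the other is recorded by [q_v]. *)
Lemma shadow_step L s s' : phase L s s' ->
  shadow s = shadow s' \/
  exists v, preds e1 v \subset shadow s :\ v /\ shadow s :\ v = shadow s' :\ v.
Proof.
have irr u v : e1 u v -> u != v.
  by apply: contraTneq => ->; rewrite (gate_irr ok).
have scS (t : st) : sc t \subset shadow t by apply/subsetP=> y yc; rewrite inE yc.
case/or3P=> /existsP[v].
- case/and5P=> vL /forallP H /eqP pE /eqP qE /eqP cE.
  have vu u : e1a u v -> u \in sc s by move=> uv; have := H u; rewrite uv.
  have vu' u : e1a u v -> u \in sc s' by rewrite -cE; apply: vu.
  have S1 := shadow_p vu pE qE cE.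
  have S2 := shadow_p vu' (esym pE) (esym qE) (esym cE).
  have [vq|vq] := boolP (v \in sq s); last first.
    left; apply/setP=> y; apply/idP/idP => [/S1[]//|/S2[]//] [_]; rewrite -?qE => vq'.
      by rewrite vq' in vq.
    by rewrite vq' in vq.
  right; exists v; split.
    apply/subsetP=> u; rewrite inE => uv; rewrite in_setD1 irr //=.
    move: uv; rewrite in_e1 => /orP[/vu|] uv; first exact: (subsetP (scS s)).
    by rewrite inE; apply/or4P; constructor 3; apply/existsP; exists v; rewrite vq.
  apply/setP=> y; rewrite !in_setD1; have [//|yv] := eqVneq y v; rewrite /=.
  by apply/idP/idP => [/S1[]//|/S2[]//] [/eqP]; rewrite (negPf yv).
- case/and4P=> vu /eqP qE /eqP pE /eqP cE.
  have vu' : preds e1 v \subset sc s' by rewrite -cE.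
  have S1 := shadow_q vu qE pE cE.
  have S2 := shadow_q vu' (esym qE) (esym pE) (esym cE).
  right; exists v; split.
    apply/subsetP=> u uv; rewrite in_setD1 (subsetP (scS s)) ?(subsetP vu) // andbT.
    by apply: irr; rewrite inE in uv.
  apply/setP=> y; rewrite !in_setD1; have [//|yv] := eqVneq y v; rewrite /=.
  by apply/idP/idP => [/S1[]//|/S2[]//] /eqP; rewrite (negPf yv).
case/and5P=> vp vq /eqP cE /eqP pE /eqP qE; left; apply/eqP; rewrite eqEsubset.
rewrite (shadow_c vp vq cE pE qE) /=; rewrite pE in vp; rewrite qE in vq.
exact: (shadow_c vp vq (esym cE) (esym pE) (esym qE)).
Qed.

Lemma path_change (T : eqType) (r : rel T) (f : T -> bool) x s a b :
  path r x s -> a \in x :: s -> b \in x :: s -> f a != f b ->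
  exists y y', [/\ y \in x :: s, y' \in x :: s, r y y' & f y != f y'].
Proof.
move=> pP aI bI fab.
have {a b aI bI fab} [a aI fa] : exists2 a, a \in x :: s & f a != f x.
  have [E|E] := eqVneq (f a) (f x); last by exists a.
  by exists b => //; rewrite -E eq_sym.
elim: s x pP aI fa => [|y s IH] x /=; first by move=> _; rewrite inE => /eqP->; rewrite eqxx.
case/andP=> xy pP aI fa; have [E|E] := eqVneq (f x) (f y); last first.
  by exists x, y; rewrite !inE !eqxx orbT.
case/predU1P: aI => [E'|aI]; first by rewrite E' eqxx in fa.
rewrite E in fa; have [y1 [y2 [H1 H2 H3 H4]]] := IH _ pP aI fa.
by exists y1, y2; split=> //; rewrite in_cons ?H1 ?H2 orbT.
Qed.

Definition weight (s : st) (L : {set V}) := #|sp s| + #|sq s| + #|sc s| + #|L|.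

(* Let [M] be the union of the shadows along the path.  If [M] has at most [K]
   elements, the shadows themselves form a pebbling.  Otherwise consider a state
   [t] of weight at most [K.+1] on the path: charging [p_v] to [v] or to its first
   predecessor, [q_v] to its other predecessor, and [c_v] and loaded tolls to [v],
   the pebbles of [t] that never move already cover [M] ([Cov] below), so that [t]
   has no pebble that moves.  Applied to both ends, this makes them equal. *)
Lemma phase_reach L K s0 ss : path (phase L) s0 ss ->
  weight s0 L <= K.+1 -> weight (last s0 ss) L <= K.+1 ->
  connect (rst e1 setT K) set0 (shadow s0) ->
  connect (rst e1 setT K) set0 (shadow (last s0 ss)).
Proof.
move=> pP w0 wl r0.
pose M := [set v | has (fun s => v \in shadow s) (s0 :: ss)].
have [MK|MK] := leqP #|M| K.
  have sM s : s \in s0 :: ss -> #|shadow s| <= K.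
    move=> sI; apply: leq_trans MK; apply: subset_leq_card; apply/subsetP=> v vs.
    by rewrite inE; apply/hasP; exists s.
  apply: connect_trans r0 _; elim: ss s0 pP sM {w0 wl M MK} => [|s1 ss IH] s0 /=.
    by move=> _ _; apply: connect0.
  case/andP=> s01 pP sM; apply: connect_trans (IH _ pP _); last first.
    by move=> s sI; apply: sM; rewrite inE sI orbT.
  case: (shadow_step s01) => [->|[v [pv E]]]; first exact: connect0.
  apply: connect1; apply: (@rst_toggle _ _ _ _ v) => //; apply: sM;
    by rewrite !inE eqxx ?orbT.
suff -> : last s0 ss = s0 by [].
pose ch (f : st -> {set V}) := [set v | has (fun s => (v \in f s) != (v \in f s0)) (s0 :: ss)].
pose on v := exists2 s, s \in s0 :: ss & v \in sc s.
have chP (f : st -> {set V}) v s s' : s \in s0 :: ss -> s' \in s0 :: ss ->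
    (v \in f s) != (v \in f s') -> v \in ch f.
  move=> sI s'I; rewrite inE; have [<-|N] := eqVneq (v \in f s') (v \in f s0).
    by move=> H; apply/hasP; exists s.
  by move=> _; apply/hasP; exists s'.
have chN (f : st -> {set V}) v s s' : v \notin ch f -> s \in s0 :: ss ->
    s' \in s0 :: ss -> (v \in f s) = (v \in f s').
  by move=> N sI s'I; apply/eqP; apply: contraR N => /(chP _ _ _ _ sI s'I).
have chE (f : st -> {set V}) v : v \in ch f -> exists y y',
    [/\ y \in s0 :: ss, y' \in s0 :: ss, phase L y y' & (v \in f y) != (v \in f y')].
  rewrite inE => /hasP[s sI ne]; apply: (path_change pP sI _ ne); by rewrite inE eqxx.
have D1 (A B : {set V}) v x : A :\ x = B :\ x -> (v \in A) != (v \in B) -> v = x.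
  by move=> E; apply: contraNeq => vx; rewrite (D1_mem E vx) eqxx.
(* A pebble that moves certifies what lies below it: moving [q_v] shows both predecessors of v,
   moving [p_v] the first one and a loaded toll, moving [c_v] the pair. *)
have chq v : v \in ch sq -> forall u, e1 u v -> on u.
  case/chE=> y [y' [yI _ /or3P[]/existsP[x]]].
  - by case/and5P=> _ _ _ /eqP-> _; rewrite eqxx.
  - case/and4P=> px /eqP E _ _ /(D1 _ _ _ _ E) -> u ux; exists y => //.
    by apply: (subsetP px); rewrite inE.
  - by case/and5P=> _ _ _ _ /eqP->; rewrite eqxx.
have chp v : v \in ch sp -> v \in L /\ forall u, e1a u v -> on u.
  case/chE=> y [y' [yI _ /or3P[]/existsP[x]]].
  - case/and5P=> xL /forallP H /eqP E _ _ /(D1 _ _ _ _ E) ->; split=> // u ux.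
    by exists y => //; have := H u; rewrite ux.
  - by case/and4P=> _ _ /eqP-> _; rewrite eqxx.
  - by case/and5P=> _ _ _ /eqP-> _; rewrite eqxx.
have chc v : v \in ch sc -> exists2 s, s \in s0 :: ss & (v \in sp s) && (v \in sq s).
  case/chE=> y [y' [yI _ /or3P[]/existsP[x]]].
  - by case/and5P=> _ _ _ _ /eqP->; rewrite eqxx.
  - by case/and4P=> _ _ _ /eqP->; rewrite eqxx.
  - by case/and5P=> xp xq /eqP E _ _ /(D1 _ _ _ _ E) ->; exists y => //; rewrite xp.
have key t : t \in s0 :: ss -> weight t L <= K.+1 ->
    [/\ sp t :&: ch sp = set0, sq t :&: ch sq = set0 & sc t :&: ch sc = set0].
  move=> tI wt.
  (* How a motionless [p_x] is charged. If [q_x] moves, the predecessors of x carry [c] at some time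
     and need no charge; if [q_x] stays on, [p_x] is never alone. In both cases the charge is free
     for x. If [q_x] stays off, x never owes its place to the pair, and the charge goes to the first
     predecessor. *)
  pose solid x := (x \in sq t) || (x \in ch sq).
  pose Fp x := if solid x then [set x] else [set u | e1a u x].
  pose Fq x := [set u | e1b u x].
  pose Cov := L :|: (sc t :\: ch sc) :|: \bigcup_(x in sp t :\: ch sp) Fp x
     :|: \bigcup_(x in sq t :\: ch sq) Fq x.
  have covL v : v \in L -> v \in Cov by move=> vL; rewrite !in_setU vL.
  have covpq v s : s \in s0 :: ss -> v \in sp s -> v \in sq s -> v \in Cov.
    move=> sI vp vq; have [/covL//|vL] := boolP (v \in L).
    have vN : v \notin ch sp by apply/negP=> /chp[]; rewrite (negPf vL).
    have vt : v \in sp t by rewrite (chN _ _ _ s vN).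
    rewrite !in_setU; apply/orP; left; apply/orP; right; apply/bigcupP; exists v.
      by rewrite in_setD vt vN.
    suff S : solid v by rewrite /Fp S set11.
    rewrite /solid; case: (boolP (v \in ch sq)) => [_|N]; first by rewrite orbT.
    by rewrite (chN _ _ _ s N) // vq.
  have covon v : on v -> v \in Cov.
    case=> s sI vs; have [/chc[s' s'I /andP[vp vq]]|N] := boolP (v \in ch sc).
      exact: covpq vp vq.
    by rewrite !in_setU in_setD N (chN _ _ _ s N) // vs !orbT.
  have MCov : M \subset Cov.
    apply/subsetP=> v; rewrite inE => /hasP[s sI]; rewrite inE.
    case/or4P=> [vs|/andP[vp vq]|/existsP[x /andP[xq vx]]|/existsP[x /and3P[xp xq vx]]].
    - by apply: covon; exists s.
    - exact: covpq vp vq.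
    - have [/chq H|N] := boolP (x \in ch sq).
        by apply: covon; apply: H; rewrite in_e1 vx orbT.
      rewrite !in_setU; apply/orP; right; apply/bigcupP; exists x; last by rewrite inE.
      by rewrite in_setD N (chN _ _ _ s N).
    have [/chq H|Nq] := boolP (x \in ch sq).
      by apply: covon; apply: H; rewrite in_e1 vx.
    have [/chp[_ H]|Np] := boolP (x \in ch sp); first by apply: covon; apply: H.
    rewrite !in_setU; apply/orP; left; apply/orP; right; apply/bigcupP; exists x.
      by rewrite in_setD Np (chN _ _ _ s Np).
    by rewrite /Fp /solid (negPf Nq) (chN _ _ _ s Nq) // (negPf xq) inE.
  have cardM : #|M| <= #|L| + #|sc t :\: ch sc| + #|sp t :\: ch sp| + #|sq t :\: ch sq|.
    apply: leq_trans (subset_leq_card MCov) _.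
    apply: leq_trans (leq_card_setU _ _) _; apply: leq_add; last first.
      by apply: card_bigcup_le1 => x; apply: card_e1b.
    apply: leq_trans (leq_card_setU _ _) _; apply: leq_add; last first.
      apply: card_bigcup_le1 => x; rewrite /Fp; case: ifP; first by rewrite cards1.
      by move=> _; apply: card_e1a.
    exact: leq_card_setU.
  (* The motionless pebbles together with [L] number at least #|M| >= K + 1, which is the whole
     weight allowed to [t], so no moving pebble is on. *)
  have H (A B : {set V}) : #|A| = #|A :&: B| + #|A :\: B| by rewrite cardsID.
  move: wt; rewrite /weight (H (sp t) (ch sp)) (H (sq t) (ch sq)) (H (sc t) (ch sc)).
  by move=> wt; split; apply/eqP; rewrite -cards_eq0; lia.
have lI : last s0 ss \in s0 :: ss by apply: mem_last.
have sI : s0 \in s0 :: ss by rewrite inE eqxx.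
have [p0 q0 c0] := key _ sI w0; have [pl ql cl] := key _ lI wl.
(* A vertex whose pebble moves is empty at both ends, and elsewhere nothing changes. *)
have fin (f : st -> {set V}) : f s0 :&: ch f = set0 -> f (last s0 ss) :&: ch f = set0 ->
    f (last s0 ss) = f s0.
  move=> /setP f0 /setP fl; apply/setP=> v; have [vc|vN] := boolP (v \in ch f).
    have := f0 v; have := fl v; rewrite !in_setI vc !andbT !in_set0 => -> ->; done.
  exact: chN.
have := fin _ p0 pl; have := fin _ q0 ql; have := fin _ c0 cl.
rewrite /sp /sq /sc; case: (last s0 ss) => [[? ?] ?]; case: (s0) => [[? ?] ?] /=.
by move=> -> -> ->.
Qed.

Implicit Types (R : {set V}) (D : {set W}).

(** * Configurations around a single gate *)

Definition conf (R : {set V}) v (D : {set W}) : {set V * W} :=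
  [set x | (x.1 \in R) && (x.2 == c) || (x.1 == v) && (x.2 \in D)].

Lemma card_conf R v D : #|conf R v D| <= #|R| + #|D|.
Proof.
have -> : conf R v D = [set (u, c) | u in R] :|: [set (v, a) | a in D].
  apply/setP=> -[u a]; rewrite !inE /=; congr (_ || _).
    apply/andP/imsetP => [[uR /eqP->]|[w wR [-> ->]]]; last by rewrite wR eqxx.
    by exists u.
  apply/andP/imsetP => [[/eqP-> aD]|[b bD [-> ->]]]; last by rewrite bD eqxx.
  by exists a.
apply: leq_trans (leq_card_setU _ _) _.
by apply: leq_add; apply: leq_imset_card.
Qed.

Lemma conf_el R v D a : a \notin [:: p; q; c] -> preds el a \subset D ->
  preds gate_edge (v, a) \subset conf R v D.
Proof.
move=> aN aD; apply/subsetP=> -[u b]; rewrite inE /gate_edge /=.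
move: aN; rewrite !in_cons !negb_or => /and4P[/negPf-> /negPf-> /negPf-> _].
case/andP=> /eqP-> ba; rewrite inE /= eqxx (subsetP aD) ?orbT // inE; exact: ba.
Qed.

Lemma conf_p R v D : z \in D -> preds e1 v \subset R -> preds gate_edge (v, p) \subset conf R v D.
Proof.
move=> zD vR; apply/subsetP=> -[u b]; rewrite inE /gate_edge /= eqxx.
case/orP=> [/andP[/eqP-> /eqP->]|/andP[/eqP-> uv]]; rewrite inE /= eqxx ?zD ?orbT //.
by rewrite (subsetP vR) // inE; apply: (gate_a1 ok).
Qed.

Lemma conf_q R v D : preds e1 v \subset R -> preds gate_edge (v, q) \subset conf R v D.
Proof.
move=> vR; apply/subsetP=> -[u b]; rewrite inE /gate_edge /= !distinct eqxx.
by case/andP=> /eqP-> uv; rewrite inE /= eqxx (subsetP vR) // inE.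
Qed.

Lemma conf_c R v D : p \in D -> q \in D -> preds gate_edge (v, c) \subset conf R v D.
Proof.
move=> pD qD; apply/subsetP=> -[u b]; rewrite inE /gate_edge /= !distinct eqxx.
by case/andP=> /eqP-> /orP[]/eqP->; rewrite inE /= eqxx ?pD ?qD ?orbT.
Qed.

End Gate.

(** * Reversible price of the gate product *)

Section GateReversible.
Variables (V W : finType) (e1 e1a : rel V) (el : rel W) (z p q c : W).
Hypothesis ok : gate_ok e1 e1a el z p q c.

Let distinct := gate_neq ok.
Let toll := toll z p q c.
Let E := gate_edge e1 e1a el z p q c.

Lemma tollE a : (a \in toll) = [&& a != z, a != p, a != q & a != c].
Proof. by rewrite inE !inE !negb_or. Qed.

Section Lower.
Variables (T K : nat) (t : V).
Hypothesis toll_lower : forall D, connect (rst el toll T) set0 D ->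
  ~~ (preds el z \subset D).

Let tr v (P : {set V * W}) := [set a in toll | (v, a) \in P].
(** Being loaded is defined by reachability within [T] and not by size: it then persists while the
    toll shrinks again, and it can change only through a move that has more than [T] pebbles in that
    toll before or after. *)
Let load (P : {set V * W}) :=
  [set v | ((v, z) \in P) || ~~ connect (rst el toll T) set0 (tr v P)].
Let stt (P : {set V * W}) : st V := (col p P, col q P, col c P).

(* The current phase starts in [s0], at a moment when the configuration was small;
   [phase_reach] is applied when it ends. *)
Let Inv (P : {set V * W}) := exists s0 ss,
  [/\ path (phase e1 e1a (load P)) s0 ss, last s0 ss = stt P,
      weight s0 (load P) <= K.+1
    & connect (rst e1 setT K) set0 (shadow e1 e1a s0)].

Let Inv_extend P Q : load Q = load P ->
  stt Q = stt P \/ phase e1 e1a (load P) (stt P) (stt Q) -> Inv P -> Inv Q.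
Proof.
move=> lE H [s0 [ss [pP pl w0 r0]]]; case: H => [sE|H].
  by exists s0, ss; rewrite lE sE.
exists s0, (rcons ss (stt Q)); rewrite lE rcons_path pP pl H last_rcons; split=> //.
Qed.

(** Moves at [p], [q] and [c] prolong the current phase, moves at [z] leave it as it is, and a toll
    move that changes the load ends it at a moment when the rest of the configuration is small. *)
Let Inv_step P Q : rst E setT (K + T).+1 P Q -> Inv P -> Inv Q.
Proof.
case/and3P=> sP sQ /existsP[[v a] /and3P[_ pv /eqP PQ]] IP.
have EQ y : y != (v, a) -> (y \in Q) = (y \in P).
  by move=> yx; have /setP/(_ y) := PQ; rewrite !in_setD1 yx.
have pvN : (v, a) \notin preds E (v, a).
  by apply/negP=> /(subsetP pv); rewrite in_setD1 eqxx.
have {}pv : preds E (v, a) \subset P by apply: subset_trans pv (subD1set _ _).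
have colE b : b != a -> col b Q = col b P.
  by move=> ba; apply/setP=> w; rewrite !inE EQ // xpair_eqE (negPf ba) andbF.
have colD : col a P :\ v = col a Q :\ v.
  apply/setP=> w; rewrite !in_setD1 !inE; have [//|wv] := eqVneq w v.
  by rewrite EQ // xpair_eqE (negPf wv).
have trE w : (w != v) || (a \notin toll) -> tr w Q = tr w P.
  move=> H; apply/setP=> b; rewrite !in_set; case bt: (b \notin _) => //=.
  rewrite EQ // xpair_eqE negb_and; case/orP: H => [->//|aN].
  by apply/orP; right; apply: contraNneq aN => <-; rewrite inE bt.
have zE w : a != z -> ((w, z) \in Q) = ((w, z) \in P).
  by move=> az; rewrite EQ // xpair_eqE (eq_sym z) (negPf az) andbF.
have loadE : a != z -> a \notin toll -> load Q = load P.
  by move=> az aN; apply/setP=> w; rewrite !in_set trE ?aN ?orbT // zE.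
have [ap|ap] := eqVneq a p.
  subst a; apply: Inv_extend IP; first by apply: loadE; rewrite ?tollE ?distinct ?eqxx ?andbF.
  have [vz vu] := gate_preds_p pv.
  right; apply/or3P; constructor 1; apply/existsP; exists v.
  rewrite /sp /sq /sc /= (colE q) ?distinct // (colE c) ?distinct // !eqxx colD eqxx /=.
  rewrite inE vz /= andbT; apply/forallP=> u; apply/implyP; exact: vu.
have [aq|aq] := eqVneq a q.
  subst a; apply: Inv_extend IP; first by apply: loadE; rewrite ?tollE ?distinct ?eqxx ?andbF.
  have vu := gate_preds_q ok pv.
  right; apply/or3P; constructor 2; apply/existsP; exists v.
  by rewrite /sp /sq /sc /= (colE p) ?distinct // (colE c) ?distinct // !eqxx colD eqxx vu.
have [ac|ac] := eqVneq a c.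
  subst a; apply: Inv_extend IP; first by apply: loadE; rewrite ?tollE ?distinct ?eqxx ?andbF.
  have [vp vq] := gate_preds_c ok pv.
  right; apply/or3P; constructor 3; apply/existsP; exists v.
  rewrite /sp /sq /sc /= (colE p) ?distinct // (colE q) ?distinct // !eqxx colD eqxx.
  by rewrite !inE vp vq.
have sttE : stt Q = stt P by rewrite /stt !colE // eq_sym.
have aG : a \notin [:: p; q; c] by rewrite !inE !negb_or ap aq ac.
have {}pv := gate_preds_el ok aG pv.
have [az|az] := eqVneq a z.
  subst a; have aN : z \notin toll by rewrite tollE eqxx.
  apply: Inv_extend IP; last by left.
  apply/setP=> w; rewrite !in_set trE ?aN ?orbT //.
  have [->|wv] := eqVneq w v; last by rewrite EQ // xpair_eqE (negPf wv).
  (* The predecessors of [z] are present, so [toll_lower] makes the toll loaded whether or not [z]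
     is on. *)
  suff -> : ~~ connect (rst el toll T) set0 (tr v P) by rewrite !orbT.
  by apply: contraL pv => /toll_lower.
have at_ : a \in toll by rewrite tollE az ap aq ac.
have [lE|lN] := eqVneq (load Q) (load P); first by apply: Inv_extend IP => //; left.
have lD w : w != v -> (w \in load Q) = (w \in load P).
  by move=> wv; rewrite !in_set zE // trE // wv.
(* If both traces had at most [T] pebbles, this would be a move of the toll game within [T], and
   reversibility would preserve reachability and unreachability alike. *)
have [Y [YPQ sY stY YT]] : exists Y, [/\ Y = P \/ Y = Q, #|Y| <= (K + T).+1,
    stt Y = stt P & T < #|tr v Y|].
  have [TP|TP] := leqP #|tr v P| T; last by exists P; split=> //; left.
  have [TQ|TQ] := leqP #|tr v Q| T; last by exists Q; split=> //; right.
  case/negP: lN; apply/eqP/setP=> w; have [->|/lD//] := eqVneq w v.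
  rewrite !in_set zE //; congr (_ || ~~ _).
  have R : rst el toll T (tr v P) (tr v Q).
    apply: (@rst_toggle _ _ _ _ a) => //.
      rewrite subsetD1 pv /= inE; apply: contra pvN => aa.
      by rewrite inE /E /gate_edge /= (negPf ap) (negPf aq) (negPf ac) eqxx.
    apply/setP=> b; rewrite !in_setD1 !in_set; have [//|ba] := eqVneq b a.
    by rewrite EQ // xpair_eqE (negPf ba) andbF.
  apply/idP/idP => H; apply: connect_trans H _; apply: connect1 => //.
  by rewrite rst_sym.
(* Of the K + T + 1 pebbles at least T + 1 are in the toll of [v]. *)
have cnt : #|col p P| + #|col q P| + #|col c P| + #|load Y :\ v| <= K.
  have := leq_trans (gate_count ok Y v) sY.
  have -> : col p Y = col p P by case: stY.
  have -> : col q Y = col q P by case: stY.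
  have -> : col c Y = col c P by case: stY.
  have H1 : #|tr v Y| <= #|row p q c v Y|.
    apply: subset_leq_card; apply/subsetP=> b; rewrite !in_set => /andP[bt ->].
    by move: bt; rewrite andbT !in_cons negb_or => /andP[].
  have H2 : #|load Y :\ v| <= #|[set w | w != v & row p q c w Y != set0]|.
    apply: subset_leq_card; apply/subsetP=> w; rewrite in_setD1 => /andP[wv].
    rewrite !in_set wv /= => /orP[wz|].
      by apply/set0Pn; exists z; rewrite inE wz andbT !inE !distinct.
    apply: contraNneq => r0; suff -> : tr w Y = set0 by apply: connect0.
    apply/setP=> b; rewrite !in_set; apply/negP=> /andP[bt bY].
    have /setP/(_ b) := r0; rewrite !in_set bY andbT.
    by move: bt; rewrite in_cons negb_or => /andP[_ ->].
  lia.
(* The load before and after the move differs at [v] only, which costs one more. *)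
have wX X : X = P \/ X = Q -> weight (stt P) (load X) <= K.+1.
  move=> XPQ; have LX : #|load X| <= #|load Y :\ v|.+1.
    rewrite (cardsD1 v); have -> : load X :\ v = load Y :\ v.
      apply/setP=> w; rewrite !in_setD1; have [//|wv] := eqVneq w v.
      by case: XPQ => ->; case: YPQ => ->; rewrite ?lD.
    by case: (_ \in _).
  move: cnt LX; rewrite /weight /sp /sq /sc /=; lia.
case: IP => s0 [ss [pP pl w0 r0]].
(* The old phase ends under the old load, and a new one starts in the same gate state under the new
   load. *)
exists (stt Q), [::]; rewrite sttE /=; split=> //.
  by apply: wX; right.
have := phase_reach ok pP w0 _ r0; rewrite pl; apply.
by apply: wX; left.
Qed.

(** The budget may exceed K + T by one because [phase_reach] admits weight K + 1 at both ends and
    still simulates G1 within K. *)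
Lemma gate_rev_lower :
  connect (rst E setT (K + T).+1) set0 [set (t, c)] ->
  connect (rst e1 setT K) set0 [set t].
Proof.
have tr0 v (P : {set V * W}) : (forall a, a \in toll -> (v, a) \notin P) -> tr v P = set0.
  move=> H; apply/setP=> a; rewrite in_set in_set0; apply/negP=> /andP[at_].
  by apply/negP; apply: H.
have load0 (P : {set V * W}) : (forall v a, (a == z) || (a \in toll) -> (v, a) \notin P) -> load P = set0.
  move=> H; apply/setP=> v; rewrite in_set in_set0 (negPf (H v z _)) ?eqxx //=.
  by rewrite tr0 ?connect0 // => a at_; apply: H; rewrite at_ orbT.
move=> H; have : Inv [set (t, c)].
  apply: (connect_ind (I := Inv)) H _; first exact: Inv_step.
  have c0 a : col a (set0 : {set V * W}) = set0 by apply/setP=> v; rewrite !inE.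
  exists (stt set0), [::]; rewrite /= load0; last by move=> v a _; rewrite inE.
  split=> //; first by rewrite /weight /sp /sq /sc /= !c0 !cards0.
  suff -> : shadow e1 e1a (stt set0) = set0 by apply: connect0.
  apply/setP=> v; rewrite in_set /sp /sq /sc /= !c0 !in_set0 /=.
  by apply/norP; split; apply/existsP=> -[x]; rewrite in_set0.
case=> s0 [ss [pP pl w0 r0]]; move: pP w0; rewrite load0; last first.
  move=> v a at_; rewrite in_set1 xpair_eqE negb_and; apply/orP; right.
  by case/orP: at_ => [/eqP->|]; rewrite ?distinct // tollE => /and4P[].
have cp : col p [set (t, c)] = set0.
  by apply/setP=> v; rewrite !inE xpair_eqE distinct andbF.
have cq : col q [set (t, c)] = set0.
  by apply/setP=> v; rewrite !inE xpair_eqE distinct andbF.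
have cc : col c [set (t, c)] = [set t].
  by apply/setP=> v; rewrite !inE xpair_eqE eqxx andbT.
move=> pP w0; have := phase_reach ok pP w0 _ r0; rewrite pl.
rewrite /weight /sp /sq /sc /= cp cq cc !cards0 cards1 => /(_ isT).
suff -> : shadow e1 e1a (stt [set (t, c)]) = [set t] by [].
apply/setP=> v; rewrite in_set /sp /sq /sc /= cp cq cc !in_set0 /=.
case: (v \in [set t]) => //=.
by apply/norP; split; apply/existsP=> -[x]; rewrite in_set0.
Qed.

End Lower.

Section Upper.
Variables (T K : nat) (C : {set W}).
Hypothesis C_surround : preds el z \subset C.
Hypothesis C_card : #|C|.+2 <= T.
Hypothesis C_reach : connect (rst el toll T) set0 C.

Implicit Types (R : {set V}) (D : {set W}).

Let cf := @conf V W c.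

Let cf_add R v D a : a \notin D -> v \notin R -> #|R| + #|D| < K + T ->
  preds E (v, a) \subset cf R v D ->
  connect (rst E setT (K + T)) (cf R v D) (cf R v (a |: D)).
Proof.
move=> aD vR sz pv; apply: connect1.
have aN : (v, a) \notin cf R v D by rewrite inE /= (negPf vR) (negPf aD) andbF.
apply: (@rst_toggle _ _ _ _ (v, a)) => //.
- by apply: leq_trans (card_conf _ _ _ _) _; apply: ltnW.
- by apply: leq_trans (card_conf _ _ _ _) _; rewrite cardsU1 aD add1n addnS.
- by rewrite setD1_id.
- apply/setP=> -[u b]; rewrite !inE /= !xpair_eqE.
  by case: (u == v); case: (b == a); rewrite ?andbF ?andbT ?orbF.
Qed.

Let cf_toll R v D0 : v \notin R -> [disjoint D0 & toll] ->
  #|R| + #|D0| <= K ->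
  connect (rst E setT (K + T)) (cf R v D0) (cf R v (D0 :|: C)).
Proof.
move=> vR dis sz.
rewrite -[X in cf R v X](setU0 D0).
apply: (connect_homo (f := fun D : {set W} => cf R v (D0 :|: D))) C_reach => D D'.
case/and3P=> sD sD' /existsP[a /and3P[at_ pa /eqP DD]]; apply: connect1.
have szU (X : {set W}) : #|X| <= T -> #|cf R v (D0 :|: X)| <= K + T.
  move=> sX; apply: leq_trans (card_conf _ _ _ _) _.
  by have := (leq_card_setU D0 X).1; lia.
have aD0 : a \notin D0.
  by apply/negP=> aD0; have /pred0P/(_ a) := dis; rewrite /= aD0 at_.
apply: (@rst_toggle _ _ _ _ (v, a)); rewrite ?inE ?szU //.
  rewrite subsetD1; apply/andP; split.
    apply: conf_el; first by move: at_; rewrite tollE !in_cons !negb_or => /and4P[_ -> -> ->].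
    by apply: subset_trans pa _; apply: subset_trans (subD1set _ _) (subsetUr _ _).
  rewrite inE /E /gate_edge /=; move: (at_); rewrite tollE.
  case/and4P=> _ /negPf-> /negPf-> /negPf->; rewrite eqxx /=.
  by apply/negP=> aa; have /(subsetP pa) : a \in preds el a; rewrite ?inE ?eqxx.
apply/setP=> -[u b]; rewrite !in_setD1 !inE /= !xpair_eqE.
have [->|//] := eqVneq u v; have [//|ba] := eqVneq b a; rewrite /= .
have /setP/(_ b) := DD; rewrite !in_setD1 ba /= => ->; done.
Qed.

(** [C] stays in place until the gate is clean again. At most three of [z], [p], [q], [c] are
    pebbled at a time, so [C_card] bounds the local pebbles by T + 1, beside at most K - 1
    elsewhere. *)
Lemma gate_rev_lift R R' : connect (rst e1 setT K) R R' ->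
  connect (rst E setT (K + T)) [set x | (x.1 \in R) && (x.2 == c)]
    [set x | (x.1 \in R') && (x.2 == c)].
Proof.
apply: (connect_homo (f := fun R : {set V} => [set x | (x.1 \in R) && (x.2 == c)])).
move=> {}R {}R' /and3P[sR sR' /existsP[v /and3P[_ pv /eqP RR]]].
suff H (S : {set V}) : v \notin S -> preds e1 v \subset S -> #|S| < K ->
    connect (rst E setT (K + T)) [set x | (x.1 \in S) && (x.2 == c)]
      [set x | (x.1 \in v |: S) && (x.2 == c)].
  case: (setD1_eq RR) => [->|[vR E']|[vR E']]; first exact: connect0.
    by rewrite E'; apply: H => //; [rewrite setD1_id in pv | rewrite E' cardsU1 vR in sR'].
  rewrite E'; apply: connect_rst_sym; apply: H => //; first by rewrite E' setU1K in pv.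
  by rewrite E' cardsU1 vR in sR.
move=> {R R' sR sR' pv RR} vS pv sS.
have Ct : C \subset toll := rst_subset C_reach.
have CN a : a \notin toll -> a \notin C by apply: contra => /(subsetP Ct).
have Cz : z \notin C by apply: CN; rewrite tollE eqxx.
have Cp : p \notin C by apply: CN; rewrite tollE eqxx andbF.
have Cq : q \notin C by apply: CN; rewrite tollE eqxx !andbF.
have Cc : c \notin C by apply: CN; rewrite tollE eqxx !andbF.
have -> : [set x | (x.1 \in S) && (x.2 == c)] = cf S v set0.
  by apply/setP=> x; rewrite !inE andbF orbF.
have -> : [set x | (x.1 \in v |: S) && (x.2 == c)] = cf S v [set c].
  by apply/setP=> x; rewrite !inE -andb_orl orbC.
apply: (@connect_trans _ _ (cf S v C)).
  have -> : cf S v C = cf S v (set0 :|: C) by rewrite set0U.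
  apply: cf_toll => //.
    by apply/pred0P=> x; rewrite /= inE.
  by rewrite cards0 addn0 ltnW.
have zD (D : {set W}) : C \subset D -> z \notin D -> #|S| + #|D| < K + T ->
    connect (rst E setT (K + T)) (cf S v D) (cf S v (z |: D)).
  move=> CD zD sz; apply: cf_add => //; apply: conf_el; last exact: subset_trans CD.
  by rewrite !inE !distinct.
have cU (D : {set W}) a : #|a |: D| <= #|D|.+1 by rewrite cardsU1; case: (_ \notin _).
apply: (@connect_trans _ _ (cf S v (z |: C))); first by apply: zD => //; lia.
apply: (@connect_trans _ _ (cf S v (p |: (z |: C)))).
  apply: cf_add => //; first by rewrite !inE !distinct.
    by have := cU C z; lia.
  by apply: (conf_p ok) => //; rewrite setU11.
(* [z] makes room for [q] and [c]; it has to come back later, because [p] can only be removed above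
   it. *)
rewrite setUCA; apply: (@connect_trans _ _ (cf S v (p |: C))).
  apply: connect_rst_sym; apply: zD; first exact: subsetUr.
    by rewrite !inE !distinct.
  by have := cU C p; lia.
apply: (@connect_trans _ _ (cf S v (q |: (p |: C)))).
  apply: cf_add => //; first by rewrite !inE !distinct.
    by have := cU C p; lia.
  exact: (conf_q ok).
apply: (@connect_trans _ _ (cf S v (c |: (q |: (p |: C))))).
  apply: cf_add => //; first by rewrite !inE !distinct.
    by have := cU (p |: C) q; have := cU C p; lia.
  by apply: (conf_c ok); rewrite !inE eqxx ?orbT.
rewrite setUCA; apply: (@connect_trans _ _ (cf S v (c |: (p |: C)))).
  apply: connect_rst_sym; apply: cf_add => //; first by rewrite !inE !distinct.
    by have := cU (p |: C) c; have := cU C p; lia.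
  exact: (conf_q ok).
apply: (@connect_trans _ _ (cf S v (z |: (c |: (p |: C))))).
  apply: zD; first by rewrite setUA subsetUr.
    by rewrite !inE !distinct.
  by have := cU (p |: C) c; have := cU C p; lia.
rewrite [c |: (p |: C)]setUCA [z |: (p |: _)]setUCA.
apply: (@connect_trans _ _ (cf S v (z |: (c |: C)))).
  apply: connect_rst_sym; apply: cf_add => //; first by rewrite !inE !distinct.
    by have := cU (c |: C) z; have := cU C c; lia.
  by apply: (conf_p ok) => //; rewrite setU11.
apply: (@connect_trans _ _ (cf S v (c |: C))).
  apply: connect_rst_sym; apply: zD; first exact: subsetUr.
    by rewrite !inE !distinct.
  by have := cU C c; lia.
(* Releasing the toll is paying it backwards, now beside the pebble on [c]. *)
apply: connect_rst_sym; apply: cf_toll => //.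
  by rewrite disjoints1 tollE eqxx !andbF.
by rewrite cards1 addn1.
Qed.

Lemma gate_rev_upper t : connect (rst e1 setT K) set0 [set t] ->
  connect (rst E setT (K + T)) set0 [set (t, c)].
Proof.
move/gate_rev_lift.
have -> : [set x : V * W | (x.1 \in set0) && (x.2 == c)] = set0.
  by apply/setP=> x; rewrite !inE.
suff -> : [set x : V * W | (x.1 \in [set t]) && (x.2 == c)] = [set (t, c)] by [].
by apply/setP=> -[u a]; rewrite !inE xpair_eqE.
Qed.

End Upper.

End GateReversible.

(** * Standard price of the gate product *)

Lemma sst_card (V : finType) (e : rel V) (A P : {set V}) s :
  connect (sst e A s) set0 P -> #|P| <= s.
Proof.
move=> H; apply: (connect_ind (I := fun P : {set V} => #|P| <= s)) H _; last by rewrite cards0.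
by move=> X Y /and3P[].
Qed.

Lemma sst_sub (V : finType) (e : rel V) (A P Q : {set V}) s :
  #|P| <= s -> Q \subset P -> sst e A s P Q.
Proof.
by move=> sP QP; rewrite /sst sP QP (leq_trans (subset_leq_card QP)).
Qed.

Lemma sst_place (V : finType) (e : rel V) (A P : {set V}) s v :
  v \in A -> #|v |: P| <= s -> preds e v \subset P -> sst e A s P (v |: P).
Proof.
move=> vA sP pv; rewrite /sst sP (leq_trans _ sP) /=; last first.
  by apply: subset_leq_card; apply: subsetUr.
by apply/orP; right; apply/existsP; exists v; rewrite vA pv eqxx.
Qed.

Section GateStandard.
Variables (V W : finType) (e1 e1a : rel V) (el : rel W) (z p q c : W).
Hypothesis ok : gate_ok e1 e1a el z p q c.

Let distinct := gate_neq ok.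
Let A : {set W} := [set a | a \notin [:: p; q; c]].
Let E := gate_edge e1 e1a el z p q c.

Section Lower.
Variables (T K : nat) (t : V).
Hypothesis toll_lower : forall D, connect (sst el A T) set0 D -> z \notin D.

Implicit Types (P Q : {set V * W}) (X : {set V}).

Let rw v (P : {set V * W}) := row p q c v P.
Let lod (D : {set W}) := ~~ connect (sst el A T) set0 D.
Let Tk (P : {set V * W}) := [set v | [|| lod (rw v P), (v, p) \in P | (v, c) \in P]].
(** A pebble [q_v] is charged to v if v is being simulated, and otherwise to its other predecessor:
    one vertex per pebble in either case. *)
Let Ch (P : {set V * W}) (X : {set V}) := Tk P :|: (X :&: col q P)
  :|: [set w | [exists v, [&& v \in col q P, v \notin X & e1b e1 e1a w v]]].

(* [X] is the simulated configuration of G1 and [Ch] the set of charged vertices,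
   which grows only when a toll gets loaded, and then [gate_count] bounds it. *)
Let Inv0 (P : {set V * W}) (X : {set V}) :=
  [/\ connect (sst e1 setT K) set0 X, col c P \subset X,
      col p P :&: col q P \subset X,
      (forall v w, v \in col q P -> v \notin X -> e1b e1 e1a w v -> w \in X)
    & #|Ch P X| <= K].

Let Inv (P : {set V * W}) := exists2 X, Inv0 P X & X \subset Ch P X.

(** Simulated pebbles without a charge are dropped, as the standard game permits. The clauses of
    [Inv0] survive because every vertex they demand is charged. *)
Let normalize P X : Inv0 P X -> Inv P.
Proof.
case=> rX cX pqX qX sX; set X' := X :&: Ch P X.
have inX v : v \in col q P -> (v \in X') = (v \in X).
  by move=> vq; rewrite in_setI !in_setU in_setI vq andbT; case: (v \in X); rewrite ?orbT.
have cT : col c P \subset Tk P.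
  by apply/subsetP=> v; rewrite !inE => ->; rewrite !orbT.
have pT : col p P \subset Tk P.
  by apply/subsetP=> v; rewrite !inE => ->; rewrite !orbT.
have TC : Tk P \subset Ch P X by rewrite /Ch -setUA subsetUl.
have ChE : Ch P X' = Ch P X.
  rewrite /Ch; congr (_ :|: _ :|: _); apply/setP=> v.
    rewrite [LHS]in_setI [RHS]in_setI.
    by have [vq|] := boolP (v \in col q P); rewrite ?andbF // inX.
  rewrite [LHS]in_set [RHS]in_set; apply/existsP/existsP => -[x /and3P[xq xX xv]]; exists x.
    by rewrite xq -inX ?xX.
  by rewrite xq inX ?xX.
exists X'; last by rewrite ChE subsetIr.
split; rewrite ?ChE //.
- apply: (connect_trans rX); apply: connect1; apply: sst_sub (subsetIl _ _).
  exact: sst_card rX.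
- by rewrite subsetI cX (subset_trans cT TC).
- by rewrite subsetI pqX (subset_trans (subset_trans (subsetIl _ _) pT) TC).
move=> v w vq; rewrite inX // => vX wv; rewrite in_setI (qX v) //= !in_setU.
by apply/orP; right; rewrite in_set; apply/existsP; exists v; rewrite vq vX.
Qed.

(** In the standard game reachable sets are closed under subsets, so a removal never loads a
    toll. *)
Let Tk_sub P Q : Q \subset P -> Tk Q \subset Tk P.
Proof.
move=> QP; apply/subsetP=> v; rewrite !in_set => /or3P[H|H|H].
- apply/or3P; constructor 1; apply: contra H => H; apply: (connect_trans H).
  apply: connect1; apply: sst_sub; first by apply: sst_card; exact: H.
  by apply/subsetP=> a; rewrite !in_set => /andP[->] /(subsetP QP)->.
- by rewrite (subsetP QP _ H) orbT.
- by rewrite (subsetP QP _ H) !orbT.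
Qed.

(** For the move that completes the pair [p_v], [q_v]: v joins the simulated configuration at no
    cost, since it is already charged for its toll or for [p_v]. *)
Let Inv_add P Q X v : Inv0 P X -> X \subset Ch P X -> Tk Q \subset Tk P ->
  col c Q = col c P -> col p Q \subset v |: col p P -> col q Q \subset v |: col q P ->
  v \in Tk P -> preds e1 v \subset X -> Inv0 Q (v |: X).
Proof.
case=> rX cX pqX qX sX XC TQ cE pS qS vT pv.
have CC : Ch Q (v |: X) \subset Ch P X.
  apply/subsetP=> x; rewrite !in_setU => /orP[/orP[/(subsetP TQ)->//|]|].
    rewrite in_setI in_setU1 => /andP[/predU1P[->|xX] xq]; first by rewrite vT.
    by have := subsetP XC _ xX; rewrite !in_setU.
  rewrite !in_set => /existsP[y /and3P[yq]]; rewrite in_setU1 negb_or => /andP[yv yX] xy.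
  apply/orP; right; apply/existsP; exists y; rewrite yX xy andbT /= andbT.
  by have := subsetP qS _ yq; rewrite in_setU1 (negPf yv).
split.
- apply: (connect_trans rX); apply: connect1; apply: sst_place => //.
  apply: leq_trans sX; apply: subset_leq_card; rewrite subUset XC andbT sub1set.
  by rewrite !in_setU vT.
- by rewrite cE; apply: subset_trans cX (subsetUr _ _).
- apply/subsetP=> x; rewrite in_setI => /andP[/(subsetP pS) xp /(subsetP qS) xq].
  move: xp xq; rewrite !in_setU1; have [//|_ /= xp xq] := eqVneq x v.
  by apply: (subsetP pqX); rewrite in_setI xp xq.
- move=> x w /(subsetP qS); rewrite !in_setU1 negb_or => xq /andP[xv xX] wx.
  by rewrite (qX x w) ?orbT //; move: xq; rewrite (negPf xv).
exact: leq_trans (subset_leq_card CC) sX.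
Qed.

Let Inv_step P Q : sst E setT (K + T) P Q -> Inv P -> Inv Q.
Proof.
case/and3P=> sP sQ PQ [X I0 XC]; have [rX cX pqX qX sX] := I0.
case/orP: PQ => [QP|/existsP[[v a] /and3P[_ pv /eqP QE]]].
  have cS b : col b Q \subset col b P.
    by apply/subsetP=> v; rewrite !inE => /(subsetP QP).
  apply: (@normalize _ X); split=> //.
  - exact: subset_trans (cS _) cX.
  - by apply: subset_trans pqX; apply: setISS.
  - by move=> v w /(subsetP (cS _)); apply: qX.
  apply: leq_trans sX; apply: subset_leq_card; rewrite /Ch.
  apply: setUSS; first by apply: setUSS; [exact: Tk_sub | exact: setIS].
  apply/subsetP=> w; rewrite !in_set => /existsP[x /and3P[xq xX xw]].
  by apply/existsP; exists x; rewrite (subsetP (cS _) _ xq) xX.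
have colE b : b != a -> col b Q = col b P.
  by move=> ba; apply/setP=> w; rewrite !inE QE in_setU1 xpair_eqE (negPf ba) andbF.
have colA : col a Q = v |: col a P.
  by apply/setP=> w; rewrite !inE QE in_setU1 xpair_eqE eqxx andbT.
have rwE w : (w != v) || (a \in [:: p; q; c]) -> rw w Q = rw w P.
  move=> H; apply/setP=> b; rewrite !in_set QE in_setU1 xpair_eqE.
  case/orP: H => [/negPf->//|aG]; have [->|_] := eqVneq b a; first by rewrite aG.
  by rewrite andbF.
have vTp w : (w, p) \in P -> w \in Tk P by rewrite in_set => ->; rewrite orbT.
have vTc w : (w, c) \in P -> w \in Tk P by rewrite in_set => ->; rewrite !orbT.
have TkE : a \in [:: p; q; c] -> v \in Tk P \/ a = q -> Tk Q \subset Tk P.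
  move=> aG vT; apply/subsetP=> w; have [->|wv] := eqVneq w v.
    case: vT => [->//|aq]; subst a; rewrite !in_set rwE ?aG ?orbT //.
    by rewrite QE !in_setU1 !xpair_eqE !distinct !andbF.
  by rewrite !in_set rwE ?wv // QE !in_setU1 !xpair_eqE (negPf wv).
have [ap|ap] := eqVneq a p.
  subst a; have [vz vu] := gate_preds_p pv.
  have vT : v \in Tk P.
    rewrite in_set; apply/or3P; constructor 1; apply: contraL (vz) => /toll_lower.
    by rewrite !in_set !in_cons !distinct.
  have TS : Tk Q \subset Tk P by apply: TkE; [rewrite !inE eqxx | left].
  (* The pair becomes complete: the first predecessor carries [c], and the other one is in [X] by
     the clause of [Inv0] on [q_v]. *)
  have [/andP[vq vX]|] := boolP ((v \in col q P) && (v \notin X)).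
    apply: (@normalize _ (v |: X)); apply: (Inv_add I0 XC TS) => //.
    - by rewrite colE ?distinct.
    - by rewrite colA.
    - by rewrite colE ?distinct // subsetUr.
    apply/subsetP=> u; rewrite inE (in_e1 ok) => /orP[/vu/(subsetP cX)//|].
    exact: qX vq vX.
  rewrite negb_and negbK => vqX; apply: (@normalize _ X); split=> //.
  - by rewrite colE ?distinct.
  - rewrite colA colE ?distinct //; apply/subsetP=> x; rewrite in_setI in_setU1.
    case/andP=> /predU1P[->|xp] xq; first by move: vqX; rewrite xq.
    by apply: (subsetP pqX); rewrite in_setI xp xq.
  - by rewrite colE ?distinct.
  apply: leq_trans sX; apply: subset_leq_card; rewrite /Ch colE ?distinct //.
  by rewrite -!setUA; apply: setSU.
have [aq|aq] := eqVneq a q.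
  subst a; have vu := gate_preds_q ok pv.
  have TS : Tk Q \subset Tk P by apply: TkE; [rewrite !inE eqxx orbT | right].
  have [vp|vp] := boolP ((v, p) \in P).
    apply: (@normalize _ (v |: X)); apply: (Inv_add I0 XC TS); rewrite ?colA //.
    - by rewrite colE ?distinct.
    - by rewrite colE ?distinct // subsetUr.
    - exact: vTp.
    - exact: subset_trans vu cX.
  apply: (@normalize _ X); split=> //.
  - by rewrite colE ?distinct.
  - rewrite colA colE ?distinct //; apply/subsetP=> x; rewrite in_setI in_setU1.
    case/andP=> xp /predU1P[xv|xq]; first by move: xp; rewrite xv inE (negPf vp).
    by apply: (subsetP pqX); rewrite in_setI xp xq.
  - move=> x w; rewrite colA in_setU1 => /predU1P[->|]; last exact: qX.
    move=> _ wv; apply: (subsetP cX); apply: (subsetP vu); by rewrite inE (in_e1 ok) wv orbT.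
  (* The charge of the new [q_v] goes to v in [X], charged because [X] lies in [Ch], or to a
     predecessor charged for its pebble on [c]. *)
  apply: leq_trans sX; apply: subset_leq_card; apply/subsetP=> x.
  rewrite /Ch colA !in_setU => /orP[/orP[/(subsetP TS)->//|]|].
    rewrite in_setI => /andP[xX _]; have := subsetP XC _ xX.
    by rewrite !in_setU.
  rewrite in_set => /existsP[y /and3P[]]; rewrite in_setU1 => /predU1P[->|yq] yX xy.
    suff -> : x \in Tk P by [].
    apply: vTc; have /(subsetP vu) : x \in preds e1 v by rewrite inE (in_e1 ok) xy orbT.
    by rewrite inE.
  by apply/orP; right; rewrite in_set; apply/existsP; exists y; rewrite yq yX.
have [ac|ac] := eqVneq a c.
  subst a; have [vp vq] := gate_preds_c ok pv.
  have TS : Tk Q \subset Tk P.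
    by apply: TkE; [rewrite !inE eqxx !orbT | left; apply: vTp].
  apply: (@normalize _ X); split=> //.
  - rewrite colA subUset cX sub1set andbT; apply: (subsetP pqX).
    by rewrite !inE vp vq.
  - by rewrite !colE ?distinct.
  - by rewrite colE ?distinct.
  apply: leq_trans sX; apply: subset_leq_card; rewrite /Ch colE ?distinct //.
  by rewrite -!setUA; apply: setSU.
have aG : a \notin [:: p; q; c] by rewrite !inE !negb_or ap aq ac.
have pQ : col p Q = col p P by rewrite colE // eq_sym.
have qQ : col q Q = col q P by rewrite colE // eq_sym.
have cQ : col c Q = col c P by rewrite colE // eq_sym.
apply: (@normalize _ X); split; rewrite ?pQ ?qQ ?cQ //.
have memQ w b : b \in [:: p; q; c] -> ((w, b) \in Q) = ((w, b) \in P).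
  move=> bG; rewrite QE in_setU1 xpair_eqE; suff -> : (b == a) = false by rewrite andbF.
  by apply: contraNF aG => /eqP<-.
have [TS|TN] := boolP (Tk Q \subset Tk P).
  by apply: leq_trans sX; apply: subset_leq_card; rewrite /Ch qQ -!setUA; apply: setSU.
have [lQ lP] : lod (rw v Q) /\ ~~ lod (rw v P).
  case/subsetPn: TN => w; have [->|wv] := eqVneq w v; last first.
    by rewrite !in_set rwE ?wv // !memQ ?inE ?eqxx ?orbT // => ->.
  rewrite !in_set !memQ ?inE ?eqxx ?orbT // !negb_or => /or3P[lQ|->|->];
    by rewrite ?andbF // => /andP[].
(* The toll of [v] has just become unreachable within [T], so it holds more than [T] pebbles. This
   leaves at most K - 1 for the other charges, and [v] is the K-th. *)
have Tr : T < #|rw v Q|.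
  rewrite ltnNge; apply: contra lQ => sz; rewrite /lod negbK in lP *.
  apply: (connect_trans lP); apply: connect1.
  move: sz; have -> : rw v Q = a |: rw v P.
    apply/setP=> b; rewrite in_setU1 !in_set QE in_setU1 xpair_eqE eqxx /=.
    by have [->|] := eqVneq b a; rewrite ?aG.
  move=> sz; apply: sst_place => //; first by rewrite inE.
  apply: subset_trans (gate_preds_el ok aG pv) _; apply/subsetP=> b; rewrite !in_set.
  by case/andP=> bt ->; move: bt; rewrite andbT !in_cons negb_or => /andP[].
pose F x := if x \in X then [set x] else [set w | e1b e1 e1a w x].
have F1 x : #|F x| <= 1.
  by rewrite /F; case: ifP; rewrite ?cards1 // => _; apply: (card_e1b ok).
pose S1 := [set w | w != v & rw w Q != set0].
have CS : Ch Q X \subset [set v] :|: (S1 :|: col p P :|: col c P :|: \bigcup_(x in col q P) F x).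
  apply/subsetP=> x; rewrite in_setU1; have [//|xv] := eqVneq x v.
  rewrite /Ch qQ !in_setU /= => /orP[/orP[|]|].
  - rewrite in_set !memQ ?inE ?eqxx ?orbT //= xv => /or3P[lx|->|->]; rewrite ?orbT //=.
    suff -> : rw x Q != set0 by [].
    by apply: contraNneq lx => ->; apply: connect0.
  - rewrite in_setI => /andP[xX xq]; apply/orP; right; apply/bigcupP; exists x => //.
    by rewrite /F xX set11.
  rewrite in_set => /existsP[y /and3P[yq yX xy]]; apply/orP; right.
  by apply/bigcupP; exists y => //; rewrite /F (negPf yX) inE.
apply: leq_trans (subset_leq_card CS) _.
have C1 := (leq_card_setU [set v] (S1 :|: col p P :|: col c P :|: \bigcup_(x in col q P) F x)).1.
have C2 := (leq_card_setU (S1 :|: col p P :|: col c P) (\bigcup_(x in col q P) F x)).1.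
have C3 := (leq_card_setU (S1 :|: col p P) (col c P)).1.
have C4 := (leq_card_setU S1 (col p P)).1.
have C5 := card_bigcup_le1 (col q P) F1.
have := leq_trans (gate_count ok Q v) sQ; rewrite pQ qQ cQ -/S1 -/(rw v Q) => C6.
rewrite cards1 in C1.
have ar (x0 x1 x2 x3 x4 x5 x6 x7 x8 x9 : nat) : x0 <= 1 + x1 -> x1 <= x2 + x3 ->
    x2 <= x4 + x5 -> x4 <= x6 + x7 -> x3 <= x8 -> T < x9 ->
    x7 + x8 + x5 + x6 + x9 <= K + T -> x0 <= K.
  by clear; lia.
exact: ar C1 C2 C3 C4 C5 Tr C6.
Qed.

Lemma gate_std_lower :
  connect (sst E setT (K + T)) set0 [set (t, c)] ->
  connect (sst e1 setT K) set0 [set t].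
Proof.
move=> H; have : Inv [set (t, c)].
  apply: (connect_ind (I := Inv)) H _; first exact: Inv_step.
  have c0 a : col a (set0 : {set V * W}) = set0 by apply/setP=> v; rewrite !inE.
  apply: (@normalize _ set0); split; rewrite ?c0 ?sub0set //.
  - by rewrite set0I sub0set.
  - by move=> v w; rewrite in_set0.
  suff -> : Ch set0 set0 = set0 by rewrite cards0.
  apply/setP=> v; rewrite /Ch c0 set0I setU0 in_setU in_set0.
  have -> : v \in Tk set0 = false.
    rewrite in_set !in_set0 !orbF; suff -> : rw v set0 = set0 by rewrite /lod connect0.
    by apply/setP=> a; rewrite !in_set andbF.
  by rewrite in_set; apply/existsP=> -[x]; rewrite in_set0.
case=> X [rX cX _ _ _] _; apply: (connect_trans rX); apply: connect1.
apply: sst_sub; first exact: sst_card rX.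
by apply: subset_trans cX; rewrite sub1set inE set11.
Qed.

End Lower.

Section Upper.
Variables (T K : nat).
Hypothesis T2 : 2 <= T.
Hypothesis toll_upper : connect (sst el A T.+1) set0 [set z].
Implicit Types (R : {set V}) (D : {set W}).

Let cf := @conf V W c.

Let cf_add R v D a : #|R| + #|D| < K + T ->
  preds E (v, a) \subset cf R v D ->
  connect (sst E setT (K + T)) (cf R v D) (cf R v (a |: D)).
Proof.
move=> sz pv; apply: connect1.
have E' : cf R v (a |: D) = (v, a) |: cf R v D.
  apply/setP=> -[u b]; rewrite !inE /= xpair_eqE.
  by case: (u == v); case: (b == a); rewrite ?orbT ?andbF.
rewrite E'; apply: sst_place; rewrite ?inE // -E'.
apply: leq_trans (card_conf _ _ _ _) _; rewrite cardsU1; case: (_ \notin _) => /=; lia.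
Qed.

Let cf_sub R v D D' : #|R| + #|D| <= K + T -> D' \subset D ->
  connect (sst E setT (K + T)) (cf R v D) (cf R v D').
Proof.
move=> sz DD; apply: connect1; apply: sst_sub.
  exact: leq_trans (card_conf _ _ _ _) sz.
apply/subsetP=> -[u b]; rewrite !inE /= => /orP[->//|/andP[-> /(subsetP DD)->]].
by rewrite orbT.
Qed.

(** Only [z] is kept of the paid toll, then only [p]. The peak of the gate is three pebbles, and
    [T2] makes them fit into the T + 1 places that the toll used. *)
Lemma gate_std_lift R R' : connect (sst e1 setT K) R R' ->
  connect (sst E setT (K + T)) [set x | (x.1 \in R) && (x.2 == c)]
    [set x | (x.1 \in R') && (x.2 == c)].
Proof.
apply: (connect_homo (f := fun R : {set V} => [set x | (x.1 \in R) && (x.2 == c)])).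
move=> {}R {}R' /and3P[sR sR'].
have lamE v (S : {set V}) : [set x : V * W | (x.1 \in S) && (x.2 == c)] = cf S v set0.
  by apply/setP=> x; rewrite !inE andbF orbF.
case/orP=> [RR|/existsP[v /and3P[_ pv /eqP RE]]].
  apply: connect1; apply: sst_sub.
    (* The size bound goes through [conf], which needs some vertex; without any, the configuration
       is empty. *)
    have [/eqP|[v _]] := set_0Vmem [set: V]; last first.
      rewrite (lamE v); apply: leq_trans (card_conf _ _ _ _) _.
      by rewrite cards0 addn0; apply: leq_trans sR _; apply: leq_addr.
    rewrite -subset0 => /subsetP V0; rewrite eq_card0 // => -[v a].
    by have := V0 v; rewrite !inE => /(_ isT).
  by apply/subsetP=> x; rewrite !inE => /andP[/(subsetP RR)-> ->].
have [vR|vR] := boolP (v \in R).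
  by rewrite RE (setUidPr _) ?sub1set // connect0.
have sz : #|R| < K by rewrite RE cardsU1 vR in sR'.
rewrite (lamE v) RE.
have -> : [set x : V * W | (x.1 \in v |: R) && (x.2 == c)] = cf R v [set c].
  by apply/setP=> x; rewrite !inE -andb_orl orbC.
apply: (@connect_trans _ _ (cf R v [set z])).
  apply: (connect_homo (f := fun D : {set W} => cf R v D)) toll_upper => D D'.
  case/and3P=> sD sD' /orP[DD|/existsP[a /and3P[aA pa /eqP DE]]].
    by apply: cf_sub => //; lia.
  rewrite DE; have [aD|aD] := boolP (a \in D).
    by rewrite (setUidPr _) ?sub1set // connect0.
  apply: cf_add; first by rewrite DE cardsU1 aD in sD'; lia.
  by apply: conf_el => //; rewrite inE in aA.
have cU D a : #|a |: D| <= #|D|.+1 by rewrite cardsU1; case: (_ \notin _).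
apply: (@connect_trans _ _ (cf R v (p |: [set z]))).
  by apply: cf_add; [rewrite cards1; lia | apply: (conf_p ok) => //; rewrite set11].
apply: (@connect_trans _ _ (cf R v [set p])).
  apply: cf_sub; last by rewrite sub1set setU11.
  by have := cU [set z] p; rewrite cards1; lia.
apply: (@connect_trans _ _ (cf R v (q |: [set p]))).
  by apply: cf_add; [rewrite cards1; lia | apply: (conf_q ok)].
apply: (@connect_trans _ _ (cf R v (c |: (q |: [set p])))).
  apply: cf_add; last by apply: (conf_c ok); rewrite !inE eqxx ?orbT.
  by have := cU [set p] q; rewrite cards1; lia.
apply: cf_sub; last by rewrite sub1set setU11.
by have := cU (q |: [set p]) c; have := cU [set p] q; rewrite cards1; lia.
Qed.

Lemma gate_std_upper t : connect (sst e1 setT K) set0 [set t] ->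
  connect (sst E setT (K + T)) set0 [set (t, c)].
Proof.
move/gate_std_lift.
have -> : [set x : V * W | (x.1 \in set0) && (x.2 == c)] = set0.
  by apply/setP=> x; rewrite !inE.
suff -> : [set x : V * W | (x.1 \in [set t]) && (x.2 == c)] = [set (t, c)] by [].
by apply/setP=> -[u a]; rewrite !inE xpair_eqE.
Qed.

End Upper.

End GateStandard.

(** * The two products *)
(** The conditions of [ssdag] on an arbitrary vertex type, so that products can be built on pairs
    and numbered only at the end. *)
Record dag_ok (X : finType) (e : rel X) (x0 : X) : Prop := DagOk {
  dag_acyclic : acyclic e;
  dag_sink : forall x, (forall y, ~~ e x y) <-> x = x0;
  dag_fan : forall x, #|preds e x| <= 2
}.

Lemma ssdag_ok (G : ssdag) : dag_ok (@edge G) (sink G).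
Proof. split; [exact: edge_acyclic | exact: sinkP | exact: fan_in_le2]. Qed.

Section Numbering.
Variables (N : nat) (X : finType) (e : rel X) (x0 : X) (f : 'I_N -> X) (g : X -> 'I_N).
Hypotheses (fK : cancel f g) (gK : cancel g f) (ok : dag_ok e x0).

Definition num_edge : rel 'I_N := fun i j => e (f i) (f j).

Lemma num_preds i : preds e (f i) = f @: preds num_edge i.
Proof.
apply/setP=> x; apply/idP/imsetP => [|[j + ->]]; rewrite !inE //.
by exists (g x); rewrite ?gK // inE /num_edge gK.
Qed.

Lemma num_acyclic : acyclic num_edge.
Proof.
apply: (acyclic_of_rank (r := anc_rank e \o f)) => i j ij /=.
exact: (anc_rankP (dag_acyclic ok)).
Qed.

Lemma num_sink i : (forall j, ~~ num_edge i j) <-> i = g x0.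
Proof.
split=> [H|-> j]; last by rewrite /num_edge gK; apply: (iffRL (dag_sink ok x0)).
rewrite -[i]fK; congr g; apply/(dag_sink ok) => y.
by have := H (g y); rewrite /num_edge gK.
Qed.

Lemma num_fan i : #|preds num_edge i| <= 2.
Proof.
by rewrite -(card_imset _ (can_inj fK)) -num_preds; apply: (dag_fan ok).
Qed.

Definition numbered := SSDag num_acyclic num_sink num_fan.

Lemma num_imT : f @: [set: 'I_N] = setT.
Proof. by apply/setP=> x; rewrite inE; apply/imsetP; exists (g x). Qed.

Lemma num_preim i : f @^-1: [set f i] = [set i].
Proof. by apply/setP=> j; rewrite !inE (can_eq fK). Qed.

Lemma RPeb_numbered s :
  RPeb numbered <= s <-> connect (rst e setT s) set0 [set x0].
Proof.
rewrite RPeb_leP /=; split=> H.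
  have := rst_emb (can_inj fK) num_preds H.
  by rewrite num_imT imset0 imset_set1 gK.
rewrite -num_imT in H; have := rst_preim (can_inj fK) num_preds H.
by rewrite preimset0 -{1}(gK x0) num_preim.
Qed.

Lemma Peb_numbered s :
  Peb numbered <= s <-> connect (sst e setT s) set0 [set x0].
Proof.
rewrite Peb_leP /=; split=> H.
  have := sst_emb (can_inj fK) num_preds H.
  by rewrite num_imT imset0 imset_set1 gK.
rewrite -num_imT in H; have := sst_preim (can_inj fK) num_preds H.
by rewrite preimset0 -{1}(gK x0) num_preim.
Qed.

End Numbering.

Lemma sub_dag (V : finType) (e : rel V) t : dag_ok e t -> dag_ok (sub e) (t, true).
Proof.
case=> ac snk fan; split.
- apply: (acyclic_of_rank (r := fun x : V * bool => (anc_rank e x.1).*2 + x.2)) => -[u bu] [v bv].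
  rewrite /sub /=; case: bv => /andP[]; first by move=> /eqP-> /negPf->; lia.
  by move=> -> /(anc_rankP ac); lia.
- case=> v b; split=> [H|[-> ->] [w bw]]; last first.
    rewrite /sub /=; case: bw; rewrite ?andbF //; exact: (iffRL (snk t)).
  case: b H => H; last by have := H (v, true); rewrite /sub /= eqxx.
  by rewrite (iffLR (snk v)) // => w; have := H (w, false).
case=> v b; case: b.
  apply: (@leq_trans #|[set (v, false)]|); last by rewrite cards1.
  apply: subset_leq_card; apply/subsetP=> -[u bu]; rewrite !inE /sub /= xpair_eqE.
  by case: bu; rewrite ?andbF ?andbT.
apply: leq_trans (fan v); apply: leq_trans (leq_imset_card (fun u => (u, true)) _).
apply: subset_leq_card; apply/subsetP=> -[u bu]; rewrite inE /sub /=.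
by case/andP=> -> uv; apply/imsetP; exists u; rewrite ?inE.
Qed.

(** * Acyclicity, sink and fan-in of the gate product *)

Section GateDag.
Variables (V W : finType) (e1 e1a : rel V) (el : rel W) (z p q c : W) (t : V).
Hypothesis ok : gate_ok e1 e1a el z p q c.
Hypothesis ok1 : dag_ok e1 t.
Hypothesis el_acyclic : acyclic el.
Hypothesis el_fan : forall b, b \notin [:: p; q; c] -> #|preds el b| <= 2.
Hypothesis el_out : forall a, a \in toll z p q c ->
  exists2 b, b \notin [:: p; q; c] & el a b.

Let distinct := gate_neq ok.

Lemma gate_dag : dag_ok (gate_edge e1 e1a el z p q c) (t, c).
Proof.
split.
(* Lexicographic rank, G1 first. Locally [p] and [q] are put above all toll vertices and [c] above
   both, whatever [el] says about these three. *)
- pose B := (\max_a anc_rank el a).+1.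
  have rB a : anc_rank el a < B by rewrite ltnS; apply: leq_bigmax.
  pose rl a := if a == p then B else if a == q then B else if a == c then B.+1
    else anc_rank el a.
  have rlB a : rl a < B.+2 by rewrite /rl; have := rB a; do 3!case: ifP => // _; lia.
  apply: (acyclic_of_rank (r := fun x : V * W => anc_rank e1 x.1 * B.+2 + rl x.2)).
  have cross u v x y : e1 u v -> anc_rank e1 u * B.+2 + rl x < anc_rank e1 v * B.+2 + rl y.
    move=> /(anc_rankP (dag_acyclic ok1)) uv; have := rlB x.
    have : (anc_rank e1 u).+1 * B.+2 <= anc_rank e1 v * B.+2 by rewrite leq_mul2r uv orbT.
    rewrite mulSn; lia.
  case=> u a [v b]; rewrite /gate_edge /=; case: eqVneq => [->|bp].
    case/orP=> [/andP[/eqP-> /eqP->]|/andP[_ /(gate_a1 ok)]]; last exact: cross.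
    by rewrite ltn_add2l /rl !distinct eqxx.
  case: eqVneq => [->|bq]; first by case/andP=> _; apply: cross.
  case: eqVneq => [->|bc] /andP[].
    by move/eqP-> => /orP[]/eqP->; rewrite ltn_add2l /rl !distinct !eqxx.
  move/eqP-> => ab; rewrite ltn_add2l /rl (negPf bp) (negPf bq) (negPf bc).
  have := gate_el ok ab; rewrite !inE !negb_or bp bq bc => /(_ isT).
  case/and4P=> _ /negPf-> /negPf-> /negPf->.
  exact: (anc_rankP el_acyclic).
- case=> v a; split=> [H|[-> ->] [w b]]; last first.
    have tN u : e1 t u = false by apply/negbTE; move: u; apply/(dag_sink ok1).
    rewrite /gate_edge /= eqxx !distinct !andbF /=.
    case: ifP => [_|/negbT bp].
      by apply/negP=> /(gate_a1 ok); rewrite tN.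
    case: ifP => [_|/negbT bq]; first by rewrite tN.
    case: ifP => [//|/negbT bc]; apply/negP=> /andP[_ /(gate_el ok)].
    by rewrite !inE !negb_or bp bq bc !eqxx !andbF => /(_ isT).
  have [az|az] := eqVneq a z.
    by have := H (v, p); rewrite /gate_edge /= az !eqxx.
  have [ap|ap] := eqVneq a p.
    by have := H (v, c); rewrite /gate_edge /= ap !distinct !eqxx.
  have [aq|aq] := eqVneq a q.
    by have := H (v, c); rewrite /gate_edge /= aq !distinct !eqxx orbT.
  have [ac|ac] := eqVneq a c; last first.
    have [|b] := @el_out a; first by rewrite !inE !negb_or az ap aq ac.
    rewrite !inE !negb_or => /and3P[/negPf bp /negPf bq /negPf bc] ab.
    by have := H (v, b); rewrite /gate_edge /= bp bq bc eqxx ab.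
  rewrite ac; congr (_, _); apply/(dag_sink ok1) => u.
  by have := H (u, q); rewrite /gate_edge /= ac !distinct !eqxx.
case=> v b; have [->|bp] := eqVneq b p.
  apply: (@leq_trans #|[set (v, z)] :|: [set (u, c) | u in [set u | e1a u v]]|).
    apply: subset_leq_card; apply/subsetP=> -[u a]; rewrite !inE /gate_edge /= eqxx.
    case/orP=> /andP[]; first by move=> /eqP-> /eqP->; rewrite eqxx.
    by move/eqP-> => uv; apply/orP; right; apply/imsetP; exists u; rewrite ?inE.
  apply: leq_trans (leq_card_setU _ _) _; rewrite cards1 -(addn1 1) leq_add2l.
  by apply: leq_trans (leq_imset_card _ _) _; apply: (card_e1a ok).
have [->|bq] := eqVneq b q.
  apply: leq_trans (dag_fan ok1 v); apply: leq_trans (leq_imset_card (fun u => (u, c)) _).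
  apply: subset_leq_card; apply/subsetP=> -[u a]; rewrite !inE /gate_edge /= !distinct eqxx.
  by case/andP=> /eqP-> uv; apply/imsetP; exists u; rewrite ?inE.
have [->|bc] := eqVneq b c.
  apply: (@leq_trans #|[set (v, p); (v, q)]|); last by rewrite cards2; case: (_ != _).
  apply: subset_leq_card; apply/subsetP=> -[u a]; rewrite !inE /gate_edge /= !distinct eqxx.
  by case/andP=> /eqP-> /orP[]/eqP->; rewrite !eqxx ?orbT.
have bG : b \notin [:: p; q; c] by rewrite !inE !negb_or bp bq bc.
apply: leq_trans (el_fan bG); apply: leq_trans (leq_imset_card (pair v) _).
apply: subset_leq_card; apply/subsetP=> -[u a]; rewrite !inE /gate_edge /=.
rewrite (negPf bp) (negPf bq) (negPf bc) => /andP[/eqP-> ab].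
by apply/imsetP; exists a; rewrite ?inE.
Qed.

End GateDag.

Section FirstPred.
Variables (n : nat) (e : rel 'I_n).

(** Choosing the least number lets a program find the distinguished predecessor by search. *)
Definition first_pred : rel 'I_n := fun u v =>
  e u v && [forall u' : 'I_n, (u' < u) ==> ~~ e u' v].

Lemma first_pred_fun u u' v : first_pred u v -> first_pred u' v -> u = u'.
Proof.
case/andP=> uv /forallP H /andP[u'v /forallP H']; apply/val_inj/eqP.
case: (ltngtP u u') => // lt; first by have := H' u; rewrite lt uv.
by have := H u'; rewrite lt u'v.
Qed.

(** Two different other predecessors and the least one would make three. *)
Lemma other_pred_fun u u' v : #|preds e v| <= 2 ->
  e1b e first_pred u v -> e1b e first_pred u' v -> u = u'.
Proof.
move=> fan /andP[uv Nu] /andP[u'v Nu'].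
have [m mv mmin] := @arg_minnP _ u (fun w => e w v) (fun w => w : nat) uv.
have Fm : first_pred m v.
  rewrite /first_pred mv; apply/forallP=> w; apply/implyP=> wm; apply/negP=> /mmin.
  by rewrite leqNgt wm.
have um : m != u by apply: contraNneq Nu => <-.
have u'm : m != u' by apply: contraNneq Nu' => <-.
apply/eqP; apply: contraLR fan => uu'; rewrite -ltnNge.
apply: (@leq_trans #|[set m; u; u']|).
  by rewrite -setUA cardsU1 !inE negb_or um u'm cards2 uu'.
apply: subset_leq_card; apply/subsetP=> x; rewrite !inE -orbA.
by case/or3P=> /eqP->.
Qed.

End FirstPred.

(** * Arithmetic numbering of the vertices *)

Section DivMod.
Variables m k : nat.

Lemma ord_div_subproof (i : 'I_(m * k)) : i %/ k < m.
Proof. by case: k i => [|k'] [i] /=; rewrite ?muln0 // => lt; rewrite ltn_divLR. Qed.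

Lemma ord_mod_subproof (i : 'I_(m * k)) : i %% k < k.
Proof. by case: k i => [|k'] [i] /=; rewrite ?muln0 // ltn_mod. Qed.

Lemma ord_pair_subproof (x : 'I_m * 'I_k) : x.1 * k + x.2 < m * k.
Proof.
case: x => [[a am] [b bk]] /=; apply: (@leq_trans (a.+1 * k)); first by rewrite mulSn; lia.
by rewrite leq_mul2r am orbT.
Qed.

(** An explicit formula instead of an enumeration of the pairs, so that the programs can decode
    vertex numbers by division with remainder. *)
Definition divmod (i : 'I_(m * k)) : 'I_m * 'I_k :=
  (Ordinal (ord_div_subproof i), Ordinal (ord_mod_subproof i)).

Definition undivmod (x : 'I_m * 'I_k) : 'I_(m * k) := Ordinal (ord_pair_subproof x).

Lemma divmodK : cancel divmod undivmod.
Proof. by move=> i; apply: val_inj; rewrite /= -divn_eq. Qed.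

Lemma undivmodK : cancel undivmod divmod.
Proof.
case=> a b; have k0 : 0 < k by case: (k) b => [[]|].
congr (_, _); apply: val_inj; rewrite /=.
  by rewrite divnMDl // divn_small ?addn0.
by rewrite modnMDl modn_small.
Qed.

End DivMod.

(** The position in a chain of four after two subdivisions, in binary: the inner subdivision is the
    high bit. *)
Definition bits4 (i : 'I_4) : bool * bool := (1 < i, odd i).
Definition unbits4 (b : bool * bool) : 'I_4 :=
  if b.1 then (if b.2 then inord 3 else inord 2) else (if b.2 then inord 1 else inord 0).

Lemma bits4K : cancel bits4 unbits4.
Proof. by case=> [[|[|[|[|i]]]] lt] //; apply: val_inj; rewrite /= inordK. Qed.

Lemma unbits4K : cancel unbits4 bits4.
Proof. by case=> [[] []]; rewrite /bits4 /unbits4 /= inordK. Qed.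

(** * The standard and the reversible product *)

Section Products.
Variables G1 G2 : ssdag.
Let n1 := nvert G1.
Let n2 := nvert G2.
Let e1 := @edge G1.
Let e2 := @edge G2.
Let t2 := sink G2.

Definition std_local := ('I_n2 + 'I_3)%type.
Definition std_el : rel std_local := fun a b =>
  if a is inl a' then if b is inl b' then e2 a' b' else false else false.
Definition std_p : std_local := inr (inord 0).
Definition std_q : std_local := inr (inord 1).
Definition std_c : std_local := inr (inord 2).
Definition std_z : std_local := inl t2.

Lemma std_notin a : (a \notin [:: std_p; std_q; std_c]) = (if a is inl _ then true else false).
Proof.
rewrite !inE; case: a => // -[i lt]; apply/negbTE; rewrite negbK.
rewrite /std_p /std_q /std_c /eq_op /= -!val_eqE /= !inordK //.
by case: i lt => [|[|[|]]].
Qed.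

Lemma std_gate_ok : gate_ok e1 (first_pred e1) std_el std_z std_p std_q std_c.
Proof.
split.
- rewrite /= !inE /std_z /std_p /std_q /std_c /eq_op /= -!val_eqE /= !inordK //.
- move=> [a|a] [b|b] //= ab _; rewrite inE in_cons negb_or std_notin andbT.
  rewrite /std_z /eq_op /=; apply: contraTneq ab => ->.
  by move: b; apply/sinkP.
- exact: acyclic_irr (@edge_acyclic G1).
- by move=> u v /andP[].
- exact: first_pred_fun.
- by move=> u u' v; apply: other_pred_fun; apply: fan_in_le2.
Qed.

Lemma std_inl_preds v : preds std_el (inl v) = inl @: preds e2 v.
Proof.
apply/setP=> -[u|u]; rewrite inE /=.
  by rewrite mem_imset ?inE // => x y [].
by apply/esym/negP=> /imsetP[].
Qed.

Lemma std_dag_ok : dag_ok (gate_edge e1 (first_pred e1) std_el std_z std_p std_q std_c)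
  (sink G1, std_c).
Proof.
apply: gate_dag; [exact: std_gate_ok | exact: ssdag_ok | | |].
- apply: (acyclic_of_rank (r := fun a : std_local => if a is inl a' then anc_rank e2 a' else 0)).
  by move=> [a|a] [b|b] //= /(anc_rankP (@edge_acyclic G2)).
- move=> [b|b]; rewrite std_notin // => _; rewrite std_inl_preds.
  by apply: leq_trans (leq_imset_card _ _) _; apply: fan_in_le2.
move=> [a|a]; rewrite inE in_cons negb_or std_notin ?andbF // andbT => az.
have [b ab] : exists b, e2 a b.
  apply/existsP; apply: contraR az => /existsPn H; apply/eqP; congr inl.
  exact/sinkP.
by exists (inl b) => //; rewrite std_notin.
Qed.

Definition std_dec (i : 'I_(n1 * (n2 + 3))) : 'I_n1 * std_local :=
  ((divmod i).1, split (divmod i).2).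
Definition std_enc (x : 'I_n1 * std_local) : 'I_(n1 * (n2 + 3)) :=
  undivmod (x.1, unsplit x.2).

Lemma std_decK : cancel std_dec std_enc.
Proof.
move=> i; rewrite -[RHS]divmodK /std_enc /std_dec; case: (divmod i) => a b.
by rewrite [(_, _).1]/= [(_, _).2]/= splitK.
Qed.

Lemma std_encK : cancel std_enc std_dec.
Proof. by case=> a b; rewrite /std_dec undivmodK /= unsplitK. Qed.

Definition std_prod := numbered std_decK std_encK std_dag_ok.

Lemma std_imA : inl @: [set: 'I_n2] = [set a : std_local | a \notin [:: std_p; std_q; std_c]].
Proof.
apply/setP=> -[a|a]; rewrite inE std_notin; first by rewrite imset_f.
by apply/negP=> /imsetP[].
Qed.

Lemma Peb_std_prod : 2 < Peb G2 -> Peb std_prod = Peb G1 + Peb G2 - 1.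
Proof.
move=> s3; have K0 := leq_ltn_trans (leq0n _) (Peb_indegree (sink G1)).
have inl_inj : injective (@inl 'I_n2 'I_3) by move=> x y [].
apply/eqP; rewrite eqn_leq; apply/andP; split.
  have -> : Peb G1 + Peb G2 - 1 = Peb G1 + (Peb G2).-1 by lia.
  apply/Peb_numbered; apply: (gate_std_upper std_gate_ok); first by lia.
    rewrite prednK; last by lia.
    have /Peb_leP H := leqnn (Peb G2).
    have := sst_emb inl_inj std_inl_preds H.
    by rewrite imset0 imset_set1 std_imA.
  by apply/Peb_leP.
rewrite leqNgt; apply/negP=> lt.
have : Peb G1 <= (Peb G1).-1; last by lia.
apply/Peb_leP.
(* Both prices are lowered by one: K = Peb(G1) - 1 cannot pebble G1, and T = Peb(G2) - 1 cannot pay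
   a toll. *)
have /Peb_numbered H : Peb std_prod <= (Peb G1).-1 + (Peb G2).-1 by lia.
apply: (gate_std_lower std_gate_ok _ H) => D; rewrite -std_imA => HD; apply/negP=> zD.
have := sst_preim inl_inj std_inl_preds HD; rewrite preimset0 => HD'.
have : Peb G2 <= (Peb G2).-1; last by lia.
apply/Peb_leP; apply: (connect_trans HD'); apply: connect1; apply: sst_sub.
  exact: sst_card HD'.
by rewrite sub1set inE.
Qed.

Definition rev_local := ('I_n2 * bool * bool)%type.
Definition rev_el : rel rev_local := sub (sub e2).
(** The gate takes over the chain of four that replaces the sink of G2: [z] is its first vertex and
    the other three are rewired. The toll proper is then the subdivision of G2 without its sink. *)
Definition rev_z : rev_local := (t2, false, false).
Definition rev_p : rev_local := (t2, false, true).
Definition rev_q : rev_local := (t2, true, false).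
Definition rev_c : rev_local := (t2, true, true).

Lemma rev_tollE : toll rev_z rev_p rev_q rev_c = fibre (fibre [set~ t2]).
Proof.
apply/setP=> -[[v b1] b0]; rewrite !inE /= !xpair_eqE.
by case: (v == t2); case: b1; case: b0.
Qed.

Lemma e2_t2 v : e2 t2 v = false.
Proof. by apply/negbTE; move: v; apply/sinkP. Qed.

Lemma rev_gate_ok : gate_ok e1 (first_pred e1) rev_el rev_z rev_p rev_q rev_c.
Proof.
split.
- by rewrite /= !inE !xpair_eqE eqxx.
- move=> [[u a1] a0] [[v b1] b0]; rewrite rev_tollE !inE /= !xpair_eqE /rev_el /sub /=.
  case: b0 => /=.
    by case/andP=> /eqP[-> _] _; case: (v == t2) => //; case: b1.
  case: b1 => /=; case/andP=> _ /andP[].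
    by move=> /eqP-> _; case: (v == t2).
  by move=> _ uv _; apply: contraTneq uv => ->; rewrite e2_t2.
- exact: acyclic_irr (@edge_acyclic G1).
- by move=> u v /andP[].
- exact: first_pred_fun.
- by move=> u u' v; apply: other_pred_fun; apply: fan_in_le2.
Qed.

Lemma rev_dag_ok : dag_ok (gate_edge e1 (first_pred e1) rev_el rev_z rev_p rev_q rev_c)
  (sink G1, rev_c).
Proof.
have ok2 := sub_dag (sub_dag (ssdag_ok G2)).
apply: gate_dag; [exact: rev_gate_ok | exact: ssdag_ok | | |].
- exact: dag_acyclic ok2.
- by move=> b _; apply: (dag_fan ok2).
move=> a; rewrite rev_tollE !inE => at2.
have : a != (t2, true, true).
  by apply: contraNneq at2 => ->.
move=> aN; have [b ab] : exists b, rev_el a b.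
  apply/existsP; apply: contraR aN => /existsPn H; apply/eqP.
  exact: (iffLR (dag_sink ok2 a)).
exists b => //; move: ab at2; case: a {aN} => [[u a1] a0]; case: b => [[v b1] b0].
rewrite /rev_el /sub /= !inE !xpair_eqE /=; case: b0 => /=.
  by case/andP=> /andP[/eqP-> _] _ /negPf->.
by case: b1 => /=; [case/and3P=> _ /eqP-> _ /negPf-> | rewrite !andbF].
Qed.

Definition rev_dec (i : 'I_(n1 * (n2 * 4))) : 'I_n1 * rev_local :=
  ((divmod i).1, ((divmod (divmod i).2).1, (bits4 (divmod (divmod i).2).2).1,
    (bits4 (divmod (divmod i).2).2).2)).
Definition rev_enc (x : 'I_n1 * rev_local) : 'I_(n1 * (n2 * 4)) :=
  undivmod (x.1, undivmod (x.2.1.1, unbits4 (x.2.1.2, x.2.2))).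

Lemma rev_decK : cancel rev_dec rev_enc.
Proof.
move=> i; rewrite -[RHS]divmodK /rev_enc /rev_dec; case: (divmod i) => a b.
rewrite -[b in RHS]divmodK; case: (divmod b) => h j.
by rewrite -[j in RHS]bits4K; case: (bits4 j).
Qed.

Lemma rev_encK : cancel rev_enc rev_dec.
Proof. by case=> a [[h b1] b0]; rewrite /rev_dec /rev_enc undivmodK [(_, _).2]/= undivmodK [(_, _).2]/= unbits4K. Qed.

Definition rev_prod := numbered rev_decK rev_encK rev_dag_ok.

Lemma rev_preds_z : preds rev_el rev_z = top (top (preds e2 t2)).
Proof.
by apply/setP=> -[[u a1] a0]; rewrite !inE /rev_el /sub /=; case: a0; case: a1; rewrite ?andbF ?andbT.
Qed.

(** With RPeb(G2) = s + 2, surrounding the sink of G2 costs s + 1, hence s + 3 after two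
    subdivisions. The upper bound takes T = s + 3; the lower bound takes T = s + 2, which is too
    small, and regains one from [gate_rev_lower]. *)
Lemma RPeb_rev_prod : 1 < n2 -> RPeb rev_prod = RPeb G1 + RPeb G2 + 1.
Proof.
move=> n2_gt1; have K0 := leq_ltn_trans (leq0n _) (RPeb_indegree (sink G1)).
have r2 : 2 <= RPeb G2 := leq_ltn_trans (sink_pred n2_gt1) (RPeb_indegree (sink G2)).
have [s rE] : exists s, RPeb G2 = s.+2 by exists (RPeb G2).-2; lia.
apply/eqP; rewrite eqn_leq; apply/andP; split.
  rewrite -addnA; apply/RPeb_numbered.
  have /RPeb_leP : RPeb G2 <= s.+2 by rewrite rE.
  case/(surround_of_price (fun w => negbT (e2_t2 w))) => C pC HC.
  have H2 := sub_upper (sub_upper HC).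
  have top0 (U : finType) : top (set0 : {set U}) = set0 by apply/setP=> x; rewrite !inE.
  rewrite !top0 in H2.
  apply: (@gate_rev_upper _ _ _ _ _ _ _ _ _ rev_gate_ok _ _ (top (top C))).
  - rewrite rev_preds_z; apply/subsetP=> x; rewrite !inE => /andP[/andP[xp ->] ->].
    by rewrite (subsetP pC) // inE.
  (* [C] keeps its size through both subdivisions while the cost of reaching it rises by 2: exactly
     the slack that the gate needs. *)
  - by rewrite !card_top rE addn1 !ltnS; apply: rst_card HC.
  - by rewrite rev_tollE rE addn1.
  - by apply/RPeb_leP.
rewrite leqNgt; apply/negP=> lt.
have : RPeb G1 <= (RPeb G1).-1; last by lia.
apply/RPeb_leP.
have /RPeb_numbered H : RPeb rev_prod <= ((RPeb G1).-1 + s.+2).+1 by lia.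
apply: (gate_rev_lower rev_gate_ok _ H) => D; rewrite rev_tollE => HD.
apply/negP; rewrite rev_preds_z => YD.
(* Undoing two subdivisions leaves a surrounding within s, and hence price at most s + 1 for G2. *)
have [C1 YC1 HC1] := sub_visit_lower YD HD.
have [C YC HC] := sub_visit_lower YC1 HC1.
have /RPeb_leP := price_of_surround YC HC; by rewrite rE ltnn.
Qed.

End Products.

Section DoubleSubdivision.
Variable G : ssdag.
Let n := nvert G.

Definition sub2_dec (i : 'I_(n * 4)) : 'I_n * bool * bool :=
  ((divmod i).1, (bits4 (divmod i).2).1, (bits4 (divmod i).2).2).
Definition sub2_enc (x : 'I_n * bool * bool) : 'I_(n * 4) :=
  undivmod (x.1.1, unbits4 (x.1.2, x.2)).

Lemma sub2_decK : cancel sub2_dec sub2_enc.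
Proof.
move=> i; rewrite -[RHS]divmodK /sub2_enc /sub2_dec; case: (divmod i) => a j.
by rewrite -[j in RHS]bits4K; case: (bits4 j).
Qed.

Lemma sub2_encK : cancel sub2_enc sub2_dec.
Proof. by case=> [[h b1] b0]; rewrite /sub2_dec /sub2_enc undivmodK [(_, _).2]/= unbits4K. Qed.

Definition sub2 := numbered sub2_decK sub2_encK (sub_dag (sub_dag (ssdag_ok G))).

Lemma RPeb_sub2 : RPeb sub2 = RPeb G + 2.
Proof.
have K0 := leq_ltn_trans (leq0n _) (RPeb_indegree (sink G)).
have fT (U : finType) : fibre [set: U] = setT by apply/setP=> x; rewrite !inE.
apply/eqP; rewrite eqn_leq; apply/andP; split.
  apply/RPeb_numbered; have /RPeb_leP := leqnn (RPeb G).
  move/sub_upper/sub_upper; rewrite !fT addn2.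
  have top0 (U : finType) : top (set0 : {set U}) = set0 by apply/setP=> x; rewrite !inE.
  have top1 (U : finType) (x : U) : top [set x] = [set (x, true)].
    by apply/setP=> -[y b]; rewrite !inE xpair_eqE; case: b.
  by rewrite !top0 !top1.
rewrite leqNgt; apply/negP=> lt.
have : RPeb G <= (RPeb G).-1; last by lia.
have /RPeb_numbered H : RPeb sub2 <= (RPeb G).-1.+2 by lia.
by apply/RPeb_leP; apply: sub_price_lower; apply: sub_price_lower.
Qed.

End DoubleSubdivision.

(** * Paths, tournaments and degenerate factors *)

Definition deg2 (G : ssdag) := [exists v : 'I_(nvert G), 1 < #|preds (@edge G) v|].

Lemma Peb_deg2 G : deg2 G -> 2 < Peb G.
Proof. by case/existsP=> v; move/leq_ltn_trans; apply; apply: Peb_indegree. Qed.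

Lemma nvert_gt0 G : 0 < nvert G.
Proof. exact: leq_ltn_trans (leq0n _) (ltn_ord (sink G)). Qed.

(** Following the only predecessor leads back from the sink to a source, and two pebbles can walk
    this path forwards. *)
Lemma Peb_path G : ~~ deg2 G -> Peb G = (1 < nvert G).+1.
Proof.
move=> /existsPn H; have P0 := Peb_indegree (sink G).
have [n1|n1] := ltnP; last first.
  have := Peb_le_nvert G; lia.
have := sink_pred n1; suff : Peb G <= 2 by lia.
apply/Peb_leP; move: (sink G) => v.
have [m] := ubnP (anc_rank (@edge G) v); elim: m v => // m IH v vm.
have := H v; rewrite -leqNgt => v1.
have [E|[u uv]] := set_0Vmem (preds (@edge G) v).
  apply: connect1; rewrite -[X in sst _ _ _ _ X](setU0 [set v]).
  by apply: sst_place; rewrite ?inE // ?setU0 ?cards1 // E sub0set.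
have pE : preds (@edge G) v = [set u].
  by apply/esym/eqP; rewrite eqEcard sub1set uv cards1.
have uv' : edge u v by rewrite inE in uv.
have Hu : connect (sst (@edge G) setT 2) set0 [set u].
  by apply: IH; apply: leq_trans (anc_rankP (@edge_acyclic G) uv') _.
have c2 : #|v |: [set u]| <= 2 by rewrite cardsU1 cards1; case: (_ \notin _).
apply: (connect_trans Hu); apply: (@connect_trans _ _ (v |: [set u])).
  by apply: connect1; apply: sst_place => //; rewrite pE.
by apply: connect1; apply: sst_sub => //; rewrite sub1set setU11.
Qed.

Section Tournament.
Variables b1 b2 : bool.
Let n := b1 + b2.

Definition tour_edge : rel 'I_n.+1 := fun i j => i < j.

Lemma tour_preds i : #|preds tour_edge i| = i.
Proof.
rewrite /preds -sum1dep_card /tour_edge (big_ord_narrow (ltnW (ltn_ord i))) /=.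
by rewrite sum1_card card_ord.
Qed.

Lemma tour_acyclic : acyclic tour_edge.
Proof. exact: (acyclic_of_rank (r := fun i : 'I_n.+1 => i : nat)). Qed.

Lemma tour_sink i : (forall j, ~~ tour_edge i j) <-> i = ord_max.
Proof.
split=> [H|-> j]; last by rewrite /tour_edge -leqNgt /= -ltnS.
apply/val_inj/eqP; rewrite eqn_leq -ltnS ltn_ord /= leqNgt.
exact: (H ord_max).
Qed.

Lemma tour_fan i : #|preds tour_edge i| <= 2.
Proof.
rewrite tour_preds -ltnS; apply: leq_trans (ltn_ord i) _.
by rewrite /n; case: (b1); case: (b2).
Qed.

Definition tournament := SSDag tour_acyclic tour_sink tour_fan.

(** All other vertices precede the last one, so the indegree bound meets the number of vertices. *)
Lemma Peb_tournament : Peb tournament = n.+1.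
Proof.
apply/eqP; rewrite eqn_leq Peb_le_nvert /=.
by have := @Peb_indegree tournament ord_max; rewrite tour_preds.
Qed.

End Tournament.

(* [std_prod] needs a vertex of indegree 2 in its second factor. *)
Definition boxtimes (G1 G2 : ssdag) : ssdag :=
  if deg2 G2 then std_prod G1 G2
  else if deg2 G1 then std_prod G2 G1
  else tournament (1 < nvert G1) (1 < nvert G2).

(* For a single vertex [G2], of reversible price 1, the toll graph would be
   empty; subdividing [G1] twice adds the required 2. *)
Definition otimes (G1 G2 : ssdag) : ssdag :=
  if nvert G2 == 1 then sub2 G1 else rev_prod G1 G2.

Lemma Peb_boxtimes G1 G2 : Peb (boxtimes G1 G2) = Peb G1 + Peb G2 - 1.
Proof.
rewrite /boxtimes; case: ifP => [/Peb_deg2|/negbT d2]; first exact: Peb_std_prod.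
case: ifP => [/Peb_deg2|/negbT d1]; first by move/Peb_std_prod->; rewrite addnC.
rewrite Peb_tournament !Peb_path //; lia.
Qed.

Lemma RPeb_otimes G1 G2 : RPeb (otimes G1 G2) = RPeb G1 + RPeb G2 + 1.
Proof.
rewrite /otimes; case: eqVneq => [n2|n2]; last first.
  by apply: RPeb_rev_prod; have := nvert_gt0 G2; lia.
rewrite RPeb_sub2; suff -> : RPeb G2 = 1 by rewrite -addnA.
apply/eqP; rewrite eqn_leq (leq_ltn_trans _ (RPeb_indegree (sink G2))) // andbT.
apply/RPeb_leP; apply: connect1; apply: (@rst_toggle _ _ _ _ (sink G2)) => //.
- by rewrite cards0.
- by rewrite cards1.
- apply/subsetP=> v; rewrite inE => vs; exfalso.
  have vE : v = sink G2.
    by apply: val_inj; have := ltn_ord v; have := ltn_ord (sink G2); move: n2 => /=; lia.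
  by move: vs; rewrite vE (acyclic_irr (@edge_acyclic G2)).
by rewrite setDv set0D.
Qed.

Lemma nvert_boxtimes G1 G2 :
  nvert (boxtimes G1 G2) <= 4 * (nvert G1 + nvert G2) ^ 2.
Proof.
have := nvert_gt0 G1; have := nvert_gt0 G2; rewrite /boxtimes.
case: ifP => _; [|case: ifP => _]; rewrite /=; nia.
Qed.

Lemma nvert_otimes G1 G2 :
  nvert (otimes G1 G2) <= 4 * (nvert G1 + nvert G2) ^ 2.
Proof.
have := nvert_gt0 G1; have := nvert_gt0 G2; rewrite /otimes.
case: ifP => _; rewrite /=; nia.
Qed.

(** * Programs *)
Lemma while_loop cnt body (J : nat -> state -> Prop) n k :
  (forall i s, i < n -> J i s ->
     exists t s', [/\ exec body s t s', t <= k & J i.+1 s']) ->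
  (forall i s, i <= n -> J i s -> cell s cnt = n - i) ->
  forall s, J 0 s ->
  exists t s', [/\ exec (CWhile cnt body) s t s', t <= n * k.+1 + 1 & J n s'].
Proof.
move=> Hb Hc s J0.
suff H m i s0 : i + m = n -> J i s0 ->
    exists t s', [/\ exec (CWhile cnt body) s0 t s', t <= m * k.+1 + 1 & J n s'].
  exact: H J0.
elim: m i s0 => [|m IH] i s0 im Ji.
  rewrite addn0 in im; subst i; exists 1, s0; split=> //.
  by apply: exec_while_false; rewrite (Hc n) // subnn.
have lt : i < n by lia.
have [t1 [s1 [e1 l1 J1]]] := Hb _ _ lt Ji.
have [|t2 [s2 [e2 l2 J2]]] := IH i.+1 s1 _ J1; first by lia.
exists (t1 + t2).+1, s2; split=> //; last by rewrite mulSn; lia.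
by apply: exec_while_true e1 e2; rewrite (Hc i) //; lia.
Qed.

(* The even cells serve as registers and the odd ones hold the input, so that
   scratch registers can be allocated upwards without a bound. *)
Definition agree (r : nat) (s s' : state) : Prop :=
  [/\ forall x, x < r -> cell s x.*2 = cell s' x.*2,
      forall a, cell s a.*2.+1 = cell s' a.*2.+1
    & input s = input s'].

Lemma agree_refl r s : agree r s s. Proof. by []. Qed.

Lemma agree_trans r s1 s2 s3 : agree r s1 s2 -> agree r s2 s3 -> agree r s1 s3.
Proof.
case=> a1 b1 c1 [a2 b2 c2]; split=> [x xr|a|]; rewrite -?c2 //.
  by rewrite a1 ?a2.
by rewrite b1.
Qed.

Lemma agree_le r r' s s' : r <= r' -> agree r' s s' -> agree r s s'.
Proof. by move=> le [a b c]; split=> // x xr; apply: a; apply: leq_trans le. Qed.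

Lemma agree_set r s x v : r <= x -> agree r s (set_cell s x.*2 v).
Proof.
by move=> rx; split=> [y yr|a|] //=; case: eqP => //; lia.
Qed.

(* [run c r] leaves its result in register [r], touching only registers from
   [r] on; [cost c] bounds both the coefficient and the degree of its time. *)
Record code := Code { run : nat -> cmd; cost : nat }.

(** Quantifying over later registers and states makes a code reusable after other code and inside
    loops, as long as the registers below [r] and the input cells are intact. *)
Definition computes (B r : nat) (s : state) (c : code) (n : nat) : Prop :=
  forall r' s', r <= r' -> agree r s s' -> exists t s'',
    [/\ exec (run c r') s' t s'', t <= cost c * B ^ cost c, cell s'' r'.*2 = n,
        agree r' s' s'' & output s'' = output s'].

Definition emits (B r : nat) (s : state) (c : code) (out : seq nat) : Prop :=
  forall r' s', r <= r' -> agree r s s' -> exists t s'',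
    [/\ exec (run c r') s' t s'', t <= cost c * B ^ cost c,
        agree r' s' s'' & output s'' = output s' ++ out].

Lemma computes_agree B r r' s s' c n : r <= r' -> agree r s s' ->
  computes B r s c n -> computes B r' s' c n.
Proof.
move=> le ag H r1 s1 le1 ag1; apply: H; first exact: leq_trans le1.
by apply: (agree_trans ag); apply: agree_le ag1.
Qed.

Lemma cost_mono B k K : 0 < B -> k <= K -> k * B ^ k <= k * B ^ K.
Proof. by move=> B0 kK; rewrite leq_mul2l leq_pexp2l // orbT. Qed.

(** A loop of at most [B] rounds multiplies the time by [B], and a strictly larger degree absorbs
    this factor. *)
Lemma cost_mono1 B k K : 0 < B -> k < K -> B * (k * B ^ k) <= k * B ^ K.
Proof.
move=> B0 kK; rewrite mulnCA leq_mul2l -expnS leq_pexp2l // orbT //.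
Qed.

Lemma cost_const B K : 0 < B -> 0 < B ^ K. Proof. by rewrite expn_gt0 => ->. Qed.

(** * Program combinators and their cost *)

Section Combinators.
Variable B : nat.
Hypothesis B0 : 0 < B.

Definition c_const n := Code (fun r => CConst r.*2 n) 1.

Lemma computes_const r s n : computes B r s (c_const n) n.
Proof.
move=> r' s' le ag; exists 1, (set_cell s' r'.*2 n); split=> //.
- exact: exec_const.
- by rewrite mul1n expn1.
- by rewrite /= eqxx.
- exact: agree_set.
Qed.

(** Copying is adding to a cleared register. *)
Definition c_var x :=
  Code (fun r => CSeq (CConst r.*2 0) (CAdd r.*2 r.*2 x.*2)) 2.

Lemma computes_var r s x : x < r -> computes B r s (c_var x) (cell s x.*2).
Proof.
move=> xr r' s' le [ag1 ag2 ag3].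
exists 2, (set_cell (set_cell s' r'.*2 0) r'.*2 (cell s' x.*2)); split=> //.
- apply: (exec_seq (exec_const _ _ _)).
  have -> : cell s' x.*2 = cell (set_cell s' r'.*2 0) r'.*2 + cell (set_cell s' r'.*2 0) x.*2.
    by rewrite /= eqxx add0n; case: eqP => //; lia.
  exact: exec_add.
- by rewrite -[X in X <= _]muln1 leq_mul2l cost_const.
- by rewrite /= eqxx ag1.
- by apply: agree_trans (agree_set _ _ _) (agree_set _ _ _).
Qed.

Section Binary.
Variables (op : nat -> nat -> nat) (mk : nat -> nat -> nat -> cmd).
Hypothesis mkP : forall i j k s,
  exec (mk i j k) s 1 (set_cell s i (op (cell s j) (cell s k))).

Definition c_bin (c1 c2 : code) := Code (fun r =>
  CSeq (run c1 r) (CSeq (run c2 r.+1) (mk r.*2 r.*2 r.+1.*2))) (cost c1 + cost c2 + 1).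

Lemma computes_bin r s c1 c2 n1 n2 : computes B r s c1 n1 -> computes B r s c2 n2 ->
  computes B r s (c_bin c1 c2) (op n1 n2).
Proof.
move=> H1 H2 r' s' le ag.
have [t1 [s1 [x1 l1 v1 a1 o1]]] := H1 _ _ le ag.
have ag1 : agree r s s1 by apply: agree_trans ag _; apply: agree_le a1.
have [t2 [s2 [x2 l2 v2 a2 o2]]] := H2 _ _ (leqW le) ag1.
exists (t1 + (t2 + 1)), (set_cell s2 r'.*2 (op n1 n2)); split.
- apply: exec_seq x1 _; apply: exec_seq x2 _.
  have -> : n1 = cell s2 r'.*2 by case: a2 => <-.
  by rewrite -v2; apply: mkP.
- have C1 := cost_mono B0 (leq_addr (cost c2 + 1) (cost c1)).
  have C2 := cost_mono B0 (leq_trans (leq_addl (cost c1) (cost c2)) (leq_addr 1 _)).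
  have C3 := cost_const (cost c1 + cost c2 + 1) B0.
  rewrite addnA in C1; rewrite /= !mulnDl mul1n; lia.
- by rewrite /= eqxx.
- apply: agree_trans a1 _; apply: agree_trans (agree_set _ _ _) => //.
  exact: agree_le a2.
- by rewrite /= o2.
Qed.

End Binary.

Definition c_add := c_bin CAdd.
Definition c_sub := c_bin CSub.

Lemma computes_add r s c1 c2 n1 n2 : computes B r s c1 n1 -> computes B r s c2 n2 ->
  computes B r s (c_add c1 c2) (n1 + n2).
Proof. exact: (computes_bin (op := addn) exec_add). Qed.

Lemma computes_sub r s c1 c2 n1 n2 : computes B r s c1 n1 -> computes B r s c2 n2 ->
  computes B r s (c_sub c1 c2) (n1 - n2).
Proof. exact: (computes_bin (op := subn) exec_sub). Qed.

(** Entry [n] of the input is stored at the odd address 2 n + 1. *)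
Definition c_load (c : code) := Code (fun r => CSeq (run c r)
  (CSeq (CAdd r.*2 r.*2 r.*2) (CSeq (CConst r.+1.*2 1)
  (CSeq (CAdd r.*2 r.*2 r.+1.*2) (CLoad r.*2 r.*2))))) (cost c + 4).

Lemma computes_load r s c n : computes B r s c n ->
  computes B r s (c_load c) (cell s n.*2.+1).
Proof.
move=> H r' s' le ag; have [t1 [s1 [x1 l1 v1 a1 o1]]] := H _ _ le ag.
pose s2 := set_cell s1 r'.*2 n.*2.
pose s3 := set_cell s2 r'.+1.*2 1.
pose s4 := set_cell s3 r'.*2 n.*2.+1.
exists (t1 + (1 + (1 + (1 + 1)))), (set_cell s4 r'.*2 (cell s n.*2.+1)); split.
- apply: exec_seq x1 _; apply: (@exec_seq _ _ _ s2).
    have -> : s2 = set_cell s1 r'.*2 (cell s1 r'.*2 + cell s1 r'.*2) by rewrite v1 addnn.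
    exact: exec_add.
  apply: (@exec_seq _ _ _ s3); first exact: exec_const.
  apply: (@exec_seq _ _ _ s4).
    have -> : s4 = set_cell s3 r'.*2 (cell s3 r'.*2 + cell s3 r'.+1.*2).
      rewrite /s4; congr set_cell; rewrite /s3 /s2 /= eqxx; case: eqP; first by lia.
      by rewrite eqxx addn1.
    exact: exec_add.
  have -> : cell s n.*2.+1 = cell s4 (cell s4 r'.*2).
    rewrite {2}/s4 /= eqxx /s4 /s3 /s2 /=.
    case: a1 ag => _ a1 _ [_ ag _]; rewrite ag a1.
    by repeat (case: eqP => [|_]; first by lia).
  exact: exec_load.
- have C1 := cost_mono B0 (leq_addr 4 (cost c)).
  have C3 := cost_const (cost c + 4) B0.
  rewrite /= mulnDl; lia.
- by rewrite /= eqxx.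
- apply: agree_trans a1 _; apply: agree_trans (agree_set _ _ _) => //.
  apply: agree_trans (agree_set _ _ _) => //.
  by apply: agree_trans (agree_set _ _ _) (agree_set _ _ _).
- by rewrite /= o1.
Qed.

Definition c_if (c c1 c2 : code) := Code (fun r =>
  CSeq (run c r) (CIf r.*2 (run c1 r) (run c2 r))) (cost c + cost c1 + cost c2 + 1).

(** A branch has to be correct only when it is taken: it may look up matrix entries that exist only
    then. *)
Lemma computes_if r s c c1 c2 n m : computes B r s c n ->
  (0 < n -> computes B r s c1 m) -> (n = 0 -> computes B r s c2 m) ->
  computes B r s (c_if c c1 c2) m.
Proof.
move=> H H1 H2 r' s' le ag; have [t0 [s0 [x0 l0 v0 a0 o0]]] := H _ _ le ag.
have ag0 : agree r s s0 by apply: agree_trans ag _; apply: agree_le a0.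
set K := cost c + cost c1 + cost c2 + 1.
have C0 : cost c * B ^ cost c <= cost c * B ^ K by apply: cost_mono => //; rewrite /K; lia.
have C1 : cost c1 * B ^ cost c1 <= cost c1 * B ^ K by apply: cost_mono => //; rewrite /K; lia.
have C2 : cost c2 * B ^ cost c2 <= cost c2 * B ^ K by apply: cost_mono => //; rewrite /K; lia.
have C3 := cost_const K B0.
have [n0|n0] := posnP n.
  have [t1 [s1 [x1 l1 v1 a1 o1]]] := H2 n0 _ _ le ag0.
  exists (t0 + t1.+1), s1; split=> //.
  - apply: exec_seq x0 _; apply: exec_if_false x1; by rewrite v0.
  - rewrite /= -/K {1}/K !mulnDl mul1n; lia.
  - exact: agree_trans a1.
  - by rewrite o1.
have [t1 [s1 [x1 l1 v1 a1 o1]]] := H1 n0 _ _ le ag0.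
exists (t0 + t1.+1), s1; split=> //.
- apply: exec_seq x0 _; apply: exec_if_true x1; by rewrite v0.
- rewrite /= -/K {1}/K !mulnDl mul1n; lia.
- exact: agree_trans a1.
- by rewrite o1.
Qed.

(** Register [r] accumulates, [r.+1] counts down, and [r.+2] holds the index seen by the body, which
    works from [r.+3] on. *)
Definition c_sum (cb : code) (body : nat -> code) := Code (fun r =>
  CSeq (run cb r.+1) (CSeq (CConst r.*2 0) (CSeq (CConst r.+2.*2 0)
  (CWhile r.+1.*2 (CSeq (run (body r.+2) r.+3) (CSeq (CAdd r.*2 r.*2 r.+3.*2)
    (CSeq (CConst r.+3.*2 1) (CSeq (CAdd r.+2.*2 r.+2.*2 r.+3.*2)
    (CSub r.+1.*2 r.+1.*2 r.+3.*2)))))))))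
  (cost cb + cost (body 0) + 10).

Lemma computes_sum r s cb body n F :
  n <= B -> (forall x, cost (body x) = cost (body 0)) ->
  computes B r s cb n ->
  (forall x s' i, r <= x -> i < n -> agree r s s' -> cell s' x.*2 = i ->
     computes B x.+1 s' (body x) (F i)) ->
  computes B r s (c_sum cb body) (\sum_(0 <= i < n) F i).
Proof.
move=> nB bc Hb HF r' s' le ag.
have [t1 [s1 [x1 l1 v1 a1 o1]]] := Hb _ _ (leqW le) ag.
pose s2 := set_cell (set_cell s1 r'.*2 0) r'.+2.*2 0.
pose J i st := [/\ cell st r'.*2 = \sum_(0 <= j < i) F j, cell st r'.+1.*2 = n - i,
  cell st r'.+2.*2 = i, agree r' s' st & output st = output s'].
have J0 : J 0 s2.
  split=> //.
  - rewrite big_geq //= eqxx; case: eqP => //; lia.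
  - rewrite /= v1 subn0; by repeat (case: eqP => [|_]; first by lia).
  - by rewrite /= eqxx.
  - apply: agree_trans (agree_le (leqnSn _) a1) _.
    apply: agree_trans (agree_set _ _ _) (agree_set _ _ _); lia.
set kb := cost (body 0) * B ^ cost (body 0).
have HC i st : i <= n -> J i st -> cell st r'.+1.*2 = n - i by move=> _ [].
have [i st lt [j1 j2 j3 j4 j5]|t2 [s3 [x3 l3 [f1 f2 f3 f4 f5]]]] :=
    @while_loop r'.+1.*2 (CSeq (run (body r'.+2) r'.+3) (CSeq (CAdd r'.*2 r'.*2 r'.+3.*2)
    (CSeq (CConst r'.+3.*2 1) (CSeq (CAdd r'.+2.*2 r'.+2.*2 r'.+3.*2)
    (CSub r'.+1.*2 r'.+1.*2 r'.+3.*2))))) J n (kb + 4) _ HC _ J0.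
  have agt : agree r s st by apply: agree_trans ag _; apply: agree_le j4.
  have [t3 [s3 [x3 l3 v3 a3 o3]]] :=
    HF _ _ _ (leqW (leqW le)) lt agt j3 _ _ (leqnn _) (agree_refl _ _).
  case: (a3) => a3r _ _.
  have E0 : cell s3 r'.*2 = \sum_(0 <= j < i) F j by rewrite -a3r ?j1 //; lia.
  have E1 : cell s3 r'.+1.*2 = n - i by rewrite -a3r ?j2 //; lia.
  have E2 : cell s3 r'.+2.*2 = i by rewrite -a3r ?j3 //; lia.
  pose u1 := set_cell s3 r'.*2 (\sum_(0 <= j < i.+1) F j).
  pose u2 := set_cell u1 r'.+3.*2 1.
  pose u3 := set_cell u2 r'.+2.*2 i.+1.
  pose u4 := set_cell u3 r'.+1.*2 (n - i.+1).
  have ne x y : x != y -> (x.*2 == y.*2) = false by move=> xy; apply/eqP; lia.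
  exists (t3 + (1 + (1 + (1 + 1)))), u4; split.
  - apply: exec_seq x3 _; apply: (@exec_seq _ _ _ u1).
      have -> : u1 = set_cell s3 r'.*2 (cell s3 r'.*2 + cell s3 r'.+3.*2).
        by rewrite /u1 E0 v3 big_nat_recr.
      exact: exec_add.
    apply: (@exec_seq _ _ _ u2); first exact: exec_const.
    apply: (@exec_seq _ _ _ u3).
      have -> : u3 = set_cell u2 r'.+2.*2 (cell u2 r'.+2.*2 + cell u2 r'.+3.*2).
        rewrite /u3; congr set_cell; rewrite /u2 /u1 /= eqxx !ne ?E2 ?addn1 //; lia.
      exact: exec_add.
    have -> : u4 = set_cell u3 r'.+1.*2 (cell u3 r'.+1.*2 - cell u3 r'.+3.*2).
      rewrite /u4; congr set_cell; rewrite /u3 /u2 /u1 /= eqxx !ne ?E1; try lia.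
    exact: exec_sub.
  - by move: l3; rewrite bc -/kb; lia.
  - split.
    + by rewrite /= eqxx !ne //; lia.
    + by rewrite /= eqxx.
    + by rewrite /= eqxx !ne //; lia.
    + apply: (agree_trans j4); apply: (@agree_trans _ _ s3); first by apply: agree_le a3; lia.
      do 3?[apply: agree_trans (agree_set _ _ _); last by lia].
      by apply: agree_set; lia.
    + by rewrite /= o3 j5.
exists (t1 + (1 + (1 + t2))), s3; split=> //.
- apply: exec_seq x1 _; apply: (exec_seq (exec_const _ _ _)).
  exact: (exec_seq (exec_const _ _ _)) x3.
set K := cost cb + cost (body 0) + 10.
have C0 : cost cb * B ^ cost cb <= cost cb * B ^ K by apply: cost_mono => //; rewrite /K; lia.
have C1 : B * kb <= cost (body 0) * B ^ K by apply: cost_mono1 => //; rewrite /K; lia.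
(* Besides its body, each round takes four commands and the loop test. *)
have C2 : B * 5 <= 5 * B ^ K.
  rewrite mulnC leq_mul2l -{1}(expn1 B) leq_pexp2l // /K; lia.
have C3 := cost_const K B0.
have C4 : n * (kb + 4).+1 <= B * kb + B * 5.
  by rewrite -mulnDr -addnS; apply: leq_mul.
rewrite /= -/K {1}/K !mulnDl; lia.
Qed.

Definition c_print (c : code) :=
  Code (fun r => CSeq (run c r) (CPrint r.*2)) (cost c + 1).

Lemma emits_print r s c n : computes B r s c n -> emits B r s (c_print c) [:: n].
Proof.
move=> H r' s' le ag; have [t1 [s1 [x1 l1 v1 a1 o1]]] := H _ _ le ag.
exists (t1 + 1), (State (cell s1) (input s1) (rcons (output s1) (cell s1 r'.*2))).
split=> //.
- exact: exec_seq x1 (exec_print _ _).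
- have C1 := cost_mono B0 (leq_addr 1 (cost c)).
  have C3 := cost_const (cost c + 1) B0.
  rewrite /= mulnDl; lia.
- by rewrite /= o1 v1 cats1.
Qed.

Definition c_seq (c1 c2 : code) :=
  Code (fun r => CSeq (run c1 r) (run c2 r)) (cost c1 + cost c2).

Lemma emits_seq r s c1 c2 o1 o2 : emits B r s c1 o1 -> emits B r s c2 o2 ->
  emits B r s (c_seq c1 c2) (o1 ++ o2).
Proof.
move=> H1 H2 r' s' le ag.
have [t1 [s1 [x1 l1 a1 p1]]] := H1 _ _ le ag.
have ag1 : agree r s s1 by apply: agree_trans ag _; apply: agree_le a1.
have [t2 [s2 [x2 l2 a2 p2]]] := H2 _ _ le ag1.
exists (t1 + t2), s2; split=> //.
- exact: exec_seq x1 x2.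
- have C1 := cost_mono B0 (leq_addr (cost c2) (cost c1)).
  have C2 := cost_mono B0 (leq_addl (cost c1) (cost c2)).
  rewrite /= mulnDl; lia.
- exact: agree_trans a2.
- by rewrite p2 p1 catA.
Qed.

Definition c_for (cb : code) (body : nat -> code) := Code (fun r =>
  CSeq (run cb r) (CSeq (CConst r.+1.*2 0)
  (CWhile r.*2 (CSeq (run (body r.+1) r.+2)
    (CSeq (CConst r.+2.*2 1) (CSeq (CAdd r.+1.*2 r.+1.*2 r.+2.*2)
    (CSub r.*2 r.*2 r.+2.*2))))))) (cost cb + cost (body 0) + 10).

Lemma emits_for r s cb body n F :
  n <= B -> (forall x, cost (body x) = cost (body 0)) ->
  computes B r s cb n ->
  (forall x s' i, r <= x -> i < n -> agree r s s' -> cell s' x.*2 = i ->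
     emits B x.+1 s' (body x) (F i)) ->
  emits B r s (c_for cb body) (flatten [seq F i | i <- iota 0 n]).
Proof.
move=> nB bc Hb HF r' s' le ag.
have [t1 [s1 [x1 l1 v1 a1 o1]]] := Hb _ _ le ag.
pose s2 := set_cell s1 r'.+1.*2 0.
pose J i st := [/\ cell st r'.*2 = n - i, cell st r'.+1.*2 = i, agree r' s' st
  & output st = output s' ++ flatten [seq F j | j <- iota 0 i]].
have ne x y : x != y -> (x.*2 == y.*2) = false by move=> xy; apply/eqP; lia.
have J0 : J 0 s2.
  split=> //.
  - by rewrite /= ne ?v1 ?subn0 //; lia.
  - by rewrite /= eqxx.
  - by apply: agree_trans a1 _; apply: agree_set.
  - by rewrite /= o1 cats0.
set kb := cost (body 0) * B ^ cost (body 0).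
have HC i st : i <= n -> J i st -> cell st r'.*2 = n - i by move=> _ [].
have [i st lt [j2 j3 j4 j5]|t2 [s3 [x3 l3 [f2 f3 f4 f5]]]] :=
    @while_loop r'.*2 (CSeq (run (body r'.+1) r'.+2)
    (CSeq (CConst r'.+2.*2 1) (CSeq (CAdd r'.+1.*2 r'.+1.*2 r'.+2.*2)
    (CSub r'.*2 r'.*2 r'.+2.*2)))) J n (kb + 3) _ HC _ J0.
  have agt : agree r s st by apply: agree_trans ag _; apply: agree_le j4.
  have [t3 [s3 [x3 l3 a3 o3]]] :=
    HF _ _ _ (leqW le) lt agt j3 _ _ (leqnn _) (agree_refl _ _).
  case: (a3) => a3r _ _.
  have E1 : cell s3 r'.*2 = n - i by rewrite -a3r ?j2 //; lia.
  have E2 : cell s3 r'.+1.*2 = i by rewrite -a3r ?j3 //; lia.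
  pose u2 := set_cell s3 r'.+2.*2 1.
  pose u3 := set_cell u2 r'.+1.*2 i.+1.
  pose u4 := set_cell u3 r'.*2 (n - i.+1).
  exists (t3 + (1 + (1 + 1))), u4; split.
  - apply: exec_seq x3 _; apply: (@exec_seq _ _ _ u2); first exact: exec_const.
    apply: (@exec_seq _ _ _ u3).
      have -> : u3 = set_cell u2 r'.+1.*2 (cell u2 r'.+1.*2 + cell u2 r'.+2.*2).
        rewrite /u3; congr set_cell; rewrite /u2 /= eqxx !ne ?E2 ?addn1 //; lia.
      exact: exec_add.
    have -> : u4 = set_cell u3 r'.*2 (cell u3 r'.*2 - cell u3 r'.+2.*2).
      rewrite /u4; congr set_cell; rewrite /u3 /u2 /= eqxx !ne ?E1; try lia.
    exact: exec_sub.
  - by move: l3; rewrite bc -/kb; lia.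
  - split.
    + by rewrite /= eqxx.
    + by rewrite /= eqxx !ne //; lia.
    + apply: (agree_trans j4); apply: (@agree_trans _ _ s3); first by apply: agree_le a3; lia.
      do 2?[apply: agree_trans (agree_set _ _ _); last by lia].
      by apply: agree_set; lia.
    + have -> : output u4 = output s3 by [].
      by rewrite o3 j5 -[i.+1]addn1 iotaD map_cat flatten_cat /= cats0 catA.
exists (t1 + (1 + t2)), s3; split=> //.
- by apply: exec_seq x1 _; apply: (exec_seq (exec_const _ _ _)) x3.
set K := cost cb + cost (body 0) + 10.
have C0 : cost cb * B ^ cost cb <= cost cb * B ^ K by apply: cost_mono => //; rewrite /K; lia.
have C1 : B * kb <= cost (body 0) * B ^ K by apply: cost_mono1 => //; rewrite /K; lia.
have C2 : B * 4 <= 4 * B ^ K.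
  rewrite mulnC leq_mul2l -{1}(expn1 B) leq_pexp2l // /K; lia.
have C3 := cost_const K B0.
have C4 : n * (kb + 3).+1 <= B * kb + B * 4.
  by rewrite -mulnDr -addnS; apply: leq_mul.
rewrite /= -/K {1}/K !mulnDl; lia.
Qed.

End Combinators.

(** * Arithmetic and Boolean programs *)

Section Arithmetic.
Variable B : nat.
Hypothesis B0 : 0 < B.

Definition c_mul c1 c2 := c_sum c1 (fun _ => c2).

Lemma computes_mul r s c1 c2 n1 n2 : n1 <= B -> computes B r s c1 n1 ->
  computes B r s c2 n2 -> computes B r s (c_mul c1 c2) (n1 * n2).
Proof.
move=> n1B H1 H2; rewrite -[n1 in n1 * n2]subn0 -sum_nat_const_nat.
apply: (computes_sum B0 n1B) => // x s' i rx _ ag _.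
by apply: (computes_agree _ ag H2); apply: leqW.
Qed.

(** Truth values are 0 and 1, and truncated subtraction from 1 is negation. *)
Definition c_le c1 c2 := c_sub (c_const 1) (c_sub c1 c2).

Lemma computes_le r s c1 c2 n1 n2 : computes B r s c1 n1 -> computes B r s c2 n2 ->
  computes B r s (c_le c1 c2) (n1 <= n2).
Proof.
move=> H1 H2; have -> : (n1 <= n2 : nat) = 1 - (n1 - n2) by case: leqP; lia.
by apply: computes_sub; [|exact: computes_const | exact: computes_sub].
Qed.

Definition c_lt c1 c2 := c_le (c_add c1 (c_const 1)) c2.

Lemma computes_lt r s c1 c2 n1 n2 : computes B r s c1 n1 -> computes B r s c2 n2 ->
  computes B r s (c_lt c1 c2) (n1 < n2).
Proof.
move=> H1 H2; rewrite -addn1; apply: computes_le => //.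
by apply: computes_add => //; apply: computes_const.
Qed.

Definition c_eq c1 c2 := c_sub (c_const 1) (c_add (c_sub c1 c2) (c_sub c2 c1)).

Lemma computes_eq r s c1 c2 n1 n2 : computes B r s c1 n1 -> computes B r s c2 n2 ->
  computes B r s (c_eq c1 c2) (n1 == n2).
Proof.
move=> H1 H2; have -> : (n1 == n2 : nat) = 1 - ((n1 - n2) + (n2 - n1)).
  by case: eqP; lia.
apply: computes_sub => //; first exact: computes_const.
by apply: computes_add => //; apply: computes_sub.
Qed.

Definition c_and c1 c2 := c_if c1 c2 (c_const 0).

Lemma computes_ifb r s c c1 c2 (b b1 b2 : bool) : computes B r s c b ->
  (b -> computes B r s c1 b1) -> (~~ b -> computes B r s c2 b2) ->
  computes B r s (c_if c c1 c2) (if b then b1 else b2).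
Proof.
by move=> H H1 H2; case: b H H1 H2 => H H1 H2; apply: (computes_if B0 H) => //= _;
  by [apply: H1 | apply: H2].
Qed.

Lemma computes_and r s c1 c2 (b1 b2 : bool) : computes B r s c1 b1 ->
  (b1 -> computes B r s c2 b2) -> computes B r s (c_and c1 c2) (b1 && b2).
Proof.
by move=> H1 H2; apply: (computes_ifb (b2 := false)) => // _; apply: computes_const.
Qed.

Definition c_or c1 c2 := c_if c1 (c_const 1) c2.

Lemma computes_or r s c1 c2 (b1 b2 : bool) : computes B r s c1 b1 ->
  computes B r s c2 b2 -> computes B r s (c_or c1 c2) (b1 || b2).
Proof.
by move=> H1 H2; apply: (computes_ifb (b1 := true)) => // _; apply: computes_const.
Qed.

Definition c_zero c := c_sub (c_const 1) c.

Lemma computes_zero r s c n : computes B r s c n -> computes B r s (c_zero c) (n == 0).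
Proof.
move=> H; have -> : (n == 0 : nat) = 1 - n by case: eqP; lia.
by apply: computes_sub => //; apply: computes_const.
Qed.

Lemma sum_ltn_const a b : b <= a -> \sum_(0 <= k < a) (k < b : nat) = b.
Proof.
move=> ba; rewrite (big_cat_nat _ (n := b)) //= [X in _ + X]big1_seq ?addn0.
  rewrite (eq_big_nat _ _ (F2 := fun=> 1)) ?sum_nat_const_nat ?subn0 ?muln1 //.
  by move=> k /andP[_ ->].
by move=> k; rewrite mem_index_iota => /and3P[_ bk _]; rewrite ltnNge bk.
Qed.

(** The quotient is counted: it is the number of k below n1 with (k + 1) n2 <= n1. *)
Definition c_div c1 c2 :=
  c_sum c1 (fun x => c_le (c_mul (c_add (c_var x) (c_const 1)) c2) c1).

Lemma computes_div r s c1 c2 n1 n2 : n1 <= B -> 0 < n2 -> computes B r s c1 n1 ->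
  computes B r s c2 n2 -> computes B r s (c_div c1 c2) (n1 %/ n2).
Proof.
move=> n1B n2_gt0 H1 H2; rewrite -(sum_ltn_const (leq_div n1 n2)).
apply: (computes_sum B0 n1B) => // x s' i rx lt ag xi.
rewrite leq_divRL // -[i.+1]addn1.
have {}H1 := computes_agree (leqW rx) ag H1; have {}H2 := computes_agree (leqW rx) ag H2.
apply: computes_le => //; apply: computes_mul => //; first by lia.
by apply: computes_add => //; [rewrite -xi; apply: computes_var | apply: computes_const].
Qed.

Definition c_mod c1 c2 := c_sub c1 (c_mul (c_div c1 c2) c2).

Lemma computes_mod r s c1 c2 n1 n2 : n1 <= B -> 0 < n2 -> computes B r s c1 n1 ->
  computes B r s c2 n2 -> computes B r s (c_mod c1 c2) (n1 %% n2).
Proof.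
move=> n1B n2_gt0 H1 H2.
have -> : n1 %% n2 = n1 - n1 %/ n2 * n2 by rewrite {2}(divn_eq n1 n2) addKn.
apply: computes_sub => //; apply: computes_mul => //.
  exact: leq_trans (leq_div _ _) n1B.
exact: computes_div.
Qed.

End Arithmetic.

(** * Reading the input *)

Definition mem_is (w : seq nat) (s : state) := forall a, cell s a.*2.+1 = nth 0 w a.

Lemma mem_is_agree w r s s' : agree r s s' -> mem_is w s -> mem_is w s'.
Proof. by move=> [_ ag _] H a; rewrite -ag. Qed.

(** Cell 0 holds the next odd address to be filled, and cells 2 and 4 are scratch. In [read_graph],
    cells 6 and 8 are the two loop counters and cell 10 keeps the number of vertices. *)
Definition read_one : cmd :=
  CSeq (CRead 2) (CSeq (CStore 0 2) (CSeq (CConst 4 2) (CAdd 0 0 4))).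

Definition read_graph : cmd :=
  CSeq read_one (CSeq (CConst 10 0) (CSeq (CAdd 10 10 2) (CSeq (CConst 6 0)
  (CSeq (CAdd 6 6 2) (CWhile 6 (CSeq (CConst 8 0) (CSeq (CAdd 8 8 10)
  (CSeq (CWhile 8 (CSeq read_one (CSeq (CConst 4 1) (CSub 8 8 4))))
  (CSeq (CConst 4 1) (CSub 6 6 4)))))))))).

Definition reading (w : seq nat) (m : nat) (s : state) : Prop :=
  [/\ input s = drop m w, cell s 0 = m.*2.+1,
      forall a, cell s a.*2.+1 = if a < m then nth 0 w a else 0 & output s = [::]].

Lemma reading_set w m s x v : 0 < x -> reading w m s -> reading w m (set_cell s x.*2 v).
Proof.
move=> x0 [h1 h2 h3 h4]; split=> //= [|a]; first by case: eqP; lia.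
by case: eqP; first by lia.
Qed.

Lemma exec_read_one w m s : reading w m s ->
  exists s', [/\ exec read_one s 4 s', reading w m.+1 s', cell s' 2 = nth 0 w m
    & forall y, 2 < y -> cell s' y.*2 = cell s y.*2].
Proof.
case=> h1 h2 h3 h4; set v := nth 0 w m.
pose s1 := set_cell (State (cell s) (behead (input s)) (output s)) 2 (head 0 (input s)).
pose s2 := set_cell s1 (cell s1 0) (cell s1 2).
pose s3 := set_cell s2 4 2.
pose s4 := set_cell s3 0 (cell s3 0 + cell s3 4).
have vE : head 0 (input s) = v by rewrite h1 -nth0 nth_drop addn0.
exists s4; split.
- rewrite -[4]/(1 + (1 + (1 + 1))).
  apply: (exec_seq (exec_read _ _)); apply: (exec_seq (exec_store _ _ _)).
  by apply: (exec_seq (exec_const _ _ _)); apply: exec_add.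
- split.
  + by rewrite /= h1 -drop1 drop_drop add1n.
  + rewrite /= h2; case: eqP; first by lia.
    by move=> _; lia.
  + move=> a /=; rewrite h2 vE.
    have [->|am] := eqVneq a m.
      by rewrite ltnSn eqxx; repeat (case: eqP => [|_]; first by lia).
    have -> : (a < m.+1) = (a < m) by rewrite ltnS leq_eqVlt (negPf am).
    by rewrite -h3; repeat (case: eqP => [|_]; first by lia).
  + by [].
- rewrite /= h2 vE; by repeat (case: eqP => [|_]; first by lia).
- by move=> y y2 /=; rewrite h2; repeat (case: eqP => [|_]; first by lia).
Qed.

Lemma exec_read_graph w m s : reading w m s -> let n := nth 0 w m in
  exists t s', [/\ exec read_graph s t s', t <= 13 * n * n + 9
    & reading w (m + 1 + n * n) s'].
Proof.
move=> R0 n; have [s1 [x1 R1 v1 _]] := exec_read_one R0; rewrite -/n in v1.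
pose s2 := set_cell (set_cell s1 10 0) 10 n.
pose s3 := set_cell (set_cell s2 6 0) 6 n.
pose Jo i st := [/\ reading w (m + 1 + i * n) st, cell st 6 = n - i & cell st 10 = n].
have J0 : Jo 0 s3.
  split=> //; last by rewrite /= subn0.
  rewrite mul0n addn0 addn1.
  do 2!(apply: (reading_set (x := 3)); first by []).
  by do 2!(apply: (reading_set (x := 5)); first by []).
have dec st x : exec (CSeq (CConst 4 1) (CSub x.*2 x.*2 4)) st 2
    (set_cell (set_cell st 4 1) x.*2 (cell (set_cell st 4 1) x.*2 - 1)).
  by rewrite -[2]/(1 + 1); apply: (exec_seq (exec_const _ _ _)); apply: exec_sub.
have Ho i st : i < n -> Jo i st -> exists t s', [/\ exec (CSeq (CConst 8 0)
    (CSeq (CAdd 8 8 10) (CSeq (CWhile 8 (CSeq read_one (CSeq (CConst 4 1) (CSub 8 8 4))))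
    (CSeq (CConst 4 1) (CSub 6 6 4))))) st t s', t <= n * 7 + 5 & Jo i.+1 s'].
  move=> lt [R c6 c10].
  pose u1 := set_cell (set_cell st 8 0) 8 n.
  pose Ji k u := [/\ reading w (m + 1 + i * n + k) u, cell u 8 = n - k,
    cell u 6 = n - i & cell u 10 = n].
  have Ji0 : Ji 0 u1.
    split=> //; last by rewrite /= subn0.
    by rewrite addn0; do 2!(apply: (reading_set (x := 4)); first by []).
  have Hi k u : k < n -> Ji k u -> exists t s', [/\ exec
      (CSeq read_one (CSeq (CConst 4 1) (CSub 8 8 4))) u t s', t <= 6 & Ji k.+1 s'].
    move=> kn [Ru k8 k6 k10]; have [u' [xu Ru' _ ku]] := exec_read_one Ru.
    exists (4 + 2), (set_cell (set_cell u' 4 1) 4.*2 (cell (set_cell u' 4 1) 4.*2 - 1)).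
    split=> //; first exact: exec_seq xu (dec _ 4).
    split.
    - rewrite addnS; apply: (reading_set (x := 4)) => //.
      exact: (reading_set (x := 2)).
    - by rewrite /= (ku 4) // k8; lia.
    - by rewrite /= (ku 3).
    - by rewrite /= (ku 5).
  have HC k u : k <= n -> Ji k u -> cell u 8 = n - k by move=> _ [].
  have [t2 [u2 [xu2 l2 [R2 _ k6 k10]]]] := while_loop Hi HC Ji0.
  exists (1 + (1 + (t2 + 2))),
    (set_cell (set_cell u2 4 1) 3.*2 (cell (set_cell u2 4 1) 3.*2 - 1)); split.
  - apply: (exec_seq (exec_const _ _ _)).
    apply: (@exec_seq _ _ _ u1).
      have -> : u1 = set_cell (set_cell st 8 0) 8
          (cell (set_cell st 8 0) 8 + cell (set_cell st 8 0) 10) by rewrite /= c10.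
      exact: exec_add.
    exact: exec_seq xu2 (dec _ 3).
  - by lia.
  - split.
    + rewrite mulSn [n + _]addnC addnA; apply: (reading_set (x := 3)) => //.
      exact: (reading_set (x := 2)).
    + by rewrite /= k6; lia.
    + by rewrite /= k10.
have HC k u : k <= n -> Jo k u -> cell u 6 = n - k by move=> _ [].
have [t2 [s4 [x2 l2 [R2 _ _]]]] := while_loop Ho HC J0.
(* The exact count gives 7 n^2 + 6 n + 9 steps, whence the constant 13. *)
have nn : n <= n * n by case: (n) => // n'; rewrite leq_pmulr.
exists (4 + (1 + (1 + (1 + (1 + t2))))), s4; split=> //; last first.
  by move: l2; rewrite -mulnA; nia.
apply: (exec_seq x1); apply: (exec_seq (exec_const _ _ _)).
apply: (@exec_seq _ _ _ s2).
  have -> : s2 = set_cell (set_cell s1 10 0) 10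
      (cell (set_cell s1 10 0) 10 + cell (set_cell s1 10 0) 2) by rewrite /= v1.
  exact: exec_add.
apply: (exec_seq (exec_const _ _ _)); apply: (@exec_seq _ _ _ s3) x2.
have -> : s3 = set_cell (set_cell s2 6 0) 6
    (cell (set_cell s2 6 0) 6 + cell (set_cell s2 6 0) 2) by rewrite /= v1.
exact: exec_add.
Qed.

Definition read_input : cmd := CSeq (CConst 0 1) (CSeq read_graph read_graph).

Lemma nth_allpairs (T U : Type) (x0 : T) (y0 : U) (f : T -> U -> nat) s t i j :
  i < size s -> j < size t ->
  nth 0 [seq f x y | x <- s, y <- t] (i * size t + j) = f (nth x0 s i) (nth y0 t j).
Proof.
move=> + jt; elim: s i => // x s IH [|i] /= lt; rewrite nth_cat size_map.
  by rewrite mul0n add0n jt (nth_map y0).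
rewrite mulSn -addnA ltnNge leq_addr /= addKn; exact: IH.
Qed.

Lemma size_encode G : size (encode G) = (nvert G * nvert G).+1.
Proof. by rewrite /= size_allpairs size_enum_ord. Qed.

Lemma nth_encode G (u v : 'I_(nvert G)) :
  nth 0 (encode G) (u * nvert G + v).+1 = edge u v.
Proof.
have := @nth_allpairs _ _ u v (fun u v => edge u v) (enum 'I_(nvert G))
  (enum 'I_(nvert G)) u v.
by rewrite !size_enum_ord !nth_ord_enum; apply.
Qed.

Section InputWord.
Variables G1 G2 : ssdag.
Let w := encode G1 ++ encode G2.
Let n1 := nvert G1.
Let n2 := nvert G2.

Lemma size_word : size w = n1 * n1 + n2 * n2 + 2.
Proof. by rewrite size_cat !size_encode /n1 /n2; lia. Qed.

Lemma word_n1 : nth 0 w 0 = n1. Proof. by []. Qed.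

Lemma word_n2 : nth 0 w (n1 * n1 + 1) = n2.
Proof. by rewrite nth_cat size_encode addn1 ltnn subnn. Qed.

Lemma word_e1 (u v : 'I_n1) : nth 0 w (1 + (u * n1 + v)) = edge u v.
Proof.
rewrite nth_cat size_encode add1n ltnS.
have -> : u * n1 + v < n1 * n1.
  apply: (@leq_trans (u.+1 * n1)); first by rewrite mulSn; have := ltn_ord v; lia.
  by rewrite leq_mul2r ltn_ord orbT.
exact: nth_encode.
Qed.

Lemma word_e2 (u v : 'I_n2) : nth 0 w (n1 * n1 + 2 + (u * n2 + v)) = edge u v.
Proof.
rewrite nth_cat size_encode; case: ltnP; first by rewrite -/n1; lia.
move=> _; rewrite -nth_encode; congr nth; rewrite -/n1 -/n2; lia.
Qed.

Lemma exec_read_input : exists t s, [/\ exec read_input (init w) t s,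
  t <= 13 * size w, mem_is w s & output s = [::]].
Proof.
have R0 : reading w 0 (set_cell (init w) 0 1).
  by split=> //=; rewrite drop0.
have [t1 [s1 [x1 l1 R1]]] := exec_read_graph R0.
rewrite word_n1 add0n in l1 R1.
have [t2 [s2 [x2 l2 R2]]] := exec_read_graph R1.
rewrite [1 + _]addnC word_n2 in l2 R2.
exists (1 + (t1 + t2)), s2; split.
- by apply: (exec_seq (exec_const _ _ _)); apply: exec_seq x1 x2.
- rewrite size_word; move: l1 l2; rewrite -!mulnA; lia.
- case: R2 => _ _ R2 _ a; rewrite R2; case: ltnP => // le.
  by rewrite nth_default // size_word; lia.
- by case: R2.
Qed.

End InputWord.

(** * From edge programs to polynomial time *)

Section Program.
Variables (f : ssdag -> ssdag -> ssdag) (cN : code) (cE : nat -> nat -> code).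
Hypothesis cE_cost : forall x y, cost (cE x y) = cost (cE 0 0).
(** The factor 8 in [B] is chosen with room to spare: the vertex numbers of both products stay below
    [B], and so do the loop lengths. *)
Hypothesis f_ok : forall G1 G2, let w := encode G1 ++ encode G2 in
  let B := 8 * size w in let N := nvert (f G1 G2) in
  N <= B /\ forall r s, mem_is w s -> computes B r s cN N /\
    forall x y (i j : 'I_N), x < r -> y < r -> cell s x.*2 = i -> cell s y.*2 = j ->
      computes B r s (cE x y) (edge i j).

Let body := c_seq (c_print cN)
  (c_for cN (fun x => c_for cN (fun y => c_print (cE x y)))).

(** The program loops over plain numbers, so the adjacency matrix is extended by 0 outside its
    range. *)
Lemma encode_flatten G : exists E : nat -> nat -> nat,
  (forall i j : 'I_(nvert G), E i j = edge i j) /\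
  encode G = nvert G :: flatten [seq flatten [seq [:: E i j] | j <- iota 0 (nvert G)]
    | i <- iota 0 (nvert G)].
Proof.
pose E i j : nat := if (insub i : option 'I_(nvert G)) is Some i' then
  if insub j is Some j' then edge i' j' else false else false.
have EE (i j : 'I_(nvert G)) : E i j = edge i j by rewrite /E !valK.
exists E; split=> //; rewrite /encode; congr (_ :: _).
rewrite -val_enum_ord -map_comp; congr flatten; apply: eq_map => i /=.
by rewrite flatten_map1 -map_comp; apply: eq_map => j /=; rewrite EE.
Qed.

Lemma poly_time_code : poly_time_constructible f.
Proof.
(* Reading costs 13 times the size of the input and the main part k (8 size)^k. The sum serves as
   coefficient and as exponent, for which the last summand makes it at least k. *)
pose k := cost body; exists (CSeq read_input (run body 0)), (13 + k * 8 ^ k + k).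
move=> G1 G2 w; have [NB H] := f_ok G1 G2; rewrite -/w in NB H.
set B := 8 * size w in NB H; set N := nvert (f G1 G2) in NB H.
have sw : 0 < size w by rewrite size_word; lia.
have B0 : 0 < B by rewrite /B; lia.
have [t1 [s1 [x1 l1 m1 o1]]] := exec_read_input G1 G2; rewrite -/w in x1 l1 m1.
have [E [EE encE]] := encode_flatten (f G1 G2).
have [t2 [s2 [x2 l2 a2 o2]]] : exists t s2, [/\ exec (run body 0) s1 t s2,
    t <= k * B ^ k, agree 0 s1 s2 & output s2 = output s1 ++ encode (f G1 G2)].
  have main : emits B 0 s1 body (encode (f G1 G2)).
    rewrite encE -cat1s; apply: (emits_seq B0).
      by apply: (emits_print B0); case: (H 0 s1 m1).
    apply: (emits_for B0 NB) => [x||x s' i _ iN ag xi]; first by rewrite /= cE_cost.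
      by case: (H 0 s1 m1).
    have m' := mem_is_agree ag m1.
    apply: (emits_for B0 NB) => [y||y s'' j xy jN ag' yj].
      by rewrite /= (cE_cost x y) (cE_cost x 0).
      by case: (H x.+1 s' m').
    apply: (emits_print B0); have [_ He] := H y.+1 s'' (mem_is_agree ag' m').
    have xi' : cell s'' x.*2 = Ordinal iN by case: ag' => <-.
    have := He x y (Ordinal iN) (Ordinal jN) (leqW xy) (leqnn _) xi' yj.
    by rewrite -EE.
  exact: main (leqnn 0) (agree_refl 0 s1).
exists (t1 + t2), s2; split; first exact: exec_seq x1 x2.
  by rewrite o2 o1.
set d := _ + k; have P1 : size w <= size w ^ d.
  by rewrite -{1}(expn1 (size w)) leq_pexp2l // /d; lia.
have P2 : size w ^ k <= size w ^ d by rewrite leq_pexp2l // /d; lia.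
apply: (@leq_trans ((13 + k * 8 ^ k) * size w ^ d)); last by rewrite leq_mul2r leq_addr orbT.
rewrite mulnDl; apply: leq_add; apply: (leq_trans l1) || apply: (leq_trans l2).
  by rewrite leq_mul2l P1.
by rewrite /B expnMn mulnA leq_mul2l P2 orbT.
Qed.

End Program.

(** * Programs for the products *)

(* A graph in memory: its number of vertices, and the address at which its
   adjacency matrix begins. *)
Record gcode := GCode { gn : code; gbase : code }.

Definition ge g cu cv := c_load (c_add (gbase g) (c_add (c_mul cu (gn g)) cv)).

(** Every vertex with a successor contributes 0, so the sum is the number of the sink itself. *)
Definition c_sink g := c_sum (gn g) (fun x =>
  c_if (c_sum (gn g) (fun y => ge g (c_var x) (c_var y))) (c_const 0) (c_var x)).

Definition c_first g cu cv :=
  c_and (ge g cu cv) (c_zero (c_sum cu (fun x => ge g (c_var x) cv))).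

Definition c_deg2 g := c_sum (gn g) (fun v =>
  c_le (c_const 2) (c_sum (gn g) (fun u => ge g (c_var u) (c_var v)))).

Definition graph_at (B : nat) (w : seq nat) (g : gcode) (G : ssdag) : Prop :=
  nvert G <= B /\ exists b, (forall r s, mem_is w s ->
    computes B r s (gn g) (nvert G) /\ computes B r s (gbase g) b) /\
    forall u v : 'I_(nvert G), nth 0 w (b + (u * nvert G + v)) = edge u v.

Section GraphCodes.
Variables (B : nat) (w : seq nat) (g : gcode) (G : ssdag).
Hypotheses (B0 : 0 < B) (gG : graph_at B w g G).
Let n := nvert G.

Lemma computes_gn r s : mem_is w s -> computes B r s (gn g) n.
Proof. by move=> ms; case: gG => _ [b [H _]]; case: (H r s ms). Qed.

Lemma computes_ge r s cu cv (u v : 'I_n) : mem_is w s ->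
  computes B r s cu u -> computes B r s cv v ->
  computes B r s (ge g cu cv) (edge u v).
Proof.
move=> ms Hu Hv; case: gG => nB [b [H Hb]]; have [Hn Hc] := H r s ms.
rewrite -Hb -ms; apply: (computes_load B0); apply: (computes_add B0) => //.
apply: (computes_add B0) => //; apply: (computes_mul B0) => //.
by have := ltn_ord u; move: nB; rewrite /n; lia.
Qed.

Lemma computes_sink r s : mem_is w s -> computes B r s (c_sink g) (sink G).
Proof.
move=> ms; have nB : n <= B by case: gG.
pose F i : nat := if (insub i : option 'I_n) is Some i' then
  (if [exists j, edge i' j] then 0 else i) else 0.
have -> : (sink G : nat) = \sum_(0 <= i < n) F i.
  rewrite big_mkord (bigD1 (sink G)) //= big1 ?addn0 => [|i ne]; rewrite /F valK.
    by case: existsP => // -[j]; rewrite (negPf (iffRL (sinkP _) erefl _)).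
  case: existsP => // N; case/eqP: ne; apply/sinkP => j; apply/negP => ij.
  by apply: N; exists j.
apply: (computes_sum B0 nB) => //; first exact: computes_gn.
move=> x s1 i rx iN ag xi; have ms1 := mem_is_agree ag ms.
have Hi : computes B x.+1 s1 (c_var x) (Ordinal iN) by rewrite -[X in computes _ _ _ _ X]xi;
  apply: computes_var.
have Hs : computes B x.+1 s1 (c_sum (gn g) (fun y => ge g (c_var x) (c_var y)))
    (\sum_(0 <= j < n) (if (insub j : option 'I_n) is Some j' then edge (Ordinal iN) j' else false)).
  apply: (computes_sum B0 nB) => //; first exact: computes_gn.
  move=> y s2 j xy jN ag' yj; have ms2 := mem_is_agree ag' ms1.
  rewrite (insubT (fun k => k < n) jN) /=; apply: computes_ge => //.
    by apply: (computes_agree _ ag' Hi); apply: leqW.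
  by rewrite -[X in computes _ _ _ _ X]yj; apply: computes_var.
have E0 : (0 < \sum_(0 <= j < n) (if (insub j : option 'I_n) is Some j' then edge (Ordinal iN) j' else false))
    = [exists j, edge (Ordinal iN) j].
  rewrite big_mkord lt0n sum_nat_eq0; apply/forallPn/existsP => -[j]; rewrite ?valK => H.
    by exists j; move: H; rewrite implyTb; case: edge.
  by exists j; rewrite valK H.
rewrite /F (insubT (fun k => k < n) iN); apply: (computes_if B0 Hs).
  by rewrite E0 => ->; apply: computes_const.
by move=> S0; move: E0; rewrite S0 ltnn => <-.
Qed.

Lemma computes_first r s cu cv (u v : 'I_n) : mem_is w s ->
  computes B r s cu u -> computes B r s cv v ->
  computes B r s (c_first g cu cv) (first_pred (@edge G) u v).
Proof.
move=> ms Hu Hv; have nB : n <= B by case: gG.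
apply: (computes_and B0); first exact: computes_ge.
move=> _; pose F i : nat := if (insub i : option 'I_n) is Some i' then edge i' v else false.
have -> : [forall u' : 'I_(nvert G), (u' < u) ==> ~~ edge u' v] = (\sum_(0 <= i < u) F i == 0).
  rewrite sum_nat_seq_eq0; apply/forallP/allP => H i.
    rewrite mem_index_iota /F => /andP[_ iu]; have iN := ltn_trans iu (ltn_ord u).
    rewrite (insubT (fun k => k < n) iN); have := H (Ordinal iN); rewrite iu /=.
    by move/negPf->.
  apply/implyP=> iu; have := H i; rewrite mem_index_iota iu /F valK => /(_ isT).
  by rewrite implyTb; case: edge.
apply: (computes_zero B0); apply: (computes_sum B0) => //.
  by have := ltn_ord u; lia.
move=> x s1 i rx iu ag xi; have ms1 := mem_is_agree ag ms.
have iN := ltn_trans iu (ltn_ord u).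
rewrite /F (insubT (fun k => k < n) iN) /=; apply: computes_ge => //.
  by rewrite -[X in computes _ _ _ _ X]xi; apply: computes_var.
by apply: (computes_agree _ ag Hv); apply: leqW.
Qed.

Lemma computes_deg2 r s : mem_is w s ->
  exists2 m, computes B r s (c_deg2 g) m & (0 < m) = deg2 G.
Proof.
move=> ms; have nB : n <= B by case: gG.
pose F i : nat := if (insub i : option 'I_n) is Some i' then 1 < #|preds (@edge G) i'| else false.
exists (\sum_(0 <= i < n) F i); last first.
  rewrite big_mkord lt0n sum_nat_eq0 /deg2; apply/forallPn/existsP => -[v];
    rewrite /F ?valK => H; exists v; rewrite ?valK.
    by move: H; rewrite implyTb; case: (1 < _).
  by rewrite H.
apply: (computes_sum B0 nB) => //; first exact: computes_gn.
move=> x s1 i rx iN ag xi; have ms1 := mem_is_agree ag ms.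
rewrite /F (insubT (fun k => k < n) iN).
apply: (computes_le B0); first exact: computes_const.
have -> : #|preds (@edge G) (Sub i iN)| =
    \sum_(0 <= u < n) (if (insub u : option 'I_n) is Some u' then edge u' (Ordinal iN) else false).
  rewrite big_mkord -sum1dep_card big_mkcond /=; apply: eq_bigr => u _.
  by rewrite valK; case: edge.
apply: (computes_sum B0 nB) => //; first exact: computes_gn.
move=> y s2 j xy jN ag' yj; have ms2 := mem_is_agree ag' ms1.
rewrite (insubT (fun k => k < n) jN) /=; apply: computes_ge => //.
  by rewrite -[X in computes _ _ _ _ X]yj; apply: computes_var.
case: ag' => ag' _ _; have <- : cell s2 x.*2 = Ordinal iN by rewrite -ag'.
by apply: (computes_var B0); apply: leqW.
Qed.

End GraphCodes.

Definition g1 := GCode (c_load (c_const 0)) (c_const 1).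
(** The word of G1 occupies n1^2 + 1 entries; the vertex number of G2 comes next, followed by its
    matrix. *)
Definition g2 := GCode (c_load (c_add (c_mul (gn g1) (gn g1)) (c_const 1)))
  (c_add (c_mul (gn g1) (gn g1)) (c_const 2)).

Section Inputs.
Variables G1 G2 : ssdag.
Let w := encode G1 ++ encode G2.
Let B := 8 * size w.

Lemma bound_gt0 : 0 < B. Proof. by rewrite /B size_word; lia. Qed.

Lemma graph_at1 : graph_at B w g1 G1.
Proof.
split; first by rewrite /B size_word; nia.
exists 1; split=> [r s ms|u v]; last exact: word_e1.
split; last exact: computes_const.
rewrite -(word_n1 G1 G2) -/w -(ms 0); apply: (computes_load bound_gt0).
exact: computes_const.
Qed.

Lemma computes_n1sq r s : mem_is w s ->
  computes B r s (c_mul (gn g1) (gn g1)) (nvert G1 * nvert G1).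
Proof.
move=> ms; have [nB _] := graph_at1; have H := computes_gn graph_at1 (r := r) ms.
exact: (computes_mul bound_gt0).
Qed.

Lemma graph_at2 : graph_at B w g2 G2.
Proof.
split; first by rewrite /B size_word; nia.
exists (nvert G1 * nvert G1 + 2); split=> [r s ms|u v]; last exact: word_e2.
have H := computes_n1sq (r := r) ms; split.
  rewrite -(word_n2 G1 G2) -/w -ms; apply: (computes_load bound_gt0).
  by apply: (computes_add bound_gt0) => //; apply: computes_const.
by apply: (computes_add bound_gt0) => //; apply: computes_const.
Qed.

End Inputs.

(** Local numbers below [nb] are toll vertices, and the following three are [p], [q] and [c], in
    accordance with [split]. *)
Definition c_std (ga gb : gcode) (ci cj : code) : code :=
  let nb := gn gb in
  let nb3 := c_add nb (c_const 3) in
  let nb1 := c_add nb (c_const 1) in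
  let nb2 := c_add nb (c_const 2) in
  let u := c_div ci nb3 in let a := c_mod ci nb3 in
  let v := c_div cj nb3 in let b := c_mod cj nb3 in
  c_if (c_eq b nb)
    (c_or (c_and (c_eq u v) (c_eq a (c_sink gb))) (c_and (c_eq a nb2) (c_first ga u v)))
  (c_if (c_eq b nb1) (c_and (c_eq a nb2) (ge ga u v))
  (c_if (c_eq b nb2) (c_and (c_eq u v) (c_or (c_eq a nb) (c_eq a nb1)))
    (c_and (c_eq u v) (c_and (c_lt a nb) (ge gb a b))))).

Section StdCode.
Variables (B : nat) (w : seq nat) (ga gb : gcode) (Ga Gb : ssdag).
Hypotheses (B0 : 0 < B) (gA : graph_at B w ga Ga) (gB : graph_at B w gb Gb).
Hypothesis NB : nvert (std_prod Ga Gb) <= B.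
Let na := nvert Ga.
Let nb := nvert Gb.

Lemma split_eq_inl (a : 'I_(nb + 3)) (t : 'I_nb) : (split a == inl t) = (a == t :> nat).
Proof. by rewrite (can2_eq (@splitK nb 3) (@unsplitK nb 3)). Qed.

Lemma split_eq_inr (a : 'I_(nb + 3)) k : k < 3 -> (split a == inr (inord k)) = (a == nb + k :> nat).
Proof. by move=> k3; rewrite (can2_eq (@splitK nb 3) (@unsplitK nb 3)) -val_eqE /= inordK. Qed.

Lemma computes_std r s ci cj (i j : 'I_(nvert (std_prod Ga Gb))) : mem_is w s ->
  computes B r s ci i -> computes B r s cj j ->
  computes B r s (c_std ga gb ci cj) (edge i j).
Proof.
move=> ms Hi Hj; have Hn := computes_gn gB (r := r) ms.
have Hn1 k : computes B r s (c_add (gn gb) (c_const k)) (nb + k).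
  by apply: (computes_add B0) => //; apply: computes_const.
pose u := (divmod (i : 'I_(na * (nb + 3)))).1; pose a := (divmod (i : 'I_(na * (nb + 3)))).2.
pose v := (divmod (j : 'I_(na * (nb + 3)))).1; pose b := (divmod (j : 'I_(na * (nb + 3)))).2.
have iB : i <= B by apply: ltnW; apply: leq_trans (ltn_ord i) NB.
have jB : j <= B by apply: ltnW; apply: leq_trans (ltn_ord j) NB.
have n3 : 0 < nb + 3 by lia.
have Hu : computes B r s (c_div ci (c_add (gn gb) (c_const 3))) u by apply: computes_div.
have Ha : computes B r s (c_mod ci (c_add (gn gb) (c_const 3))) a by apply: computes_mod.
have Hv : computes B r s (c_div cj (c_add (gn gb) (c_const 3))) v by apply: computes_div.
have Hb : computes B r s (c_mod cj (c_add (gn gb) (c_const 3))) b by apply: computes_mod.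
(* Holds by conversion, since the numbering is given by quotient and remainder. *)
have -> : edge i j = gate_edge (@edge Ga) (first_pred (@edge Ga)) (@std_el Gb)
   (std_z Gb) (std_p Gb) (std_q Gb) (std_c Gb) (u, split a) (v, split b) by [].
clearbody u v a b; clear Hi Hj iB jB i j.
rewrite /gate_edge [(u, _).1]/= [(v, _).1]/= [(u, _).2]/= [(v, _).2]/=.
rewrite /std_p /std_q /std_c /std_z !split_eq_inr // !split_eq_inl -val_eqE /=.
rewrite addn0.
have Huv := computes_eq B0 Hu Hv.
apply: (computes_ifb B0); [exact: (computes_eq B0) | move=> _ | move=> b0].
  apply: (computes_or B0).
    apply: (computes_and B0) => // _; apply: (computes_eq B0) => //.
    exact: (computes_sink B0 gB).
  apply: (computes_and B0) => [|_]; first exact: (computes_eq B0).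
  exact: (computes_first B0 gA).
apply: (computes_ifb B0); [exact: (computes_eq B0) | move=> _ | move=> b1].
  apply: (computes_and B0) => [|_]; first exact: (computes_eq B0).
  exact: (computes_ge B0 gA).
apply: (computes_ifb B0); [exact: (computes_eq B0) | move=> _ | move=> b2].
  apply: (computes_and B0) => // _; apply: (computes_or B0); exact: (computes_eq B0).
apply: (computes_and B0) => // _.
have bn : b < nb.
  by move: b0 b1 b2; have := ltn_ord b; clear; lia.
(* The failed tests leave [b] in the toll, but [a] may still be a gate vertex, which must be
   excluded before the matrix of the toll graph is read. *)
have -> : std_el (split a) (split b) =
    (a < nb) && (if (insub (a : nat) : option 'I_nb) is Some a' then edge a' (Ordinal bn) else false).
  case: (splitP b) => [b' bb|b' bb]; last by move: bn; rewrite bb; clear; lia.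
  case: (splitP a) => [a' aa|a' aa] /=.
    rewrite aa (_ : insub _ = Some a') ?valK //=; congr edge; exact: val_inj.
  by [].
apply: (computes_and B0) => [|an]; first exact: (computes_lt B0).
by rewrite (insubT (fun k => k < nb) an); apply: (computes_ge B0 gB).
Qed.

End StdCode.

Definition c_chain (g : gcode) (cu ca cv cb : code) : code :=
  c_or (c_and (c_eq cu cv) (c_eq cb (c_add ca (c_const 1))))
    (c_and (c_and (c_eq ca (c_const 3)) (c_eq cb (c_const 0))) (ge g cu cv)).

(** Walking along a chain is counting in binary: the outer subdivision flips the low bit, and the
    inner one carries into the high bit. *)
Lemma sub2E (n : nat) (e : rel 'I_n) (u v : 'I_n) (a b : 'I_4) :
  sub (sub e) (u, (bits4 a).1, (bits4 a).2) (v, (bits4 b).1, (bits4 b).2) =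
  (u == v) && (b == a + 1 :> nat) || ((a == 3 :> nat) && (b == 0 :> nat)) && e u v.
Proof.
rewrite /sub /bits4 /= !xpair_eqE.
case: a b => [[|[|[|[|a]]]] //= _] [[|[|[|[|b]]]] //= _];
  by rewrite ?andbF ?andbT ?orbF.
Qed.

Section ChainCode.
Variables (B : nat) (w : seq nat) (g : gcode) (G : ssdag).
Hypotheses (B0 : 0 < B) (gG : graph_at B w g G).
Let n := nvert G.

Lemma computes_chain r s cu ca cv cb (u v : 'I_n) (a b : 'I_4) : mem_is w s ->
  computes B r s cu u -> computes B r s ca a -> computes B r s cv v -> computes B r s cb b ->
  computes B r s (c_chain g cu ca cv cb) (sub (sub (@edge G))
    (u, (bits4 a).1, (bits4 a).2) (v, (bits4 b).1, (bits4 b).2)).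
Proof.
move=> ms Hu Ha Hv Hb; rewrite sub2E; apply: (computes_or B0).
  apply: (computes_and B0) => [|_]; first by rewrite -val_eqE; apply: (computes_eq B0).
  by apply: (computes_eq B0) => //; apply: (computes_add B0) => //; apply: computes_const.
apply: (computes_and B0) => [|_]; last exact: (computes_ge B0 gG).
apply: (computes_and B0) => [|_]; apply: (computes_eq B0) => //; exact: computes_const.
Qed.

Lemma computes_sub2 r s ci cj (i j : 'I_(nvert (sub2 G))) : mem_is w s -> n * 4 <= B ->
  computes B r s ci i -> computes B r s cj j ->
  computes B r s (c_chain g (c_div ci (c_const 4)) (c_mod ci (c_const 4))
    (c_div cj (c_const 4)) (c_mod cj (c_const 4))) (edge i j).
Proof.
move=> ms NB Hi Hj.
have iB : i <= B by apply: ltnW; apply: leq_trans (ltn_ord i) NB.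
have jB : j <= B by apply: ltnW; apply: leq_trans (ltn_ord j) NB.
have C4 : computes B r s (c_const 4) 4 by apply: computes_const.
apply: (@computes_chain r s _ _ _ _ (divmod (i : 'I_(n * 4))).1 (divmod (j : 'I_(n * 4))).1
  (divmod (i : 'I_(n * 4))).2 (divmod (j : 'I_(n * 4))).2) => //;
  by [apply: computes_div | apply: computes_mod].
Qed.

End ChainCode.

(** [at_ x y k] recognises the vertex at position [k] of the chain of the sink; positions 0 to 3 are
    [z], [p], [q] and [c]. *)
Definition c_rev (ga gb : gcode) (ci cj : code) : code :=
  let m := c_mul (gn gb) (c_const 4) in
  let four := c_const 4 in
  let u := c_div ci m in let l := c_mod ci m in
  let g := c_div l four in let a := c_mod l four in
  let v := c_div cj m in let l' := c_mod cj m in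
  let h := c_div l' four in let b := c_mod l' four in
  let t := c_sink gb in
  let at_ x y k := c_and (c_eq x t) (c_eq y (c_const k)) in
  c_if (at_ h b 1)
    (c_or (c_and (c_eq u v) (at_ g a 0)) (c_and (at_ g a 3) (c_first ga u v)))
  (c_if (at_ h b 2) (c_and (at_ g a 3) (ge ga u v))
  (c_if (at_ h b 3) (c_and (c_eq u v) (c_or (at_ g a 1) (at_ g a 2)))
    (c_and (c_eq u v) (c_chain gb g a h b)))).

Section RevCode.
Variables (B : nat) (w : seq nat) (ga gb : gcode) (Ga Gb : ssdag).
Hypotheses (B0 : 0 < B) (gA : graph_at B w ga Ga) (gB : graph_at B w gb Gb).
Hypothesis NB : nvert (rev_prod Ga Gb) <= B.
Let na := nvert Ga.
Let nb := nvert Gb.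

Lemma bits4_eq (h t : 'I_nb) (b : 'I_4) : [/\
  ((h, (bits4 b).1, (bits4 b).2) == (t, false, false)) = (h == t :> nat) && (b == 0 :> nat),
  ((h, (bits4 b).1, (bits4 b).2) == (t, false, true)) = (h == t :> nat) && (b == 1 :> nat),
  ((h, (bits4 b).1, (bits4 b).2) == (t, true, false)) = (h == t :> nat) && (b == 2 :> nat)
& ((h, (bits4 b).1, (bits4 b).2) == (t, true, true)) = (h == t :> nat) && (b == 3 :> nat)].
Proof.
rewrite !xpair_eqE -val_eqE /=; case: b => [[|[|[|[|b]]]] //= _];
  by rewrite ?andbF ?andbT.
Qed.

Lemma computes_rev r s ci cj (i j : 'I_(nvert (rev_prod Ga Gb))) : mem_is w s ->
  computes B r s ci i -> computes B r s cj j ->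
  computes B r s (c_rev ga gb ci cj) (edge i j).
Proof.
move=> ms Hi Hj; have Hn := computes_gn gB (r := r) ms.
have nB : nb <= B by case: gB.
have Hc k : computes B r s (c_const k) k by apply: computes_const.
have Hm : computes B r s (c_mul (gn gb) (c_const 4)) (nb * 4) by apply: computes_mul.
have Ht := computes_sink B0 gB (r := r) ms.
pose di := divmod (i : 'I_(na * (nb * 4))); pose dj := divmod (j : 'I_(na * (nb * 4))).
pose u := di.1; pose v := dj.1.
pose h := (divmod dj.2).1; pose g := (divmod di.2).1.
pose b := (divmod dj.2).2; pose a := (divmod di.2).2.
have iB : i <= B by apply: ltnW; apply: leq_trans (ltn_ord i) NB.
have jB : j <= B by apply: ltnW; apply: leq_trans (ltn_ord j) NB.
have n4 : 0 < nb * 4 by have := nvert_gt0 Gb; rewrite /nb; lia.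
have Hu : computes B r s (c_div ci (c_mul (gn gb) (c_const 4))) u by apply: computes_div.
have Hv : computes B r s (c_div cj (c_mul (gn gb) (c_const 4))) v by apply: computes_div.
have Hl : computes B r s (c_mod ci (c_mul (gn gb) (c_const 4))) di.2 by apply: computes_mod.
have Hl' : computes B r s (c_mod cj (c_mul (gn gb) (c_const 4))) dj.2 by apply: computes_mod.
have lB : di.2 <= B by apply: leq_trans (leq_mod _ _) iB.
have lB' : dj.2 <= B by apply: leq_trans (leq_mod _ _) jB.
have Hg : computes B r s (c_div (c_mod ci (c_mul (gn gb) (c_const 4))) (c_const 4)) g.
  exact: computes_div.
have Ha : computes B r s (c_mod (c_mod ci (c_mul (gn gb) (c_const 4))) (c_const 4)) a.
  exact: computes_mod.
have Hh : computes B r s (c_div (c_mod cj (c_mul (gn gb) (c_const 4))) (c_const 4)) h.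
  exact: computes_div.
have Hb : computes B r s (c_mod (c_mod cj (c_mul (gn gb) (c_const 4))) (c_const 4)) b.
  exact: computes_mod.
have -> : edge i j = gate_edge (@edge Ga) (first_pred (@edge Ga)) (@rev_el Gb)
   (rev_z Gb) (rev_p Gb) (rev_q Gb) (rev_c Gb)
   (u, (g, (bits4 a).1, (bits4 a).2)) (v, (h, (bits4 b).1, (bits4 b).2)) by [].
clearbody u v g h a b; clear di dj Hl Hl' lB lB' Hi Hj iB jB i j Hm.
rewrite /gate_edge [(u, _).1]/= [(v, _).1]/= [(u, _).2]/= [(v, _).2]/=.
rewrite /rev_p /rev_q /rev_c /rev_z.
have [_ -> -> ->] := bits4_eq h (sink Gb) b; have [-> -> -> ->] := bits4_eq g (sink Gb) a.
rewrite -val_eqE [val u]/= [val v]/=.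
have Huv := computes_eq B0 Hu Hv.
have at_ cx cy x y k : computes B r s cx x -> computes B r s cy y ->
    computes B r s (c_and (c_eq cx (c_sink gb)) (c_eq cy (c_const k)))
      ((x == sink Gb :> nat) && (y == k)).
  by move=> Hx Hy; apply: (computes_and B0) => [|_]; apply: (computes_eq B0).
apply: (computes_ifb B0); [exact: at_ | move=> _ | move=> b0].
  apply: (computes_or B0); first by apply: (computes_and B0) => // _; apply: at_.
  by apply: (computes_and B0) => [|_]; [apply: at_ | apply: (computes_first B0 gA)].
apply: (computes_ifb B0); [exact: at_ | move=> _ | move=> b1].
  by apply: (computes_and B0) => [|_]; [apply: at_ | apply: (computes_ge B0 gA)].
apply: (computes_ifb B0); [exact: at_ | move=> _ | move=> b2].
  by apply: (computes_and B0) => // _; apply: (computes_or B0); apply: at_.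
by apply: (computes_and B0) => // _; apply: (computes_chain B0 gB).
Qed.

End RevCode.

Definition c_otimes (ga gb : gcode) (ci cj : code) : code :=
  let four := c_const 4 in
  c_if (c_eq (gn gb) (c_const 1))
    (c_chain ga (c_div ci four) (c_mod ci four) (c_div cj four) (c_mod cj four))
    (c_rev ga gb ci cj).

(* Stated for abstract [ga] and [gb]: on closed codes the comparison would
   evaluate the costs, which are unary numbers in the tens of thousands. *)
Lemma cost_otimes ga gb ci cj ci' cj' : cost ci = cost ci' -> cost cj = cost cj' ->
  cost (c_otimes ga gb ci cj) = cost (c_otimes ga gb ci' cj').
Proof. by case: ci ci' cj cj' => [? ?] [? ?] [? ?] [? ?] /= <- <-. Qed.

Lemma otimes_poly_time : poly_time_constructible otimes.
Proof.
apply: (@poly_time_code _ (c_mul (gn g1) (c_mul (gn g2) (c_const 4)))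
  (fun x y => c_otimes g1 g2 (c_var x) (c_var y))) => [x y|G1 G2 w B]; first exact: cost_otimes.
have B0 := bound_gt0 G1 G2; rewrite -/w -/B in B0.
have A1 : graph_at B w g1 G1 := graph_at1 G1 G2.
have A2 : graph_at B w g2 G2 := graph_at2 G1 G2.
have NB : nvert G1 * (nvert G2 * 4) <= B by rewrite /B size_word; nia.
have [n1B _] := A1; have [n2B _] := A2.
have HN r s : mem_is w s ->
    computes B r s (c_mul (gn g1) (c_mul (gn g2) (c_const 4))) (nvert G1 * (nvert G2 * 4)).
  move=> ms; apply: (computes_mul B0) => //; first exact: (computes_gn A1).
  by apply: (computes_mul B0) => //; [exact: (computes_gn A2) | exact: computes_const].
have Hc r s : mem_is w s -> computes B r s (c_eq (gn g2) (c_const 1)) (nvert G2 == 1).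
  by move=> ms; apply: (computes_eq B0); [apply: (computes_gn A2) | apply: computes_const].
rewrite /otimes; case: eqP => n2 /=.
  (* The same vertex count serves both branches, as it specialises to 4 n1 when G2 is a single
     vertex. *)
  rewrite n2 mul1n in NB HN; split=> // r s ms; split; first exact: HN.
  move=> x y i j xr yr xi yj; apply: (computes_if B0 (Hc r s ms)); rewrite n2 //= => _.
  apply: (computes_sub2 B0 A1) => //.
    by rewrite -[X in computes _ _ _ _ X]xi; apply: computes_var.
  by rewrite -[X in computes _ _ _ _ X]yj; apply: computes_var.
split=> // r s ms; split; first exact: HN.
move=> x y i j xr yr xi yj; apply: (computes_if B0 (Hc r s ms)); case: eqP => //= _ _.
apply: (computes_rev B0 A1 A2) => //.
  by rewrite -[X in computes _ _ _ _ X]xi; apply: computes_var.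
by rewrite -[X in computes _ _ _ _ X]yj; apply: computes_var.
Qed.

Definition c_boxtimes (ga gb : gcode) (ci cj : code) : code :=
  c_if (c_deg2 gb) (c_std ga gb ci cj)
    (c_if (c_deg2 ga) (c_std gb ga ci cj) (c_lt ci cj)).

Lemma cost_boxtimes ga gb ci cj ci' cj' : cost ci = cost ci' -> cost cj = cost cj' ->
  cost (c_boxtimes ga gb ci cj) = cost (c_boxtimes ga gb ci' cj').
Proof. by case: ci ci' cj cj' => [? ?] [? ?] [? ?] [? ?] /= <- <-. Qed.

Lemma boxtimes_poly_time : poly_time_constructible boxtimes.
Proof.
pose big g := c_lt (c_const 1) (gn g).
apply: (@poly_time_code _
  (c_if (c_deg2 g2) (c_mul (gn g1) (c_add (gn g2) (c_const 3)))
   (c_if (c_deg2 g1) (c_mul (gn g2) (c_add (gn g1) (c_const 3)))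
     (c_add (c_add (big g1) (big g2)) (c_const 1))))
  (fun x y => c_boxtimes g1 g2 (c_var x) (c_var y))) => [x y|G1 G2 w B]; first exact: cost_boxtimes.
have B0 := bound_gt0 G1 G2; rewrite -/w -/B in B0.
have A1 : graph_at B w g1 G1 := graph_at1 G1 G2.
have A2 : graph_at B w g2 G2 := graph_at2 G1 G2.
have N12 : nvert G1 * (nvert G2 + 3) <= B by rewrite /B size_word; nia.
have N21 : nvert G2 * (nvert G1 + 3) <= B by rewrite /B size_word; nia.
have B3 : 3 <= B by rewrite /B size_word; lia.
have [n1B _] := A1; have [n2B _] := A2.
have Hx r s x y : x < r -> cell s x.*2 = y -> computes B r s (c_var x) y.
  by move=> xr <-; apply: computes_var.
(* [c_deg2] yields a count and not a truth value, so only its positivity is used. *)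
have if_true r s g G c1 c2 m : graph_at B w g G -> mem_is w s -> deg2 G ->
    computes B r s c1 m -> computes B r s (c_if (c_deg2 g) c1 c2) m.
  move=> AG ms dG H; have [k Hk kE] := computes_deg2 B0 AG r ms.
  by apply: (computes_if B0 Hk) => // k0; move: dG; rewrite -kE k0.
have if_false r s g G c1 c2 m : graph_at B w g G -> mem_is w s -> ~~ deg2 G ->
    computes B r s c2 m -> computes B r s (c_if (c_deg2 g) c1 c2) m.
  move=> AG ms dG H; have [k Hk kE] := computes_deg2 B0 AG r ms.
  by apply: (computes_if B0 Hk) => // k0; move: dG; rewrite -kE k0.
rewrite /boxtimes; case: ifP => [d2|/negbT d2] /=.
  split=> // r s ms; split=> [|x y i j xr yr xi yj]; apply: (if_true _ _ _ _ _ _ _ A2) => //.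
    apply: (computes_mul B0) => //; first exact: (computes_gn A1).
    by apply: (computes_add B0); [apply: (computes_gn A2) | apply: computes_const].
  by apply: (computes_std B0 A1 A2) => //; apply: Hx.
case: ifP => [d1|/negbT d1] /=.
  split=> // r s ms; split=> [|x y i j xr yr xi yj];
    apply: (if_false _ _ _ _ _ _ _ A2) => //; apply: (if_true _ _ _ _ _ _ _ A1) => //.
    apply: (computes_mul B0) => //; first exact: (computes_gn A2).
    by apply: (computes_add B0); [apply: (computes_gn A1) | apply: computes_const].
  by apply: (computes_std B0 A2 A1) => //; apply: Hx.
split; first by apply: leq_trans B3; case: (1 < nvert G1); case: (1 < nvert G2).
move=> r s ms; split=> [|x y i j xr yr xi yj];
  apply: (if_false _ _ _ _ _ _ _ A2) => //; apply: (if_false _ _ _ _ _ _ _ A1) => //.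
  rewrite -[X in computes _ _ _ _ X]addn1; apply: (computes_add B0); last exact: computes_const.
  apply: (computes_add B0); apply: (computes_lt B0);
    by [apply: computes_const | apply: (computes_gn A1) | apply: (computes_gn A2)].
by apply: (computes_lt B0); apply: Hx.
Qed.

Theorem theorem3p5 :
  exists boxtimes otimes : ssdag -> ssdag -> ssdag,
    [/\ poly_time_constructible boxtimes,
        poly_time_constructible otimes
      & exists C : nat, forall G1 G2 : ssdag,
          [/\ nvert (boxtimes G1 G2) <= C * (nvert G1 + nvert G2) ^ 2,
              nvert (otimes G1 G2) <= C * (nvert G1 + nvert G2) ^ 2,
              Peb (boxtimes G1 G2) = Peb G1 + Peb G2 - 1
            & RPeb (otimes G1 G2) = RPeb G1 + RPeb G2 + 1]].
Proof.
exists boxtimes, otimes; split; [exact: boxtimes_poly_time | exact: otimes_poly_time |].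
exists 4 => G1 G2; split; [exact: nvert_boxtimes | exact: nvert_otimes
  | exact: Peb_boxtimes | exact: RPeb_otimes].
Qed.
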